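(* Let $f:\mathbb{R}^d\to[0,\infty)$ be continuous, log-concave and symmetric ($f(-x)=f(x)$). Let $\Sigma$ be a $d\times d$ symmetric positive definite matrix and $\varphi:[0,\infty)\to[0,\infty)$ a continuous non-increasing function. Then $$\int_{\mathbb{R}^d} f(x)\,\varphi(\langle\Sigma x,x\rangle)\,\mathrm{d}\gamma_d(x)\ \ge\ \Big(\int_{\mathbb{R}^d} f\,\mathrm{d}\gamma_d\Big)\Big(\int_{\mathbb{R}^d}\varphi(\langle\Sigma x,x\rangle)\,\mathrm{d}\gamma_d(x)\Big).$$
   Context: $\gamma_d$ is the standard Gaussian measure on $\mathbb{R}^d$. A function $f\ge0$ is log-concave if $f(\lambda x+(1-\lambda)y)\ge f(x)^\lambda f(y)^{1-\lambda}$ for all $x,y\in\mathbb{R}^d$ and $\lambda\in(0,1)$. *)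

(* Defs.v *)
From HB Require Import structures.
From mathcomp Require Import all_boot all_order all_algebra.
From mathcomp Require Import all_classical all_reals all_analysis.
Set Implicit Arguments. Unset Strict Implicit. Unset Printing Implicit Defensive.
Import Order.TTheory GRing.Theory Num.Theory.
Import numFieldNormedType.Exports.
Local Open Scope ring_scope.
Local Open Scope ereal_scope.

(* Integral of a nonnegative function g : R^d -> \bar R against the standard
   Gaussian measure gamma_d = N(0,1)^{\otimes d}, points of R^d being row
   vectors 'rV[R]_d.  Since the library has no product measure on R^d, it is
   defined as the iterated integral over the coordinates, each against the
   standard normal probability on R (Tonelli: equals the product-measure
   integral for nonnegative measurable integrands). *)
Fixpoint gauss_int {R : realType} (n : nat) : ('rV[R]_n -> \bar R) -> \bar R :=
  match n with
  | 0 => fun g => g 0%R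
  | n'.+1 => fun g =>
      \int[normal_prob (0:R) 1]_x
        gauss_int (fun t : 'rV[R]_n' => g (row_mx (const_mx x : 'rV[R]_1) t))
  end.

Definition qform {R : realType} (d : nat) (S : 'M[R]_d) (x : 'rV[R]_d) : R :=
  (x *m S *m x^T)%R ord0 ord0.

Definition log_concave {R : realType} (d : nat) (f : 'rV[R]_d -> R) : Prop :=
  forall (x y : 'rV[R]_d) (l : R), (0 < l < 1)%R ->
    (f x `^ l * f y `^ (1 - l) <= f (l *: x + (1 - l) *: y))%R.

(* Main.v *)
Require Import Defs.
From HB Require Import structures.
From mathcomp Require Import all_boot all_order all_algebra.
From mathcomp Require Import all_classical all_reals all_analysis.
From mathcomp Require Import measurable_realfun ring lra.

Set Implicit Arguments.
Unset Strict Implicit.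
Unset Printing Implicit Defensive.

Import Order.TTheory GRing.Theory Num.Theory.
Import numFieldNormedType.Exports.
Local Open Scope classical_set_scope.
Local Open Scope ring_scope.

(* Harge's argument.  By rotation invariance, <Sigma x, x> may be taken to be
   T x = \sum_i s_i x_i^2.  Let P_k be the k-step operator of the chain replacing x_i by
   a_i x_i + b_i z_i, with z an independent Gaussian vector, s_i b_i^2 = 2 del^2
   and a_i^2 + b_i^2 = 1: a discretized Ornstein-Uhlenbeck semigroup with
   diffusion matrix Sigma^-1, reversible for the Gaussian measure.  Since
   Sigma^-1 grad T = 2 x, one step changes E[P_k f * p(T)], up to O(del^3),
   by a negative multiple of the integral of p'(T) <x, grad P_k f>.
   By Prekopa's theorem P_k f is log-concave and even, hence decreasing along
   rays, so that with p' <= 0 the quantity E[P_k f * p(T)] decreases, from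
   E[f * p(T)] to E[f] E[p(T)].  The radial integration by parts is carried out
   by differentiating in l the image of the measure - p'(T) dgamma under
   x |-> x / l.  A general phi is squeezed between p and a translate of p, where
   p is the average of phi over three successive windows. *)

(** * One-dimensional Gaussian integrals *)

Section affine.
Context {R : realType}.
Local Notation leb := (@lebesgue_measure R).
Local Open Scope ereal_scope.

(** Only continuity of [f] is available, so neither [f] nor its averages are ever differentiated.
    Reversibility moves each step from [f] to [p (T x)], where Taylor's formula for a function of
    one real variable applies; what is kept of the log-concavity of the averaged [f] is its
    monotonicity along rays, which a comparison of two dilates can use without a gradient. Discrete
    steps replace semigroup theory: a step costs O(del^3), while [k] steps contract the i-th
    coordinate by (1 - 2 del^2 / s_i)^(k/2). The chain equilibrates once k del^2 is large, and the
    total error is negligible once k del^3 is small; both can be had together. The noise levels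
    depend on i because the increment of T then has the drift part 2 del^2 (|z|^2 - |x|^2), in which
    s no longer appears. Composition of steps, reversibility and rotation invariance all rest on one
    reflection (x, z) -> (p x + q z, q x - p z), which is its own inverse. *)

Lemma measurable_affine (c e : R) : measurable_fun setT (fun x : R => (c * x + e)%R).
Proof. by apply: measurable_funD => //; exact: measurable_funM. Qed.

(** Uniqueness of Lebesgue measure: the scaled pushforward has the right value on half-open
    intervals. For [c < 0] the preimage is closed at the other end, which does not change its
    length. *)
Lemma lebesgue_measure_affine (c e : R) (A : set R) : c != 0%R -> measurable A ->
  leb A = (`|c|%:E * leb [set x | A (c * x + e)%R]).
Proof.
move=> c0 mA.
pose F : measurableTypeR R -> measurableTypeR R := fun x => (c * x + e)%R.
have mF : measurable_fun setT F by exact: measurable_affine.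
have nc0 : (0 < `|c|)%R by rewrite normr_gt0.
pose pf := pushforward leb F : {measure set (measurableTypeR R) -> \bar R}.
pose nc : {nonneg R} := NngNum (ltW nc0).
pose m : {measure set (measurableTypeR R) -> \bar R} := mscale nc (pf mF).
apply: (@lebesgue_measure_unique _ m) => // _ [[a b] _ <-] /=.
rewrite /m /mscale /= /pushforward /=.
have [cp|cn|] := ltgtP 0%R c; last by move/eqP; rewrite eq_sym (negbTE c0).
- have -> : F @^-1` `]a, b] = `]((a - e) / c)%R, ((b - e) / c)%R]%classic.
    apply/seteqP; split => x /=; rewrite !in_itv/= /F ltr_pdivrMr// ler_pdivlMr//;
      rewrite ltrBlDr lerBrDr; by rewrite (mulrC x).
  rewrite !lebesgue_measure_itv/= !lte_fin ltr_pM2r ?invr_gt0// ltrD2r.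
  case: ifP => _; last by rewrite mule0.
  rewrite -!EFinB -EFinM; congr EFin; rewrite gtr0_norm//; field; exact: lt0r_neq0.
- have -> : F @^-1` `]a, b] = `[((b - e) / c)%R, ((a - e) / c)%R[%classic.
    apply/seteqP; split => x /=; rewrite !in_itv/= /F ltr_ndivlMr// ler_ndivrMr//;
      rewrite ltrBlDr lerBrDr andbC; by rewrite (mulrC x).
  rewrite !lebesgue_measure_itv/= !lte_fin ltr_nM2r ?invr_lt0// ltrD2r.
  case: ifP => _; last by rewrite mule0.
  rewrite -!EFinB -EFinM; congr EFin; rewrite ltr0_norm//; field; exact: ltr0_neq0.
Qed.

Lemma ge0_integral_affine (c e : R) (g : R -> \bar R) : c != 0%R ->
  measurable_fun setT g -> (forall x, 0 <= g x) ->
  \int[leb]_x g x = `|c|%:E * \int[leb]_x g (c * x + e)%R.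
Proof.
move=> c0 mg g0.
pose F : measurableTypeR R -> measurableTypeR R := fun x => (c * x + e)%R.
have mF : measurable_fun setT F by exact: measurable_affine.
have nc0 : (0 < `|c|)%R by rewrite normr_gt0.
pose pf := pushforward leb F : {measure set (measurableTypeR R) -> \bar R}.
pose nc : {nonneg R} := NngNum (ltW nc0).
pose m : {measure set (measurableTypeR R) -> \bar R} := mscale nc (pf mF).
rewrite (@eq_measure_integral _ _ _ _ m); last first.
  move=> A mA _; first [exact: lebesgue_measure_affine|exact/esym/lebesgue_measure_affine].
rewrite ge0_integral_mscale//=; congr (_ * _).
by rewrite ge0_integral_pushforward.
Qed.

End affine.

Section density.
Context {R : realType}.
Local Notation leb := (@lebesgue_measure R).
Local Notation gam := (normal_prob (0:R) 1).
Local Open Scope ereal_scope.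

Import HBNNSimple.

Lemma normal01_pdfE (x : R) :
  normal_pdf 0 1 x = (normal_peak 1 * expR (- (x ^+ 2 / 2)))%R.
Proof.
by rewrite normal_pdfE ?oner_neq0// /normal_fun subr0 expr1n mulNr.
Qed.

(** [normal_prob] is given by its density on sets only, so the formula is passed from indicators to
    simple functions and then, by monotone convergence, to [g]. *)
Lemma integral_normal01 (g : measurableTypeR R -> \bar R) :
  measurable_fun setT g -> (forall x, 0 <= g x) ->
  \int[gam]_x g x = \int[leb]_x (g x * (normal_pdf 0 1 x)%:E).
Proof.
move=> mg g0.
have mp : measurable_fun setT (fun x : measurableTypeR R => (normal_pdf 0 1 x)%:E).
  by apply/measurable_EFinP; exact: measurable_normal_pdf.
have p0 (x : R) : 0 <= (normal_pdf 0 1 x)%:E by rewrite lee_fin normal_pdf_ge0.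
pose h := nnsfun_approx measurableT mg.
have mh n : measurable_fun setT (h n : measurableTypeR R -> R) by exact: measurable_funPT.
have hg x : g x = limn (fun n => (h n x)%:E).
  by apply/esym/cvg_lim => //; exact: cvg_nnsfun_approx.
transitivity (limn (fun n => \int[gam]_x (h n x)%:E)).
  rewrite -monotone_convergence//.
  - by apply: eq_integral => x _; exact: hg.
  - by move=> n; apply/measurable_EFinP; exact: mh.
  - by move=> n x _; rewrite lee_fin; exact: fun_ge0.
  - by move=> x _ m n mn; rewrite lee_fin; exact/lefP/nd_nnsfun_approx.
transitivity (limn (fun n => \int[leb]_x ((h n x)%:E * (normal_pdf 0 1 x)%:E))); last first.
  rewrite -monotone_convergence//.
  - apply: eq_integral => x _; apply/cvg_lim => //.
    apply: cvgeZr => //; exact: cvg_nnsfun_approx.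
  - move=> n; apply: emeasurable_funM => //; apply/measurable_EFinP; exact: mh.
  - by move=> n x _; apply: mule_ge0 => //; rewrite lee_fin; exact: fun_ge0.
  - move=> x _ m n mn; apply: lee_wpmul2r => //.
    by rewrite lee_fin; exact/lefP/nd_nnsfun_approx.
congr (limn _); apply/funext => n.
under eq_integral do rewrite fimfunE -fsumEFin//.
rewrite ge0_integral_fsum//; last 2 first.
- by move=> r; exact/measurable_EFinP/measurable_funM.
- by move=> r x _; rewrite nnfun_muleindic_ge0.
transitivity (\int[leb]_x (\sum_(r \in range (h n))
    (r * \1_(h n @^-1` [set r]) x)%:E * (normal_pdf 0 1 x)%:E)); last first.
  apply: eq_integral => x _; rewrite fimfunE -fsumEFin// ge0_mule_fsuml// => r.
  by rewrite nnfun_muleindic_ge0.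
rewrite ge0_integral_fsum//; last 2 first.
- move=> r; apply: emeasurable_funM => //; exact/measurable_EFinP/measurable_funM.
- by move=> r x _; apply: mule_ge0 => //; rewrite nnfun_muleindic_ge0.
apply: eq_fsbigr => r _.
have mA : measurable (h n @^-1` [set r]) by exact: measurable_funPTI.
(* The terms are compared for every real [r]; a negative one has an empty fibre because [h n] is
   nonnegative. *)
have [r0|r0] := leP 0%R r; last first.
  have A0 x : (\1_(h n @^-1` [set r]) x = 0 :> R)%R.
    rewrite indicE memNset//= => hr; have : (0 <= h n x)%R by exact: fun_ge0.
    by rewrite hr leNgt r0.
  rewrite !integral0_eq//= => x _; by rewrite A0 mulr0 ?mul0e.
under eq_integral do rewrite EFinM.
rewrite ge0_integralZl//; last by apply/measurable_EFinP.
rewrite integral_indic// setIT.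
under [RHS]eq_integral do rewrite EFinM -muleA.
rewrite ge0_integralZl//; last 2 first.
- by apply: emeasurable_funM => //; apply/measurable_EFinP.
- by move=> x _; apply: mule_ge0.
congr (_ * _).
rewrite [LHS]integral_mkcond; apply: eq_integral => x _.
by rewrite epatch_indic muleC.
Qed.
End density.
Section gauss1.
Context {R : realType}.
Local Notation leb := (@lebesgue_measure R).
Local Notation gR := (measurableTypeR R).
Local Notation gam := (normal_prob (0:R) 1).
Local Open Scope ereal_scope.

Lemma measurable_lin2 (p q : R) :
  measurable_fun setT (fun x : gR * gR => (p * x.1 + q * x.2)%R).
Proof. by apply: measurable_funD; apply: measurable_funM. Qed.

(** Two one-dimensional substitutions with a Tonelli swap between them: u = p x + q z at fixed x,
    then x = p u + q v at fixed u. The Jacobians [|q^-1|] and [|q|] cancel, and p^2 + q^2 = 1 turns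
    z into q u - p v. *)
Lemma lebesgue_reflection (p q : R) (h : gR * gR -> \bar R) :
  q != 0%R -> (p ^+ 2 + q ^+ 2 = 1)%R ->
  measurable_fun setT h -> (forall x, 0 <= h x) ->
  \int[leb]_x \int[leb]_z h (x, z) =
  \int[leb]_x \int[leb]_z h ((p * x + q * z)%R, (q * x - p * z)%R).
Proof.
move=> q0 pq mh h0.
have q'0 : (q^-1 != 0)%R by rewrite invr_eq0.
have nq0 : 0 <= `|q^-1|%:E by rewrite lee_fin.
have mh2 (a b : gR * gR -> R) : measurable_fun setT a -> measurable_fun setT b ->
    measurable_fun setT (fun x => h (a x, b x)).
  move=> ma mb; apply: (measurableT_comp mh); exact: measurable_fun_pair.
have mh1 (a b : gR -> R) : measurable_fun setT a -> measurable_fun setT b ->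
    measurable_fun setT (fun x => h (a x, b x)).
  move=> ma mb; apply: (measurableT_comp mh); exact: measurable_fun_pair.
transitivity (\int[leb]_x \int[leb]_u
    (`|q^-1|%:E * h (x, (q^-1 * u - q^-1 * p * x)%R))).
  apply: eq_integral => x _.
  rewrite (@ge0_integral_affine _ q^-1 (- (q^-1 * p * x)) (fun z => h (x, z)))//.
    rewrite -ge0_integralZl//.
    by apply: mh1 => //; exact: measurable_affine.
  exact: mh1.
rewrite (fubini_tonelli (fun x : gR * gR =>
   `|q^-1|%:E * h (x.1, (q^-1 * x.2 - q^-1 * p * x.1)%R)))//=; last 2 first.
- apply: emeasurable_funM => //; apply: mh2 => //.
  by apply: measurable_funB; apply: measurable_funM.
- by move=> x; apply: mule_ge0.
apply: eq_integral => u _.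
rewrite ge0_integralZl//; last first.
  apply: mh1 => //; apply: measurable_funB => //; exact: measurable_funM.
rewrite (@ge0_integral_affine _ q (p * u)
  (fun x => h (x, (q^-1 * u - q^-1 * p * x)%R)))//; last first.
  apply: mh1 => //; apply: measurable_funB => //; exact: measurable_funM.
rewrite muleA -EFinM -normrM mulVf// normr1 mul1e.
apply: eq_integral => v _; congr (h (_, _)); first by rewrite addrC.
transitivity (q^-1 * (1 - p ^+ 2) * u - p * v)%R; first by field.
have -> : (1 - p ^+ 2 = q ^+ 2)%R by rewrite -pq; ring.
by field.
Qed.

Lemma measurable_int2 (m : {sigma_finite_measure set gR -> \bar R})
  (h : gR * gR -> \bar R) : measurable_fun setT h -> (forall x, 0 <= h x) ->
  measurable_fun setT (fun x => \int[m]_z h (x, z)).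
Proof. by move=> mh h0; exact: (@measurable_fun_fubini_tonelli_F _ _ _ _ _ m h). Qed.

Lemma integral_normal01_2 (h : gR * gR -> \bar R) :
  measurable_fun setT h -> (forall x, 0 <= h x) ->
  \int[gam]_x \int[gam]_z h (x, z) =
  \int[leb]_x \int[leb]_z (h (x, z) * (normal_pdf 0 1 x * normal_pdf 0 1 z)%:E).
Proof.
move=> mh h0.
have mp : measurable_fun setT (fun x : gR => (normal_pdf 0 1 x)%:E).
  by apply/measurable_EFinP; exact: measurable_normal_pdf.
have p0 (x : R) : 0 <= (normal_pdf 0 1 x)%:E by rewrite lee_fin normal_pdf_ge0.
have mh1 x : measurable_fun setT (fun z => h (x, z)).
  by apply: (measurableT_comp mh); exact: measurable_fun_pair.
rewrite integral_normal01; last 2 first.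
- exact: measurable_int2.
- by move=> x; exact: integral_ge0.
apply: eq_integral => x _.
rewrite integral_normal01// -ge0_integralZr//; last 2 first.
- by apply: emeasurable_funM.
- by move=> z _; apply: mule_ge0.
by apply: eq_integral => z _; rewrite -muleA -EFinM [(_ * normal_pdf 0 1 x)%R]mulrC.
Qed.

(** The product density depends on x^2 + z^2 only, which the map preserves. A reflection is used
    rather than a rotation because it is an involution, which makes reversibility of the chain
    immediate. *)
Lemma normal01_reflection (p q : R) (h : gR * gR -> \bar R) :
  q != 0%R -> (p ^+ 2 + q ^+ 2 = 1)%R ->
  measurable_fun setT h -> (forall x, 0 <= h x) ->
  \int[gam]_x \int[gam]_z h (x, z) =
  \int[gam]_x \int[gam]_z h ((p * x + q * z)%R, (q * x - p * z)%R).
Proof.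
move=> q0 pq mh h0.
have mp2 : measurable_fun setT
    (fun x : gR * gR => (normal_pdf 0 1 x.1 * normal_pdf 0 1 x.2)%:E).
  apply/measurable_EFinP; apply: measurable_funM;
    by apply: (measurableT_comp (measurable_normal_pdf _ _)).
pose h' (x : gR * gR) := h ((p * x.1 + q * x.2)%R, (q * x.1 - p * x.2)%R).
have mh' : measurable_fun setT h'.
  apply: (measurableT_comp mh); apply: measurable_fun_pair => /=.
    exact: measurable_lin2.
  by apply: measurable_funB; apply: measurable_funM.
have h'0 x : 0 <= h' x by exact: h0.
pose H x := h x * (normal_pdf 0 1 x.1 * normal_pdf 0 1 x.2)%:E.
have mH : measurable_fun setT H by exact: emeasurable_funM.
have H0 x : 0 <= H x.
  by apply: mule_ge0 => //; rewrite lee_fin mulr_ge0// normal_pdf_ge0.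
rewrite (integral_normal01_2 mh h0) [RHS](integral_normal01_2 mh' h'0).
rewrite [LHS](lebesgue_reflection q0 pq mH H0).
apply: eq_integral => x _; apply: eq_integral => z _; congr (_ * _%:E) => /=.
rewrite !normal01_pdfE mulrACA -expRD [RHS]mulrACA -expRD; congr (_ * expR _)%R.
have -> : (x ^+ 2 = (p ^+ 2 + q ^+ 2) * x ^+ 2)%R by rewrite pq mul1r.
have -> : (z ^+ 2 = (p ^+ 2 + q ^+ 2) * z ^+ 2)%R by rewrite pq mul1r.
by field.
Qed.

(** The weight is the density, relative to the Gaussian, of its image under x |-> c x. *)
Lemma normal01_scale (c : R) (g : gR -> \bar R) : (0 < c)%R ->
  measurable_fun setT g -> (forall x, 0 <= g x) ->
  \int[gam]_x g (c * x)%R =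
  \int[gam]_x (g x * (c^-1 * expR ((1 - c ^- 2) * x ^+ 2 / 2))%:E).
Proof.
move=> c0 mg g0.
have mp : measurable_fun setT (fun x : gR => (normal_pdf 0 1 x)%:E).
  by apply/measurable_EFinP; exact: measurable_normal_pdf.
have p0 (x : R) : 0 <= (normal_pdf 0 1 x)%:E by rewrite lee_fin normal_pdf_ge0.
have mgc : measurable_fun setT (fun x : gR => g (c * x)%R).
  by apply: (measurableT_comp mg); exact: measurable_funM.
have mE : measurable_fun setT
   (fun x : gR => (c^-1 * expR ((1 - c ^- 2) * x ^+ 2 / 2))%:E).
  apply/measurable_EFinP; apply: measurable_funM => //.
  apply: (measurableT_comp (@measurable_expR R)).
  by apply: measurable_funM => //; apply: measurable_funM => //; exact: exprn_measurable.
rewrite integral_normal01// integral_normal01//; last 2 first.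
- exact: emeasurable_funM.
- by move=> x; rewrite mule_ge0// lee_fin mulr_ge0 ?expR_ge0// invr_ge0 ltW.
rewrite [RHS](@ge0_integral_affine _ c 0 (fun x =>
   g x * (c^-1 * expR ((1 - c ^- 2) * x ^+ 2 / 2))%:E * (normal_pdf 0 1 x)%:E)); last 3 first.
- exact: lt0r_neq0.
- by apply: emeasurable_funM => //; exact: emeasurable_funM.
- move=> x; rewrite mule_ge0//.
  by rewrite mule_ge0// lee_fin mulr_ge0 ?expR_ge0// invr_ge0 ltW.
rewrite -ge0_integralZl//; last 2 first.
- apply: emeasurable_funM; last first.
    by apply: (measurableT_comp mp); exact: measurable_affine.
  apply: emeasurable_funM; last first.
    by apply: (measurableT_comp mE); exact: measurable_affine.
  by apply: (measurableT_comp mg); exact: measurable_affine.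
- move=> x _; rewrite mule_ge0//.
  by rewrite mule_ge0// lee_fin mulr_ge0 ?expR_ge0// invr_ge0 ltW.
apply: eq_integral => x _; rewrite addr0 -[X in _ = _ * X]muleA [RHS]muleCA -!EFinM; congr (_ * _%:E).
rewrite !normal01_pdfE gtr0_norm// !mulrA divff ?lt0r_neq0// mul1r.
rewrite mulrAC [in RHS]mulrC mulrA mulrAC -mulrA -expRD mulrC; congr (_ * expR _)%R.
field; exact: lt0r_neq0.
Qed.

Lemma normal01_opp (g : gR -> \bar R) :
  measurable_fun setT g -> (forall x, 0 <= g x) ->
  \int[gam]_x g (- x)%R = \int[gam]_x g x.
Proof.
move=> mg g0.
have mp : measurable_fun setT (fun x : gR => (normal_pdf 0 1 x)%:E).
  by apply/measurable_EFinP; exact: measurable_normal_pdf.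
have p0 (x : R) : 0 <= (normal_pdf 0 1 x)%:E by rewrite lee_fin normal_pdf_ge0.
have mgc : measurable_fun setT (fun x : gR => g (- x)%R).
  by apply: (measurableT_comp mg).
rewrite !integral_normal01// [RHS](@ge0_integral_affine _ (-1) 0
  (fun x => g x * (normal_pdf 0 1 x)%:E)); last 3 first.
- by rewrite oppr_eq0 oner_neq0.
- exact: emeasurable_funM.
- by move=> x; rewrite mule_ge0.
rewrite normrN1 mul1e; apply: eq_integral => x _.
by rewrite addr0 mulN1r !normal01_pdfE sqrrN.
Qed.

Lemma integral_normal01_cst1 : \int[gam]_x (cst 1 x) = 1.
Proof. by rewrite integral_cst//= probability_setT mule1. Qed.

Lemma normal01_exp2 (c : R) : (0 < c)%R ->
  \int[gam]_x (expR ((1 - c ^- 2) * x ^+ 2 / 2))%:E = c%:E.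
Proof.
move=> c0.
have mE : measurable_fun setT
   (fun x : gR => (expR ((1 - c ^- 2) * x ^+ 2 / 2))%:E).
  apply/measurable_EFinP; apply: (measurableT_comp (@measurable_expR R)).
  by apply: measurable_funM => //; apply: measurable_funM => //; exact: exprn_measurable.
have c'0 : 0 <= (c^-1)%:E by rewrite lee_fin invr_ge0 ltW.
have e : (c^-1)%:E * \int[gam]_x (expR ((1 - c ^- 2) * x ^+ 2 / 2))%:E = 1.
  rewrite -integral_normal01_cst1 -ge0_integralZl//.
  rewrite [RHS](@normal01_scale c (cst 1))//.
  by apply: eq_integral => x _; rewrite mul1e EFinM.
rewrite -[LHS]mul1e -[X in X%:E * _](divff (lt0r_neq0 c0)) EFinM -muleA e.
by rewrite mule1.
Qed.

(** The identity E exp((1 - c^-2) x^2 / 2) = c and 1 + u <= e^u bound the second moment by 2 c^2 /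
    (c + 1), from above for c > 1 and from below for c < 1; both bounds tend to 1 as c does. *)
Lemma normal01_sqr : \int[gam]_x (x ^+ 2)%:E = 1.
Proof.
set m := (X in X = 1).
have m0 : 0 <= m by apply: integral_ge0 => x _; rewrite lee_fin sqr_ge0.
have mE c : measurable_fun setT
   (fun x : gR => (expR ((1 - c ^- 2) * x ^+ 2 / 2))%:E).
  apply/measurable_EFinP; apply: (measurableT_comp (@measurable_expR R)).
  by apply: measurable_funM => //; apply: measurable_funM => //; exact: exprn_measurable.
have mX : measurable_fun setT (fun x : gR => (x ^+ 2)%:E).
  by apply/measurable_EFinP; exact: exprn_measurable.
have up (c : R) : (1 < c)%R -> 1 + ((1 - c ^- 2) / 2)%:E * m <= c%:E.
  move=> c1; have c0 : (0 < c)%R by exact: lt_trans c1.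
  have k0 : (0 <= (1 - c ^- 2) / 2)%R.
    by rewrite divr_ge0// subr_ge0 invf_le1 ?exprn_gt0// exprn_ege1// ltW.
  rewrite -(normal01_exp2 c0) /m -ge0_integralZl//; last first.
    by move=> x _; rewrite lee_fin sqr_ge0.
  rewrite -[X in X + _ <= _]integral_normal01_cst1.
  rewrite -ge0_integralD//; last 2 first.
  - by move=> x _; rewrite -EFinM lee_fin mulr_ge0// sqr_ge0.
  - exact: emeasurable_funM.
  apply: ge0_le_integral => //.
  - by move=> x _; rewrite adde_ge0// -EFinM lee_fin mulr_ge0// sqr_ge0.
  - by apply: emeasurable_funD => //; exact: emeasurable_funM.
  - by move=> x _; rewrite -EFinM -EFinD lee_fin mulrAC expR_ge1Dx.
(* The bound at c = 2 already excludes an infinite moment. *)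
have mfin : m \is a fin_num.
  rewrite ge0_fin_numE// ltNge leye_eq; apply/negP => /eqP my.
  have := up 2%R; rewrite my.
  rewrite gt0_muley ?lte_fin; last first.
    by rewrite divr_gt0// subr_gt0 invf_lt1 ?exprn_gt0// exprn_egt1// ltr1n.
  by rewrite addey// leye_eq => H; have /H : (1 < 2 :> R)%R by rewrite ltr1n.
have mfinE : m = (fine m)%:E by rewrite fineK.
have up2 (c : R) : (1 < c)%R -> (fine m <= 2 * c ^+ 2 / (c + 1))%R.
  move=> c1; have := up c c1; rewrite mfinE -EFinM -EFinD lee_fin => H.
  have c0 : (0 < c)%R by exact: lt_trans c1.
  rewrite ler_pdivlMr ?addr_gt0//.
  have c2 : (0 < (c - 1)%R)%R by rewrite subr_gt0.
  rewrite -(ler_pM2r c2).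
  have -> : (fine m * (c + 1) * (c - 1) = ((1 - c ^- 2) / 2 * fine m) * (2 * c ^+ 2))%R.
    field; exact: lt0r_neq0.
  have -> : (2 * c ^+ 2 * (c - 1) = (c - 1) * (2 * c ^+ 2))%R by ring.
  rewrite ler_pM2r; first by rewrite lerBrDl.
  by rewrite mulr_gt0// exprn_gt0.
have lo (c : R) : (0 < c < 1)%R -> (2 * c ^+ 2 / (c + 1) <= fine m)%R.
  move=> /andP[c0 c1].
  have k0 : (0 <= (c ^- 2 - 1) / 2)%R.
    by rewrite divr_ge0// subr_ge0 invf_ge1 ?exprn_gt0// exprn_ile1 ?ltW.
  have : 1 <= c%:E + ((c ^- 2 - 1) / 2)%:E * m.
    rewrite -(normal01_exp2 c0) /m -ge0_integralZl//; last first.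
      by move=> x _; rewrite lee_fin sqr_ge0.
    rewrite -[X in X <= _]integral_normal01_cst1.
    rewrite -ge0_integralD//; last 2 first.
    - by move=> x _; rewrite -EFinM lee_fin mulr_ge0// sqr_ge0.
    - exact: emeasurable_funM.
    apply: ge0_le_integral => //.
    - by apply: emeasurable_funD => //; exact: emeasurable_funM.
    - move=> x _; rewrite -EFinM -EFinD lee_fin.
      have := expR_ge1Dx ((1 - c ^- 2) * x ^+ 2 / 2).
      have -> : ((c ^- 2 - 1) / 2 * x ^+ 2 = - ((1 - c ^- 2) * x ^+ 2 / 2))%R by ring.
      by lra.
  rewrite mfinE -EFinM -EFinD lee_fin => H.
  rewrite ler_pdivrMr ?addr_gt0//.
  have c2 : (0 < (1 - c)%R)%R by rewrite subr_gt0.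
  rewrite -(ler_pM2r c2).
  have -> : (fine m * (c + 1) * (1 - c) = ((c ^- 2 - 1) / 2 * fine m) * (2 * c ^+ 2))%R.
    field; exact: lt0r_neq0.
  have -> : (2 * c ^+ 2 * (1 - c) = (1 - c) * (2 * c ^+ 2))%R by ring.
  rewrite ler_pM2r; first by rewrite lerBlDl.
  by rewrite mulr_gt0// exprn_gt0.
rewrite mfinE; congr EFin; apply/eqP; rewrite eq_le; apply/andP; split.
- apply/ler_addgt0Pr => e e0.
  apply: (le_trans (up2 (1 + e / 2)%R _)); first by rewrite ltrDl divr_gt0.
  rewrite ler_pdivrMr; last by rewrite addr_gt0// addr_gt0// divr_gt0.
  by nra.
- apply/ler_addgt0Pr => e e0.
  (* At c = 1 - k the lower bound misses 1 by (3 k - 2 k^2) / (2 - k), which is at most 2 k since k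
     <= 1/2. *)
  pose k := (Num.min (e / 4) (1 / 2))%R.
  have ke : (k <= e / 4)%R by rewrite ge_min lexx.
  have k2 : (k <= 1 / 2)%R by rewrite ge_min lexx orbT.
  have k0 : (0 < k)%R by rewrite lt_min !divr_gt0.
  have : (1 <= 2 * (1 - k) ^+ 2 / ((1 - k) + 1) + e)%R.
    rewrite -lerBlDr ler_pdivlMr; last by lra.
    by nra.
  move=> /le_trans; apply; rewrite lerD2r; apply: lo; apply/andP; split; lra.
Qed.

(** The cross term 2 v c x is signed, so it is not integrated: the integrals for v and -v are equal
    by symmetry, and in their sum it cancels pointwise. *)
Lemma normal01_affine_sqr (v c : R) :
  \int[gam]_x ((v * x + c) ^+ 2)%:E = (v ^+ 2 + c ^+ 2)%:E.
Proof.
have mX (v' : R) : measurable_fun setT (fun x : gR => ((v' * x + c) ^+ 2)%:E).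
  apply/measurable_EFinP; apply: (measurableT_comp (@exprn_measurable R _ 2)).
  exact: measurable_affine.
have H0 (v' x : R) : 0 <= ((v' * x + c) ^+ 2)%:E by rewrite lee_fin sqr_ge0.
have e1 : \int[gam]_x ((v * x + c) ^+ 2)%:E = \int[gam]_x ((- v * x + c) ^+ 2)%:E.
  by rewrite -normal01_opp//; under eq_integral do rewrite mulrN -mulNr.
have e2 : \int[gam]_x ((v * x + c) ^+ 2)%:E + \int[gam]_x ((- v * x + c) ^+ 2)%:E =
   (2 * (v ^+ 2 + c ^+ 2))%:E.
  rewrite -ge0_integralD//.
  transitivity (\int[gam]_x ((2 * v ^+ 2)%:E * (x ^+ 2)%:E + (2 * c ^+ 2)%:E)).
    by apply: eq_integral => x _; rewrite -!EFinD; congr EFin; ring.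
  have mX2 : measurable_fun setT (fun x : gR => (x ^+ 2)%:E).
    by apply/measurable_EFinP; exact: exprn_measurable.
  rewrite ge0_integralD//; last 3 first.
  - by move=> x _; rewrite -EFinM lee_fin mulr_ge0 ?sqr_ge0// mulr_ge0 ?sqr_ge0.
  - exact: emeasurable_funM.
  - by move=> x _; rewrite lee_fin mulr_ge0 ?sqr_ge0.
  rewrite ge0_integralZl//; last 2 first.
  - by move=> x _; rewrite lee_fin sqr_ge0.
  - by rewrite lee_fin mulr_ge0 ?sqr_ge0.
  by rewrite normal01_sqr mule1 integral_cst//= probability_setT mule1 -EFinD mulrDr.
move: e2; rewrite -e1.
have : 0 <= \int[gam]_x ((v * x + c) ^+ 2)%:E by apply: integral_ge0 => x _; exact: H0.
case: (\int[gam]_x ((v * x + c) ^+ 2)%:E) => [r| |]//=.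
by rewrite -EFinD => _ [rr]; congr EFin; lra.
Qed.

End gauss1.

(** * The standard Gaussian measure on row vectors *)

Section gprob.
Context {R : realType}.
Local Notation gR := (measurableTypeR R).
Local Notation gam := (normal_prob (0:R) 1).
Local Open Scope ereal_scope.

Definition tuple_cons n (p : gR * n.-tuple gR) : n.+1.-tuple gR :=
  [the n.+1.-tuple gR of p.1 :: p.2].

Lemma measurable_tuple_cons n : measurable_fun setT (@tuple_cons n).
Proof. exact: (measurable_cons measurable_fst measurable_snd). Qed.

HB.instance Definition _ n := isMeasurableFun.Build _ _ _ _ (@tuple_cons n)
  (@measurable_tuple_cons n).

(** A genuine probability with the recursion of [gauss_int], so that Tonelli identifies the two. It
    lives on tuples, which carry a sigma-algebra; functions of row vectors are integrated through
    [row_of]. *)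
Fixpoint gprob (n : nat) : probability (n.-tuple gR) R :=
  match n with
  | 0 => \d_([tuple] : 0.-tuple gR)
  | n'.+1 => distribution (gam \x gprob n') (@tuple_cons n')
  end.

Definition row_of n (t : n.-tuple gR) : 'rV[R]_n := \row_i tnth t i.
Definition row_cons n (a : R) (x : 'rV[R]_n) : 'rV[R]_n.+1 :=
  row_mx (const_mx a : 'rV[R]_1) x.

Lemma row_cons0 n a (x : 'rV[R]_n) : row_cons a x ord0 ord0 = a.
Proof. by rewrite mxE; case: splitP => j; rewrite ?mxE. Qed.

Lemma row_consS n a (x : 'rV[R]_n) i : row_cons a x ord0 (lift ord0 i) = x ord0 i.
Proof.
rewrite mxE; case: splitP => j /=; first by rewrite (ord1 j).
by rewrite /bump add1n => -[ij]; congr (x _ _); exact/val_inj.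
Qed.

Lemma eq_row_cons n (y : 'rV[R]_n.+1) a (x : 'rV[R]_n) : y ord0 ord0 = a ->
  (forall i, y ord0 (lift ord0 i) = x ord0 i) -> y = row_cons a x.
Proof.
move=> y0 yS; apply/rowP => i; case: (unliftP ord0 i) => [j ->|->].
  by rewrite yS row_consS.
by rewrite y0 row_cons0.
Qed.

Lemma row_of_cons n (a : R) (t : n.-tuple gR) :
  row_of (tuple_cons (a, t)) = row_cons a (row_of t).
Proof. by apply: eq_row_cons => [|i]; rewrite !mxE// tnthS. Qed.

Definition mrv n (G : 'rV[R]_n -> \bar R) := measurable_fun setT (G \o @row_of n).

Definition mcoord d (T : measurableType d) n (phi : T -> 'rV[R]_n) :=
  forall i, measurable_fun setT (fun t => phi t ord0 i : gR).

Lemma mcoord_tuple d (T : measurableType d) n (phi : T -> 'rV[R]_n) :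
  mcoord phi -> exists2 psi : T -> n.-tuple gR, measurable_fun setT psi &
    forall t, phi t = row_of (psi t).
Proof.
move=> mphi; exists (fun t => [tuple phi t ord0 i | i < n] : n.-tuple gR).
  apply/measurable_fun_tnthP => i.
  by rewrite (_ : _ \o _ = (fun t => phi t ord0 i))//; apply/funext => t /=; rewrite tnth_mktuple.
by move=> t; apply/rowP => i; rewrite mxE tnth_mktuple.
Qed.

Lemma mrv_comp d (T : measurableType d) n (phi : T -> 'rV[R]_n) G :
  mrv G -> mcoord phi -> measurable_fun setT (fun t => G (phi t)).
Proof.
move=> mG /mcoord_tuple[psi mpsi E].
rewrite (_ : (fun t => _) = (G \o @row_of n) \o psi); first exact: measurableT_comp.
by apply/funext => t /=; rewrite E.
Qed.

Definition mrv2 n m (h : 'rV[R]_n -> 'rV[R]_m -> \bar R) :=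
  measurable_fun setT (fun p : n.-tuple gR * m.-tuple gR => h (row_of p.1) (row_of p.2)).

Lemma mrv2_comp d (T : measurableType d) n m (phi : T -> 'rV[R]_n) (phi' : T -> 'rV[R]_m) h :
  mrv2 h -> mcoord phi -> mcoord phi' -> measurable_fun setT (fun t => h (phi t) (phi' t)).
Proof.
move=> mh /mcoord_tuple[psi mpsi E] /mcoord_tuple[psi' mpsi' E'].
rewrite (_ : (fun t => _) = (fun p : n.-tuple gR * m.-tuple gR => h (row_of p.1) (row_of p.2))
   \o (fun t => (psi t, psi' t))).
  apply: (measurableT_comp mh); exact: measurable_fun_pair.
by apply/funext => t /=; rewrite E E'.
Qed.

Lemma mcoord_row_of d (T : measurableType d) n (psi : T -> n.-tuple gR) :
  measurable_fun setT psi -> mcoord (fun t => row_of (psi t)).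
Proof.
move=> /measurable_fun_tnthP mpsi i.
by rewrite (_ : (fun t => _) = (@tnth n gR ^~ i \o psi))//; apply/funext => t /=; rewrite mxE.
Qed.

Lemma mcoord_row_cons d (T : measurableType d) n (a : T -> gR) (phi : T -> 'rV[R]_n) :
  measurable_fun setT a -> mcoord phi -> mcoord (fun t => row_cons (a t) (phi t)).
Proof.
move=> ma mphi i; case: (unliftP ord0 i) => [j ->|->].
  by under eq_fun do rewrite row_consS; exact: mphi.
by under eq_fun do rewrite row_cons0.
Qed.

Lemma mcoord_mul d (T : measurableType d) n m (phi : T -> 'rV[R]_n) (A : 'M[R]_(n, m)) :
  mcoord phi -> mcoord (fun t => phi t *m A).
Proof.
move=> mphi i; under eq_fun do rewrite mxE.
apply: (@measurable_sum _ _ _ _ _ _ (fun j t => phi t ord0 j * A j i)%R) => j.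
by apply: measurable_funM => //; exact: mphi.
Qed.

(** One transition of the chain from the state [x] with noise [z]; [mix p q] and [mix q (- p)]
    together are the coordinatewise reflection of the pair (x, z). *)
Definition mix n (p q x z : 'rV[R]_n) : 'rV[R]_n :=
  \row_i (p ord0 i * x ord0 i + q ord0 i * z ord0 i)%R.

Lemma mcoord_mix d (T : measurableType d) n (p q : 'rV[R]_n) (phi psi : T -> 'rV[R]_n) :
  mcoord phi -> mcoord psi -> mcoord (fun t => mix p q (phi t) (psi t)).
Proof.
move=> mphi mpsi i; under eq_fun do rewrite mxE.
by apply: measurable_funD; apply: measurable_funM => //; [exact: mphi|exact: mpsi].
Qed.

Lemma mix_row_cons n p0 q0 (p q : 'rV[R]_n) x0 z0 x z :
  mix (row_cons p0 p) (row_cons q0 q) (row_cons x0 x) (row_cons z0 z) =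
  row_cons (p0 * x0 + q0 * z0)%R (mix p q x z).
Proof. by apply: eq_row_cons => [|i]; rewrite [LHS]mxE ?row_cons0// !row_consS mxE. Qed.

Lemma opp_row_cons n a (x : 'rV[R]_n) : (- row_cons a x = row_cons (- a) (- x))%R.
Proof. by apply: eq_row_cons => [|i]; rewrite [LHS]mxE ?row_cons0// row_consS mxE. Qed.

Lemma row_cons_eta n (x : 'rV[R]_n.+1) :
  x = row_cons (x ord0 ord0) (\row_i x ord0 (lift ord0 i)).
Proof. by apply: eq_row_cons => // i; rewrite mxE. Qed.

Lemma integral_gprob0 (G : 0.-tuple gR -> \bar R) :
  \int[gprob 0]_t G t = G [tuple].
Proof.
rewrite (_ : G = cst (G [tuple])); last by apply/funext => t; rewrite (tuple0 t).
by rewrite integral_cst//= diracT mule1.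
Qed.

Lemma integral_gprobS n (G : n.+1.-tuple gR -> \bar R) :
  measurable_fun setT G -> (forall t, 0 <= G t) ->
  \int[gprob n.+1]_t G t = \int[gam]_a \int[gprob n]_t G (tuple_cons (a, t)).
Proof.
move=> mG G0.
have mGc : measurable_fun setT (G \o @tuple_cons n).
  exact: (measurableT_comp mG (@measurable_tuple_cons n)).
rewrite [LHS](ge0_integral_distribution _ mG G0) fubini_tonelli1// => x; exact: G0.
Qed.

Lemma integral_rowS n (G : 'rV[R]_n.+1 -> \bar R) :
  mrv G -> (forall t, 0 <= G t) ->
  \int[gprob n.+1]_t G (row_of t) =
  \int[gam]_a \int[gprob n]_t G (row_cons a (row_of t)).
Proof.
move=> mG G0; rewrite (@integral_gprobS _ (fun t => G (row_of t)) mG (fun t => G0 _)).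
by apply: eq_integral => a _; apply: eq_integral => t _; rewrite row_of_cons.
Qed.

Lemma mrv_row_cons n (G : 'rV[R]_n.+1 -> \bar R) a : mrv G ->
  mrv (fun x => G (row_cons a x)).
Proof.
move=> mG; apply: (mrv_comp mG); apply: mcoord_row_cons => //; exact: mcoord_row_of.
Qed.

Lemma gauss_intE n (G : 'rV[R]_n -> \bar R) : mrv G -> (forall t, 0 <= G t) ->
  gauss_int G = \int[gprob n]_t G (row_of t).
Proof.
elim: n G => [|n IH] G mG G0.
  by rewrite integral_gprob0 /=; congr G; apply/rowP => -[].
rewrite integral_rowS//=; apply: eq_integral => a _.
rewrite -[RHS](IH (fun x => G (row_cons a x)))//; exact: mrv_row_cons.
Qed.

(** Induction on the dimension: once Tonelli has brought both leading coordinates outside, the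
    inductive hypothesis reflects the tails and the plane reflection treats the heads. *)
Lemma gprob_reflection n (p q : 'rV[R]_n) (h : 'rV[R]_n -> 'rV[R]_n -> \bar R) :
  (forall i, q ord0 i != 0)%R -> (forall i, p ord0 i ^+ 2 + q ord0 i ^+ 2 = 1)%R ->
  mrv2 h -> (forall x z, 0 <= h x z) ->
  \int[gprob n]_x \int[gprob n]_z h (row_of x) (row_of z) =
  \int[gprob n]_x \int[gprob n]_z
    h (mix p q (row_of x) (row_of z)) (mix q (- p) (row_of x) (row_of z)).
Proof.
elim: n p q h => [|n IH] p q h q0 pq mh h0.
  rewrite !integral_gprob0; congr h; apply/rowP => -[]//.
have swapE (k : 'rV[R]_n.+1 -> 'rV[R]_n.+1 -> \bar R) : mrv2 k ->
    (forall x z, 0 <= k x z) ->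
    \int[gprob n.+1]_x \int[gprob n.+1]_z k (row_of x) (row_of z) =
    \int[gam]_a \int[gam]_b \int[gprob n]_x \int[gprob n]_z
       k (row_cons a (row_of x)) (row_cons b (row_of z)).
  move=> mk k0.
  have mk1 : measurable_fun setT (fun x : n.+1.-tuple gR =>
      \int[gprob n.+1]_z k (row_of x) (row_of z)).
    exact: (@measurable_fun_fubini_tonelli_F _ _ _ _ _ (gprob n.+1)
      (fun p : n.+1.-tuple gR * n.+1.-tuple gR => k (row_of p.1) (row_of p.2))).
  rewrite integral_gprobS//; last by move=> x; exact: integral_ge0.
  apply: eq_integral => a _.
  transitivity (\int[gprob n]_x \int[gam]_b \int[gprob n]_z
     k (row_cons a (row_of x)) (row_cons b (row_of z))).
    apply: eq_integral => x _; rewrite row_of_cons.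
    rewrite (@integral_rowS _ (fun z => k (row_cons a (row_of x)) z))//.
    by apply: (mrv2_comp mk) => //; exact: mcoord_row_of.
  rewrite (fubini_tonelli (fun xb : n.-tuple gR * gR => \int[gprob n]_z
     k (row_cons a (row_of xb.1)) (row_cons xb.2 (row_of z))))//=.
    apply: (@measurable_fun_fubini_tonelli_F _ _ _ _ _ (gprob n)
      (fun p : (n.-tuple gR * gR) * n.-tuple gR =>
        k (row_cons a (row_of p.1.1)) (row_cons p.1.2 (row_of p.2)))) => //.
    apply: (mrv2_comp mk); apply: mcoord_row_cons => //.
    - by apply: mcoord_row_of; exact: measurableT_comp.
    - by exact: measurableT_comp.
    - exact: mcoord_row_of.
  by move=> xb; apply: integral_ge0.
pose p' : 'rV[R]_n := \row_i p ord0 (lift ord0 i).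
pose q' : 'rV[R]_n := \row_i q ord0 (lift ord0 i).
have mhm : mrv2 (fun x z => h (mix p q x z) (mix q (- p) x z)).
  by apply: (mrv2_comp mh); apply: mcoord_mix; exact: mcoord_row_of.
rewrite (swapE h mh h0) [RHS](swapE _ mhm (fun x z => h0 _ _)).
pose K (ab : gR * gR) := \int[gprob n]_x \int[gprob n]_z
   h (row_cons ab.1 (mix p' q' (row_of x) (row_of z)))
     (row_cons ab.2 (mix q' (- p') (row_of x) (row_of z))).
transitivity (\int[gam]_a \int[gam]_b K (a, b)).
  apply: eq_integral => a _; apply: eq_integral => b _.
  rewrite (IH p' q' (fun x z => h (row_cons a x) (row_cons b z)))//.
  - by move=> i; rewrite mxE.
  - by move=> i; rewrite !mxE.
  - by apply: (mrv2_comp mh); apply: mcoord_row_cons => //; exact: mcoord_row_of.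
have mK : measurable_fun setT K.
  apply: (@measurable_fun_fubini_tonelli_F _ _ _ _ _ (gprob n)
      (fun p : (gR * gR) * n.-tuple gR => \int[gprob n]_z
    h (row_cons p.1.1 (mix p' q' (row_of p.2) (row_of z)))
     (row_cons p.1.2 (mix q' (- p') (row_of p.2) (row_of z))))) => //.
  + apply: (@measurable_fun_fubini_tonelli_F _ _ _ _ _ (gprob n)
      (fun p : ((gR * gR) * n.-tuple gR) * n.-tuple gR =>
    h (row_cons p.1.1.1 (mix p' q' (row_of p.1.2) (row_of p.2)))
     (row_cons p.1.1.2 (mix q' (- p') (row_of p.1.2) (row_of p.2))))) => //.
    apply: (mrv2_comp mh); apply: mcoord_row_cons.
    * by apply: measurableT_comp => //; exact: measurableT_comp.
    * by apply: mcoord_mix; apply: mcoord_row_of => //; exact: measurableT_comp.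
    * by apply: measurableT_comp => //; exact: measurableT_comp.
    * by apply: mcoord_mix; apply: mcoord_row_of => //; exact: measurableT_comp.
  + by move=> x; exact: integral_ge0.
have K0 ab : 0 <= K ab by apply: integral_ge0 => *; exact: integral_ge0.
apply: (etrans (normal01_reflection (q0 ord0) (pq ord0) mK K0)).
apply: eq_integral => a _; apply: eq_integral => b _.
apply: eq_integral => x _; apply: eq_integral => z _.
rewrite [in RHS](row_cons_eta p) [in RHS](row_cons_eta q) mix_row_cons.
by rewrite opp_row_cons mix_row_cons mulNr.
Qed.

End gprob.

(** * Measurability of continuous functions of row vectors *)

Section continuous_measurable.
Context {R : realType}.
Local Notation gR := (measurableTypeR R).

(** An open set is the countable union of the balls it contains with rational centre and radius 1 /
    (k + 1); along [row_of] such a ball is a finite intersection of coordinate conditions. Balls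
    that do not fit are replaced by the empty set, so that all pairs can index the union. *)
Lemma open_row_of_measurable n (U : set 'rV[R]_n) : open U ->
  measurable ((@row_of R n) @^-1` U).
Proof.
move=> oU.
pose c (q : 'rV[rat]_n) : 'rV[R]_n := \row_i ratr (q ord0 i).
pose F (qk : 'rV[rat]_n * nat) : set (n.-tuple gR) :=
  if `[< ball (c qk.1) (qk.2.+1%:R^-1) `<=` U >]
  then (@row_of R n) @^-1` (ball (c qk.1) (qk.2.+1%:R^-1)) else set0.
have -> : (@row_of R n) @^-1` U = \bigcup_qk F qk.
  apply/seteqP; split => [t /= Ut|t [qk _]]; last first.
    by rewrite /F; case: ifPn => // /asboolP qkU /qkU.
  have /nbhs_ballP[e /= e0 eU] : nbhs (row_of t) U by exact: open_nbhs_nbhs.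
  have [k ke] : exists k : nat, (k.+1%:R^-1 < e / 2)%R.
    have e20 : 0 < e / 2 by rewrite divr_gt0.
    exists (Num.truncn (e / 2)^-1).
    rewrite invf_plt ?posrE//; exact: truncnS_gt.
  have k0 : (0 < k.+1%:R^-1 :> R) by rewrite invr_gt0.
  have qex i : {q : rat | `|ratr q - tnth t i| < k.+1%:R^-1}.
    have lt1 : tnth t i - k.+1%:R^-1 < tnth t i + k.+1%:R^-1.
      by rewrite ltrBlDr -addrA ltrDl addr_gt0.
    apply: cid; have [q qin] := rat_in_itvoo lt1.
    exists q; move: qin; rewrite in_itv /= => /andP[q1 q2].
    by rewrite ltr_distl q1 q2.
  pose q : 'rV[rat]_n := \row_i sval (qex i).
  have qk : forall i j, `|c q i j - row_of t i j| < k.+1%:R^-1.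
    by move=> i j; rewrite !mxE; case: (qex j).
  exists (q, k) => //; rewrite /F /= ifT.
    by split=> // i j; exact: qk.
  apply/asboolP => y [_ yq]; apply: eU; split=> // i j.
  have := qk i j; have := yq i j; rewrite /ball/= => h1 h2.
  rewrite (_ : row_of t i j - y i j = (c q i j - y i j) - (c q i j - row_of t i j)); last by ring.
  apply: (le_lt_trans (ler_normB _ _)); rewrite (splitr e).
  by apply: ltrD; exact: lt_trans ke.
apply: countable_bigcupT_measurable => // qk.
rewrite /F; case: ifP => // _.
rewrite (_ : _ @^-1` _ = \bigcap_(i in [set: 'I_n]) [set t : n.-tuple gR |
   `|c qk.1 ord0 i - tnth t i| < qk.2.+1%:R^-1]).
  apply: fin_bigcap_measurable => // i _.
  have mt : measurable_fun setT (fun t : n.-tuple gR => `|c qk.1 ord0 i - tnth t i|).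
    apply: measurableT_comp => //; apply: measurable_funB => //.
    exact: measurable_tnth.
  have := measurable_fun_ltr mt (measurable_cst (qk.2.+1%:R^-1 : R)).
  by move=> /(_ measurableT [set true]); rewrite setTI; exact.
apply/seteqP; split => t /=.
  by move=> [_ H] i _; have := H ord0 i; rewrite /ball/= mxE [row_of t _ _]mxE.
move=> H; split=> [|i j]; first by rewrite invr_gt0.
by rewrite (ord1 i) /ball/= [c _ _ _]mxE [row_of t _ _]mxE; have := H j I; rewrite mxE.
Qed.

Lemma continuous_mrv n (f : 'rV[R]_n -> R) : continuous f -> mrv (EFin \o f).
Proof.
move=> cf; apply/measurable_EFinP.
apply: (measurability _ (RGenOInfty.measurableE R)) => _ [_ [a ->] <-].
rewrite setTI; apply: (@open_row_of_measurable _ (f @^-1` `]a, +oo[)).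
by apply: open_comp => // x _; exact: cf.
Qed.

End continuous_measurable.

(** * Dilations, exponential integrability and moments of the Gaussian measure *)

Section gprob_moments.
Context {R : realType}.
Local Notation gR := (measurableTypeR R).
Local Notation gam := (normal_prob (0:R) 1).
Local Open Scope ereal_scope.

Definition sqn n (x : 'rV[R]_n) : R := (\sum_i x ord0 i ^+ 2)%R.

Lemma sqn_row_cons n a (x : 'rV[R]_n) : sqn (row_cons a x) = (a ^+ 2 + sqn x)%R.
Proof.
rewrite /sqn big_ord_recl row_cons0; congr (_ + _)%R.
by apply: eq_bigr => i _; rewrite row_consS.
Qed.

Lemma sqn_ge0 n (x : 'rV[R]_n) : (0 <= sqn x)%R.
Proof. by apply: sumr_ge0 => i _; exact: sqr_ge0. Qed.

Lemma sqn0 (x : 'rV[R]_0) : sqn x = 0%R.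
Proof. by rewrite /sqn big_ord0. Qed.

Lemma measurable_sqn d (T : measurableType d) n (phi : T -> 'rV[R]_n) :
  mcoord phi -> measurable_fun setT (fun t => sqn (phi t)).
Proof.
move=> mphi; apply: measurable_sum => i.
apply: (measurableT_comp (@exprn_measurable R _ 2)); exact: mphi.
Qed.

Lemma mcoordZ d (T : measurableType d) n (phi : T -> 'rV[R]_n) (c : R) :
  mcoord phi -> mcoord (fun t => c *: phi t)%R.
Proof.
move=> mphi i; under eq_fun do rewrite mxE.
by apply: measurable_funM => //; exact: mphi.
Qed.

Lemma scale_row_cons n c a (x : 'rV[R]_n) :
  (c *: row_cons a x = row_cons (c * a) (c *: x))%R.
Proof. by apply: eq_row_cons => [|i]; rewrite [LHS]mxE ?row_cons0// row_consS mxE. Qed.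

Lemma integral_row0 (G : 'rV[R]_0 -> \bar R) :
  \int[gprob 0]_t G (row_of t) = G 0%R.
Proof. by rewrite integral_gprob0; congr G; apply/rowP => -[]. Qed.

(** Gives the dilated Gaussian an explicit density; with c = 1 / l it drives the radial comparison
    in [rint_gen_le0]. *)
Lemma gprob_scale n (c : R) (G : 'rV[R]_n -> \bar R) : (0 < c)%R ->
  mrv G -> (forall x, 0 <= G x) ->
  \int[gprob n]_t G (c *: row_of t)%R =
  \int[gprob n]_t (G (row_of t) *
     (c ^- n * expR ((1 - c ^- 2) * sqn (row_of t) / 2))%:E).
Proof.
move=> c0; elim: n G => [|n IH] G mG G0.
  rewrite (integral_row0 (fun x => G (c *: x)%R)).
  rewrite (integral_row0 (fun x => G x * (c ^- 0 * expR ((1 - c ^- 2) * sqn x / 2))%:E)).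
  by rewrite scaler0 sqn0 mulr0 mul0r expR0 expr0 invr1 mulr1 mule1.
have w0 m (x : 'rV[R]_m) : 0 <= (c ^- m * expR ((1 - c ^- 2) * sqn x / 2))%:E.
  by rewrite lee_fin mulr_ge0 ?expR_ge0// invr_ge0 exprn_ge0// ltW.
have mw d (T : measurableType d) m (phi : T -> 'rV[R]_m) : mcoord phi ->
   measurable_fun setT (fun t => (c ^- m * expR ((1 - c ^- 2) * sqn (phi t) / 2))%:E).
  move=> mphi; apply/measurable_EFinP; apply: measurable_funM => //.
  apply: measurableT_comp => //; apply: measurable_funM => //.
  by apply: measurable_funM => //; exact: measurable_sqn.
rewrite (@integral_rowS _ _ (fun x => G (c *: x)%R))//; last first.
  by apply: (mrv_comp mG); apply: mcoordZ; exact: mcoord_row_of.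
rewrite (@integral_rowS _ _ (fun x => G x *
     (c ^- n.+1 * expR ((1 - c ^- 2) * sqn x / 2))%:E)); last 2 first.
- by apply: emeasurable_funM => //; apply: mw; exact: mcoord_row_of.
- by move=> x; exact: mule_ge0.
have mK : measurable_fun setT (fun p : gR * n.-tuple gR => G (row_cons p.1 (row_of p.2)) *
     (c ^- n * expR ((1 - c ^- 2) * sqn (row_of p.2) / 2))%:E).
  apply: emeasurable_funM; last by apply: mw; exact: mcoord_row_of.
  by apply: (mrv_comp mG); apply: mcoord_row_cons => //; exact: mcoord_row_of.
pose K a := \int[gprob n]_t (G (row_cons a (row_of t)) *
     (c ^- n * expR ((1 - c ^- 2) * sqn (row_of t) / 2))%:E).
transitivity (\int[gam]_a K (c * a)%R).
  apply: eq_integral => a _.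
  rewrite -[RHS](IH (fun x => G (row_cons (c * a)%R x)))//; last exact: mrv_row_cons.
  by apply: eq_integral => t _; rewrite scale_row_cons.
rewrite normal01_scale//.
- apply: eq_integral => a _; rewrite /K muleC -ge0_integralZl//.
  + apply: eq_integral => t _; rewrite muleCA -EFinM; congr (_ * _%:E).
    rewrite (_ : c ^- n.+1 = c^-1 * c ^- n)%R; last by rewrite exprS invfM.
    by rewrite sqn_row_cons mulrDr mulrDl expRD mulrACA.
  + apply: emeasurable_funM; last by apply: mw; exact: mcoord_row_of.
    exact: mrv_row_cons.
  + by move=> t _; exact: mule_ge0.
  + by rewrite lee_fin mulr_ge0 ?expR_ge0// invr_ge0 ltW.
- apply: (@measurable_fun_fubini_tonelli_F _ _ _ _ _ (gprob n) _ mK).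
  by move=> p; exact: mule_ge0.
- by move=> a; apply: integral_ge0 => t _; exact: mule_ge0.
Qed.

Lemma gprob_expsq n : \int[gprob n]_t (expR (sqn (row_of t) / 8))%:E < +oo.
Proof.
(* This [c] makes (1 - c^-2) / 2 equal to 1/8; applied to the constant 1, the dilation formula then
   says that the integral is c^n. *)
pose c : R := Num.sqrt (4 / 3).
have c2 : (c ^+ 2 = 4 / 3)%R by rewrite sqr_sqrtr// divr_ge0.
have c0 : (0 < c)%R by rewrite sqrtr_gt0 divr_gt0.
have E (t : 'rV[R]_n) : cst 1 t * (c ^- n * expR ((1 - c ^- 2) * sqn t / 2))%:E =
   (c ^- n)%:E * (expR (sqn t / 8))%:E.
  rewrite mul1e EFinM; congr (_ * (expR _)%:E); rewrite c2; by field.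
have cn0 : (0 < c ^- n)%R by rewrite invr_gt0 exprn_gt0.
set I := (X in X < _).
have : 1 = (c ^- n)%:E * I.
  transitivity (\int[gprob n]_t cst 1 (c *: row_of t : 'rV[R]_n)%R).
    rewrite integral_cst// -[LHS]mule1; congr (_ * _); exact/esym/probability_setT.
  rewrite gprob_scale//; last exact: measurable_cst.
  under eq_integral do rewrite E.
  rewrite ge0_integralZl//; last 2 first.
  - apply/measurable_EFinP; apply: measurableT_comp => //; apply: measurable_funM => //.
    by apply: measurable_sqn; exact: mcoord_row_of.
  - by rewrite lee_fin ltW.
case: I => [r _||]; rewrite ?ltry//.
by rewrite gt0_muley ?lte_fin.
Qed.

Lemma gprob_opp n (G : 'rV[R]_n -> \bar R) : mrv G -> (forall x, 0 <= G x) ->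
  \int[gprob n]_t G (- row_of t)%R = \int[gprob n]_t G (row_of t).
Proof.
elim: n G => [|n IH] G mG G0.
  rewrite integral_row0 (integral_row0 (fun x => G (- x)%R)) oppr0//.
have mcN m d (T : measurableType d) (phi : T -> 'rV[R]_m) :
    mcoord phi -> mcoord (fun t => - phi t)%R.
  by move=> mphi i; under eq_fun do rewrite mxE; exact: (measurable_funN (mphi i)).
rewrite (@integral_rowS _ _ (fun x => G (- x)%R))//; last first.
  by apply: (mrv_comp mG); apply: mcN; exact: mcoord_row_of.
rewrite (integral_rowS mG G0).
pose K a := \int[gprob n]_t (G (row_cons a (row_of t))).
transitivity (\int[gam]_a K (- a)%R).
  apply: eq_integral => a _.
  rewrite -[RHS](IH (fun x => G (row_cons (- a)%R x)))//; last exact: mrv_row_cons.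
  by apply: eq_integral => t _; rewrite opp_row_cons.
rewrite normal01_opp//.
- apply: (@measurable_fun_fubini_tonelli_F _ _ _ _ _ (gprob n)
    (fun p => G (row_cons p.1 (row_of p.2)))) => //.
  by apply: (mrv_comp mG); apply: mcoord_row_cons => //; exact: mcoord_row_of.
- by move=> a; exact: integral_ge0.
Qed.

Definition dotp n (v x : 'rV[R]_n) : R := (\sum_i v ord0 i * x ord0 i)%R.

Lemma measurable_dotp d (T : measurableType d) n (phi psi : T -> 'rV[R]_n) :
  mcoord phi -> mcoord psi -> measurable_fun setT (fun t => dotp (phi t) (psi t)).
Proof.
move=> mphi mpsi; apply: measurable_sum => i.
by apply: measurable_funM; [exact: mphi|exact: mpsi].
Qed.

Lemma mcoord_cst d (T : measurableType d) n (v : 'rV[R]_n) : mcoord (fun _ : T => v).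
Proof. by move=> i. Qed.

(** The shift [c] carries the induction, absorbing the leading coordinate; comparing c = 0 with c =
    1 later also gives the mean of [dotp]. *)
Lemma gprob_dotp2 n (v : 'rV[R]_n) (c : R) :
  \int[gprob n]_t ((dotp v (row_of t) + c) ^+ 2)%:E = (sqn v + c ^+ 2)%:E.
Proof.
elim: n v c => [|n IH] v c.
  rewrite (integral_row0 (fun x => ((dotp v x + c) ^+ 2)%:E)) sqn0 add0r /dotp big_ord0 add0r//.
rewrite (@integral_rowS _ _ (fun x => ((dotp v x + c) ^+ 2)%:E)); last 2 first.
- apply/measurable_EFinP; apply: (measurableT_comp (@exprn_measurable R _ 2)).
  apply: measurable_funD => //; apply: measurable_dotp; first exact: mcoord_cst.
  exact: mcoord_row_of.
- by move=> t; rewrite lee_fin sqr_ge0.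
pose v' : 'rV[R]_n := \row_i v ord0 (lift ord0 i).
have vE : v = row_cons (v ord0 ord0) v' by exact: row_cons_eta.
transitivity (\int[gam]_a ((sqn v')%:E + ((v ord0 ord0 * a + c) ^+ 2)%:E)).
  apply: eq_integral => a _; rewrite -EFinD -IH; apply: eq_integral => t _.
  congr (_ ^+ 2)%:E; rewrite addrA; congr (_ + _)%R.
  rewrite /dotp big_ord_recl row_cons0 addrC; congr (_ + _)%R.
  by apply: eq_bigr => i _; rewrite row_consS [v' _ _]mxE.
rewrite ge0_integralD//; last 3 first.
- by move=> a _; rewrite lee_fin sqn_ge0.
- by move=> a _; rewrite lee_fin sqr_ge0.
- apply/measurable_EFinP; apply: (measurableT_comp (@exprn_measurable R _ 2)).
  exact: measurable_affine.
rewrite integral_cst// normal01_affine_sqr.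
transitivity ((sqn v')%:E * 1 + (v ord0 ord0 ^+ 2 + c ^+ 2)%:E).
  by congr (_ * _ + _); exact: probability_setT.
by rewrite mule1 -EFinD vE sqn_row_cons row_cons0; congr EFin; ring.
Qed.

Lemma gprob_sqn n : \int[gprob n]_t (sqn (row_of t))%:E = n%:R%:E.
Proof.
elim: n => [|n IH]; first by rewrite (integral_row0 (fun x => (sqn x)%:E)) sqn0.
rewrite (@integral_rowS _ _ (fun x => (sqn x)%:E)); last 2 first.
- by apply/measurable_EFinP; apply: measurable_sqn; exact: mcoord_row_of.
- by move=> t; rewrite lee_fin sqn_ge0.
transitivity (\int[gam]_a ((a ^+ 2)%:E + n%:R%:E)).
  apply: eq_integral => a _; rewrite -IH.
  under eq_integral do rewrite sqn_row_cons EFinD.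
  rewrite ge0_integralD//; last 3 first.
  - by move=> t _; rewrite lee_fin sqr_ge0.
  - by move=> t _; rewrite lee_fin sqn_ge0.
  - by apply/measurable_EFinP; apply: measurable_sqn; exact: mcoord_row_of.
  rewrite integral_cst//; congr (_ + _); rewrite -[RHS]mule1; congr (_ * _).
  exact: probability_setT.
rewrite ge0_integralD//; last 2 first.
- by move=> a _; rewrite lee_fin sqr_ge0.
- by apply/measurable_EFinP; exact: exprn_measurable.
rewrite normal01_sqr integral_cst//.
transitivity (1 + n%:R%:E * 1 : \bar R).
  by congr (_ + _ * _); exact: probability_setT.
by rewrite mule1 -EFinD -natr1 addrC.
Qed.

End gprob_moments.

(** * Prekopa-Leindler and log-concave marginals *)

Section prekopa_leindler.
Context {R : realType}.
Local Notation gR := (measurableTypeR R).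
Local Notation leb := (@lebesgue_measure R).
Local Notation gam := (normal_prob (0:R) 1).

Lemma measure_le_diam (A : set R) (r : R) : measurable A -> A !=set0 ->
  (forall a b, A a -> A b -> b - a <= r) -> (leb A <= r%:E)%E.
Proof.
move=> mA [a0 Aa0] Ar.
have r0 : 0 <= r by rewrite -(subrr a0); exact: Ar.
have hinf : has_inf A.
  by split; [exists a0|exists (a0 - r) => x Ax; rewrite lerBlDr -lerBlDl; exact: Ar].
have sub : A `<=` `[inf A, inf A + r]%classic.
  move=> x Ax; rewrite /= in_itv /=; apply/andP; split.
    exact: (ge_inf (proj2 hinf)).
  rewrite -lerBlDr; apply: lb_le_inf; first by exists a0.
  by move=> y Ay; rewrite lerBlDr -lerBlDl; exact: Ar.
apply: (@le_trans _ _ (leb `[inf A, inf A + r]%classic)).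
  by apply: le_measure => //; rewrite inE.
rewrite lebesgue_measure_itv/= lte_fin; case: ifP => _; last by rewrite lee_fin.
by rewrite -EFinB lee_fin addrAC subrr add0r.
Qed.

(* A set containing every segment [l a1 + (1-l) b1, l a2 + (1-l) b2] is at least
   as long as the weighted sum of the diameters of A and B. *)
Lemma brunn_minkowski1 (l : R) (A B C : set R) : 0 < l < 1 ->
  measurable A -> measurable B -> measurable C -> A !=set0 -> B !=set0 ->
  (forall a1 a2 b1 b2 x, A a1 -> A a2 -> B b1 -> B b2 ->
     l * a1 + (1 - l) * b1 <= x <= l * a2 + (1 - l) * b2 -> C x) ->
  (l%:E * leb A + (1 - l)%:E * leb B <= leb C)%E.
Proof.
move=> /andP[l0 l1] mA mB mC A0 B0 ABC.
have l'0 : 0 < 1 - l by rewrite subr_gt0.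
have [->|Cy] := eqVneq (leb C) +oo%E; first by rewrite leey.
have Cfin : leb C \is a fin_num by rewrite ge0_fin_numE// ltey.
pose m := fine (leb C).
have mE : leb C = m%:E by rewrite fineK.
have m0 : 0 <= m by apply: fine_ge0.
have H a1 a2 b1 b2 : A a1 -> A a2 -> B b1 -> B b2 -> a1 <= a2 -> b1 <= b2 ->
    l * (a2 - a1) + (1 - l) * (b2 - b1) <= m.
  move=> Aa1 Aa2 Bb1 Bb2 a12 b12.
  have ineq : l * a1 + (1 - l) * b1 <= l * a2 + (1 - l) * b2.
    by apply: lerD; rewrite ler_pM2l.
  have : (leb `[(l * a1 + (1 - l) * b1)%R, (l * a2 + (1 - l) * b2)%R]%classic <= leb C)%E.
    apply: le_measure; rewrite ?inE// => x /=; rewrite in_itv/=.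
    exact: ABC.
  rewrite mE lebesgue_measure_itv/= lte_fin; case: ifPn => [_|]; last first.
    rewrite -leNgt => /(conj ineq)/andP/le_anti e _.
    have : l * (a2 - a1) + (1 - l) * (b2 - b1) = 0 by rewrite !mulrBr; lra.
    by move=> ->.
  by rewrite -EFinB lee_fin; apply: le_trans; rewrite !mulrBr; lra.
(* Each pair in B bounds the diameter, hence the length, of A. The same inequality solved for b2 -
   b1 bounds the diameter of B by what the length of A leaves over. *)
have HA b1 b2 : B b1 -> B b2 -> b1 <= b2 ->
    (leb A <= ((m - (1 - l) * (b2 - b1)) / l)%:E)%E.
  move=> Bb1 Bb2 b12; apply: measure_le_diam => // a1 a2 Aa1 Aa2.
  rewrite ler_pdivlMr// lerBrDr mulrC.
  have [a12|/ltW a21] := leP a1 a2; first exact: H.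
  apply: le_trans (H _ _ _ _ Aa1 Aa1 Bb1 Bb2 (lexx _) b12).
  by rewrite lerD2r ler_pM2l// lerD2r.
have [b0 Bb0] := B0.
have Afin : leb A \is a fin_num.
  rewrite ge0_fin_numE//; apply: le_lt_trans (HA _ _ Bb0 Bb0 (lexx _)) _.
  exact: ltry.
pose mA' := fine (leb A).
have mAE : leb A = mA'%:E by rewrite fineK.
have HB : (leb B <= ((m - l * mA') / (1 - l))%:E)%E.
  apply: measure_le_diam => // b1 b2 Bb1 Bb2.
  rewrite ler_pdivlMr// mulrC.
  have [b12|/ltW b21] := leP b1 b2.
    have := HA _ _ Bb1 Bb2 b12; rewrite mAE lee_fin ler_pdivlMr//.
    by move=> ?; lra.
  have := HA _ _ Bb0 Bb0 (lexx _); rewrite mAE lee_fin subrr mulr0 subr0 ler_pdivlMr//.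
  have : (1 - l) * (b2 - b1) <= 0 by rewrite pmulr_rle0// subr_le0.
  by move=> ? ?; lra.
rewrite mE mAE -EFinM.
apply: (@le_trans _ _ ((l * mA')%:E + (1 - l)%:E * ((m - l * mA') / (1 - l))%:E)%E).
  by rewrite leeD2l// lee_pmul2l.
rewrite -EFinM -EFinD lee_fin mulrCA divff ?mulr1 ?gt_eqF//; lra.
Qed.

(** Requiring 0 <= t makes negative levels empty, so the layer-cake integral can run over the whole
    line. *)
Definition level (X : R -> R) (t : R) : \bar R := leb [set x | 0 <= t < X x].

Lemma measurable_level_set (X : R -> R) (t : R) : measurable_fun setT X ->
  measurable [set x | 0 <= t < X x].
Proof.
move=> mX; have [t0|t0] := leP 0 t; last first.
  rewrite (_ : [set x | _] = set0)//; apply/seteqP; split => x //=.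
have := measurable_fun_ltr (measurable_cst t) mX.
move=> /(_ measurableT [set true]); rewrite setTI; exact.
Qed.

Lemma layer_cake (X : R -> R) : measurable_fun setT X -> (forall x, 0 <= X x) ->
  (\int[leb]_x (X x)%:E = \int[leb]_t level X t)%E /\ measurable_fun setT (level X).
Proof.
move=> mX X0.
pose D : set (gR * gR) := [set p | 0 <= p.2 < X p.1].
have mD : measurable D.
  have m1 : measurable_fun setT (fun p : gR * gR => 0 <= p.2).
    exact: measurable_fun_ler.
  have m2 : measurable_fun setT (fun p : gR * gR => p.2 < X p.1).
    by apply: measurable_fun_ltr => //; exact: measurableT_comp.
  have := measurable_and m1 m2.
  by move=> /(_ measurableT [set true]); rewrite setTI; exact.
pose f (p : gR * gR) : \bar R := (\1_D p)%:E.
have mf : measurable_fun setT f by exact/measurable_EFinP.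
have f0 p : (0 <= f p)%E by rewrite lee_fin.
have levelE t : (\int[leb]_x f (x, t) = level X t)%E.
  rewrite (_ : (fun x => f (x, t)) = (fun x => (\1_[set x | 0 <= t < X x] x)%:E)).
    rewrite integral_indic//; last exact: measurable_level_set.
    by rewrite setIT.
  by apply/funext => x; rewrite /f !indicE; congr ((nat_of_bool _)%:R%:E);
    apply/idP/idP; rewrite !inE.
split; last first.
  rewrite (_ : level X = (fun t => \int[leb]_x f (x, t))%E).
    exact: (@measurable_fun_fubini_tonelli_G _ _ _ _ _ leb f mf f0).
  by apply/funext => t; rewrite levelE.
under [RHS]eq_integral do rewrite -levelE.
rewrite -(fubini_tonelli f mf f0); apply: eq_integral => x _.
rewrite (_ : (fun t => f (x, t)) = (fun t => (\1_(`[0, X x[%classic) t)%:E)).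
  transitivity (leb `[0, X x[%classic); last by rewrite integral_indic// setIT.
  rewrite lebesgue_measure_itv/= lte_fin.
  case: ltP => [_|X0']; first by rewrite sube0.
  by congr EFin; apply: le_anti; rewrite X0' X0.
apply/funext => t; rewrite /f !indicE; congr ((nat_of_bool _)%:R%:E).
Qed.

(** When both suprema are 1, the level sets of F and G are nonempty for the same levels t < 1, so
    the one-dimensional Brunn-Minkowski inequality applies level by level. Quasi-concavity of H puts
    whole segments into its level sets, as that inequality requires. *)
Lemma prekopa_leindler_normalized (l : R) (F G H : R -> R) : 0 < l < 1 ->
  measurable_fun setT F -> measurable_fun setT G -> measurable_fun setT H ->
  (forall x, 0 <= F x <= 1) -> (forall x, 0 <= G x <= 1) -> (forall x, 0 <= H x) ->
  (forall t, t < 1 -> exists x, t < F x) -> (forall t, t < 1 -> exists x, t < G x) ->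
  (forall x y, F x `^ l * G y `^ (1 - l) <= H (l * x + (1 - l) * y)) ->
  (forall x y z, x <= z <= y -> Num.min (H x) (H y) <= H z) ->
  (l%:E * (\int[leb]_x (F x)%:E) + (1 - l)%:E * (\int[leb]_x (G x)%:E)
    <= \int[leb]_x (H x)%:E)%E.
Proof.
move=> l01 mF mG mH F01 G01 H0 Fsup Gsup FGH qH.
have /andP[l0 l1] := l01.
have l'0 : 0 < 1 - l by rewrite subr_gt0.
have F0 x : 0 <= F x by have /andP[] := F01 x.
have G0 x : 0 <= G x by have /andP[] := G01 x.
have [-> mLF] := layer_cake mF F0.
have [-> mLG] := layer_cake mG G0.
have [-> mLH] := layer_cake mH H0.
have lev0 X t : (0 <= level X t)%E by exact: measure_ge0.
rewrite -ge0_integralZl//; last by rewrite lee_fin ltW.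
rewrite -ge0_integralZl//; last by rewrite lee_fin ltW.
have e0 (c : R) X t : 0 < c -> (0 <= c%:E * level X t)%E.
  by move=> c0; rewrite mule_ge0// lee_fin ltW.
rewrite -ge0_integralD//; last 4 first.
- by move=> t _; exact: e0.
- exact: emeasurable_funM.
- by move=> t _; exact: e0.
- exact: emeasurable_funM.
apply: ge0_le_integral => //.
- by move=> t _; apply: adde_ge0; exact: e0.
- by apply: emeasurable_funD; exact: emeasurable_funM.
move=> t _.
have lvl0 (X : R -> R) : (forall x, ~ (0 <= t < X x)) -> level X t = 0%E.
  move=> nX; rewrite /level (_ : [set x | _] = set0) ?measure0//.
  by apply/seteqP; split => x //= /nX.
have [t0|t0] := leP 0 t; last first.
  rewrite !lvl0 ?mule0 ?adde0// => x; rewrite leNgt t0//.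
have [t1|t1] := ltP t 1; last first.
  rewrite (lvl0 F) ?(lvl0 G) ?mule0 ?adde0// => x /andP[_ tx].
    by have /andP[_] := G01 x; rewrite leNgt (le_lt_trans t1 tx).
  by have /andP[_] := F01 x; rewrite leNgt (le_lt_trans t1 tx).
have pos x y : t < F x -> t < G y -> t < H (l * x + (1 - l) * y).
  move=> tF tG; apply: lt_le_trans (FGH x y).
  have -> : t = t `^ l * t `^ (1 - l).
    rewrite -powRD ?powRr1//; first by rewrite addrC subrK powRr1.
    by rewrite addrC subrK oner_eq0.
  apply: ltr_pM => //; rewrite ?powR_ge0//.
    by apply: gt0_ltr_powR; rewrite // nnegrE.
  by apply: gt0_ltr_powR; rewrite // nnegrE.
apply: brunn_minkowski1 => //; try exact: measurable_level_set.
- by have [x tx] := Fsup t t1; exists x; rewrite /= t0.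
- by have [x tx] := Gsup t t1; exists x; rewrite /= t0.
move=> a1 a2 b1 b2 x /= /andP[_ ta1] /andP[_ ta2] /andP[_ tb1] /andP[_ tb2] xab.
rewrite t0 /=; apply: lt_le_trans (qH _ _ _ xab).
by rewrite lt_min !pos.
Qed.

(** Young's inequality with exponents [l^-1] and [(1 - l)^-1]. *)
Lemma powR_prod_le (l a b : R) : 0 < l < 1 -> 0 <= a -> 0 <= b ->
  a `^ l * b `^ (1 - l) <= l * a + (1 - l) * b.
Proof.
move=> /andP[l0 l1] a0 b0.
have l'0 : 0 < 1 - l by rewrite subr_gt0.
have := @conjugate_powR R (a `^ l) (b `^ (1 - l)) l^-1 (1 - l)^-1
   (powR_ge0 _ _) (powR_ge0 _ _).
rewrite !invr_gt0 !invrK -!powRrM !divff ?gt_eqF// !powRr1// => /(_ l0 l'0).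
by rewrite [a * l]mulrC [b * _]mulrC; apply; rewrite addrC subrK.
Qed.

(** F and G are divided by their suprema f and g, and H by f^l g^(1-l), which preserves the
    hypothesis; the arithmetic mean of the normalized integrals is then bounded below by the
    geometric one. If a supremum vanishes, the left side is 0. *)
Lemma prekopa_leindler (l M : R) (F G H : R -> R) : 0 < l < 1 ->
  measurable_fun setT F -> measurable_fun setT G -> measurable_fun setT H ->
  (forall x, 0 <= F x <= M) -> (forall x, 0 <= G x <= M) -> (forall x, 0 <= H x) ->
  leb.-integrable setT (EFin \o F) -> leb.-integrable setT (EFin \o G) ->
  leb.-integrable setT (EFin \o H) ->
  (forall x y, F x `^ l * G y `^ (1 - l) <= H (l * x + (1 - l) * y)) ->
  (forall x y z, x <= z <= y -> Num.min (H x) (H y) <= H z) ->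
  (\int[leb]_x F x) `^ l * (\int[leb]_x G x) `^ (1 - l) <= \int[leb]_x H x.
Proof.
move=> l01 mF mG mH FM GM H0 iF iG iH FGH qH.
have /andP[l0 l1] := l01.
have l'0 : 0 < 1 - l by rewrite subr_gt0.
have IH0 : 0 <= \int[leb]_x H x by apply: Rintegral_ge0 => x _.
have sup_spec (X : R -> R) : (forall x, 0 <= X x <= M) ->
   (forall x, X x = 0) \/ (exists s, [/\ 0 < s, (forall x, X x <= s) & (forall t, t < 1 -> exists x, t < X x / s)]).
  move=> XM.
  have hs : has_sup (range X).
    by split; [exists (X 0); exists 0|exists M => _ [x _ <-]; have /andP[] := XM x].
  have Xs x : X x <= sup (range X) by apply: (ub_le_sup (proj2 hs)); exists x.
  have [s0|s0] := ltP 0 (sup (range X)); last first.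
    left => x; apply: le_anti; rewrite (le_trans (Xs x) s0).
    by have /andP[] := XM x.
  right; exists (sup (range X)); split => // t t1.
  have [_ [x _ <-] ltx] := @sup_adherent _ (range X) (sup (range X) - t * sup (range X))
    ltac:(by rewrite subr_gt0 gtr_pMl) hs.
  by exists x; rewrite ltr_pdivlMr//; move: ltx; rewrite opprB addrCA subrr addr0.
have int0 (X : R -> R) : (forall x, X x = 0) -> \int[leb]_x X x = 0.
  by move=> X0; rewrite /Rintegral integral0_eq// => x _; rewrite X0.
have [F00|[f [f0 Ff Fs]]] := sup_spec F FM.
  by rewrite (int0 F)// powR0 ?mul0r// gt_eqF.
have [G00|[g [g0 Gg Gs]]] := sup_spec G GM.
  by rewrite (int0 G)// powR0 ?mulr0// gt_eqF.
pose h := f `^ l * g `^ (1 - l).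
have h0 : 0 < h by rewrite mulr_gt0// powR_gt0.
have pV (c r : R) : 0 < c -> c^-1 `^ r = (c `^ r)^-1.
  by move=> c0; rewrite -powR_inv1 ?ltW// -powRrM mulN1r powRN.
have mdiv (X : R -> R) (c : R) : measurable_fun setT X -> measurable_fun setT (fun x => X x / c).
  by move=> mX; exact: measurable_funM.
have := @prekopa_leindler_normalized l (fun x => F x / f) (fun x => G x / g) (fun x => H x / h)
  l01 (mdiv _ _ mF) (mdiv _ _ mG) (mdiv _ _ mH).
have step : (forall x, 0 <= F x / f <= 1) /\ (forall x, 0 <= G x / g <= 1) /\
   (forall x, 0 <= H x / h) /\
  (forall x y, (F x / f) `^ l * (G y / g) `^ (1 - l) <= H (l * x + (1 - l) * y) / h) /\
  (forall x y z, x <= z <= y -> Num.min (H x / h) (H y / h) <= H z / h).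
  split; [|split; [|split; [|split]]].
  - move=> x; rewrite ler_pdivrMr// mul1r Ff andbT divr_ge0// ?(ltW f0)//.
    by have /andP[] := FM x.
  - move=> x; rewrite ler_pdivrMr// mul1r Gg andbT divr_ge0// ?(ltW g0)//.
    by have /andP[] := GM x.
  - by move=> x; rewrite divr_ge0// ltW.
  - move=> x y; have /andP[Fx0 _] := FM x; have /andP[Gy0 _] := GM y.
    rewrite !powRM ?invr_ge0 ?(ltW f0) ?(ltW g0)// mulrACA !pV// -invfM.
    by rewrite ler_pM2r ?invr_gt0.
  - move=> x y z xzy; have := qH x y z xzy.
    rewrite !ge_min => /orP[] ?; apply/orP; [left|right];
    by rewrite ler_pM2r ?invr_gt0.
have [S1 [S2 [S3 [S4 S5]]]] := step.
move=> /(_ S1 S2 S3 Fs Gs S4 S5).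
have cE (X : R -> R) (c : R) : leb.-integrable setT (EFin \o X) ->
    (\int[leb]_x (X x / c)%:E = ((\int[leb]_x X x) / c)%:E)%E.
  move=> iX; under eq_integral do rewrite EFinM.
  rewrite integralZr// EFinM; congr (_ * _)%E.
  by rewrite /Rintegral fineK//; exact: integrable_fin_num.
rewrite !cE// -!EFinM -EFinD lee_fin => main.
have IF0 : 0 <= \int[leb]_x F x by apply: Rintegral_ge0 => x _; have /andP[] := FM x.
have IG0 : 0 <= \int[leb]_x G x by apply: Rintegral_ge0 => x _; have /andP[] := GM x.
have := le_trans (powR_prod_le l01 (divr_ge0 IF0 (ltW f0)) (divr_ge0 IG0 (ltW g0))) main.
rewrite !powRM ?invr_ge0 ?(ltW f0) ?(ltW g0)// mulrACA !pV// -invfM.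
by rewrite ler_pM2r ?invr_gt0.
Qed.

End prekopa_leindler.

Section bounded.
Context d (T : measurableType d) {R : realType} (P : probability T R).

Lemma bounded_integrable (M : R) (g : T -> R) : measurable_fun setT g ->
  (forall x, `|g x| <= M) -> P.-integrable setT (EFin \o g).
Proof.
move=> mg gM; apply: (@le_integrable _ _ _ _ _ _ _ (EFin \o cst M)) => //.
- exact/measurable_EFinP.
- by move=> x _; rewrite /= lee_fin (le_trans (gM x))// ler_norm.
- exact: finite_measure_integrable_cst.
Qed.

Lemma EFin_Rintegral (g : T -> R) : P.-integrable setT (EFin \o g) ->
  (\int[P]_x g x)%:E = (\int[P]_x (g x)%:E)%E.
Proof. by move=> ig; rewrite /Rintegral fineK//; exact: integrable_fin_num. Qed.

Lemma bounded_EFin_Rintegral (M : R) (g : T -> R) : measurable_fun setT g ->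
  (forall x, 0 <= g x <= M) -> (\int[P]_x g x)%:E = (\int[P]_x (g x)%:E)%E.
Proof.
move=> mg gM; apply/EFin_Rintegral/(@bounded_integrable M) => // x.
by have /andP[g0 ?] := gM x; rewrite ger0_norm.
Qed.

Lemma bounded_Rintegral (M : R) (g : T -> R) : measurable_fun setT g ->
  (forall x, 0 <= g x <= M) -> 0 <= \int[P]_x g x <= M.
Proof.
move=> mg gM; apply/andP; split.
  by apply: Rintegral_ge0 => x _; have /andP[] := gM x.
rewrite -lee_fin (bounded_EFin_Rintegral mg gM).
apply: (@le_trans _ _ (\int[P]_x (cst M%:E x))%E).
  apply: ge0_le_integral => //.
  - by move=> x _; rewrite lee_fin; have /andP[] := gM x.
  - exact/measurable_EFinP.
  - by move=> x _; rewrite lee_fin; have /andP[] := gM x.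
by rewrite integral_cst//= probability_setT mule1.
Qed.

End bounded.

Section prekopa_gauss.
Context {R : realType}.
Local Notation gR := (measurableTypeR R).
Local Notation leb := (@lebesgue_measure R).
Local Notation gam := (normal_prob (0:R) 1).
Local Notation w := (normal_pdf (0:R) 1).

Lemma normal01_Rintegral (M : R) (X : gR -> R) : measurable_fun setT X ->
  (forall x, 0 <= X x <= M) ->
  leb.-integrable setT (EFin \o (fun x => X x * w x)) /\
  \int[gam]_x X x = \int[leb]_x (X x * w x).
Proof.
move=> mX XM.
have X0 x : 0 <= X x by have /andP[] := XM x.
have M0 : 0 <= M by have /andP[] := XM 0; exact: le_trans.
have mw : measurable_fun setT (w : gR -> R) by exact: measurable_normal_pdf.
split.
  apply: (@le_integrable _ gR R leb setT measurableT _ (EFin \o (fun x : gR => M * w x))) => //.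
  - by apply/measurable_EFinP; apply: measurable_funM.
  - move=> x _; rewrite /= lee_fin !ger0_norm ?mulr_ge0 ?normal_pdf_ge0//.
    by rewrite ler_wpM2r ?normal_pdf_ge0//; have /andP[] := XM x.
  - apply: (@integrableZl _ gR R leb setT measurableT M (fun x => (w x)%:E)).
    exact: integrable_normal_pdf.
rewrite /Rintegral integral_normal01//; last by apply/measurable_EFinP.
Qed.

Lemma min_le_powR (l a b : R) : 0 < l < 1 -> 0 <= a -> 0 <= b ->
  Num.min a b <= a `^ l * b `^ (1 - l).
Proof.
move=> /andP[l0 l1] a0 b0.
have l'0 : 0 < 1 - l by rewrite subr_gt0.
set m := Num.min a b.
have m0 : 0 <= m by rewrite le_min a0.
have -> : m = m `^ l * m `^ (1 - l).
  rewrite -powRD ?powRr1//; first by rewrite addrC subrK powRr1.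
  by rewrite addrC subrK oner_eq0.
apply: ler_pM; rewrite ?powR_ge0//; apply: ge0_ler_powR;
  by rewrite ?nnegrE ?(ltW l0) ?(ltW l'0)// ge_min lexx ?orbT.
Qed.

Lemma normal01_pdf_log_concave (l x y : R) : 0 < l < 1 ->
  w x `^ l * w y `^ (1 - l) <= w (l * x + (1 - l) * y).
Proof.
move=> /andP[l0 l1]; rewrite !normal01_pdfE.
have p0 : 0 <= normal_peak 1 :> R by exact: normal_peak_ge0.
rewrite !powRM ?expR_ge0// -!expRM mulrACA -expRD.
rewrite -powRD; last by rewrite addrC subrK oner_eq0.
rewrite [l + _]addrC subrK powRr1// ler_wpM2l// ler_expR.
have : 0 <= l * (1 - l) * (x - y) ^+ 2.
  apply: mulr_ge0; last exact: sqr_ge0.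
  by apply: mulr_ge0; [exact: ltW|rewrite subr_ge0 ltW].
by nra.
Qed.

(** The Gaussian density is itself log-concave, so each function absorbs it; [H] times the density
    is log-concave and therefore quasi-concave. *)
Lemma prekopa_leindler_normal01 (l M : R) (F G H : gR -> R) : 0 < l < 1 ->
  measurable_fun setT F -> measurable_fun setT G -> measurable_fun setT H ->
  (forall x, 0 <= F x <= M) -> (forall x, 0 <= G x <= M) -> (forall x, 0 <= H x <= M) ->
  (forall x y, F x `^ l * G y `^ (1 - l) <= H (l * x + (1 - l) * y)) ->
  (forall t x y, 0 < t < 1 -> H x `^ t * H y `^ (1 - t) <= H (t * x + (1 - t) * y)) ->
  (\int[gam]_x F x) `^ l * (\int[gam]_x G x) `^ (1 - l) <= \int[gam]_x H x.
Proof.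
move=> l01 mF mG mH FM GM HM FGH qH.
have [iF ->] := normal01_Rintegral mF FM.
have [iG ->] := normal01_Rintegral mG GM.
have [iH ->] := normal01_Rintegral mH HM.
have mw : measurable_fun setT (w : gR -> R) by exact: measurable_normal_pdf.
have M0 : 0 <= M by have /andP[] := FM 0; exact: le_trans.
have w0 x : 0 <= w x by exact: normal_pdf_ge0.
have wM x : w x <= normal_peak 1 by apply: normal_pdf_ub; rewrite oner_neq0.
have XM (X : gR -> R) : (forall x, 0 <= X x <= M) -> forall x, 0 <= X x * w x <= M * normal_peak 1.
  by move=> HX x; have /andP[X0 ?] := HX x; rewrite mulr_ge0//= ler_pM.
have lc t (X Y Z : gR -> R) x y : 0 < t < 1 -> (forall x, 0 <= X x <= M) -> (forall x, 0 <= Y x <= M) ->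
   (forall x, 0 <= Z x <= M) ->
   X x `^ t * Y y `^ (1 - t) <= Z (t * x + (1 - t) * y) ->
   (X x * w x) `^ t * (Y y * w y) `^ (1 - t) <= Z (t * x + (1 - t) * y) * w (t * x + (1 - t) * y).
  move=> t01 HX HY HZ XYZ.
  have /andP[X0 _] := HX x; have /andP[Y0 _] := HY y.
  rewrite !powRM// mulrACA; apply: ler_pM => //; rewrite ?mulr_ge0 ?powR_ge0//.
  exact: normal01_pdf_log_concave.
apply: (@prekopa_leindler R l (M * normal_peak 1) (fun x => F x * w x) (fun x => G x * w x)
  (fun x => H x * w x)) => //; try exact: measurable_funM; try exact: XM.
- by move=> x; have /andP[] := XM H HM x.
- by move=> x y; exact: lc.
- move=> x y z /andP[xz zy].
  have [xy|yx] := ltP x y; last first.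
    have -> : z = x by apply: le_anti; rewrite xz (le_trans zy).
    by rewrite ge_min lexx.
  have [->|zx] := eqVneq z x; first by rewrite ge_min lexx.
  have [->|zy'] := eqVneq z y; first by rewrite ge_min lexx orbT.
  have {}xz : x < z by rewrite lt_neqAle eq_sym zx.
  have {}zy : z < y by rewrite lt_neqAle zy'.
  have yx0 : 0 < y - x by rewrite subr_gt0.
  pose t := (y - z) / (y - x).
  have t01 : 0 < t < 1 by rewrite divr_gt0 ?subr_gt0//= ltr_pdivrMr// mul1r ltrD2l ltrN2.
  have -> : z = t * x + (1 - t) * y by rewrite /t; field; rewrite gt_eqF.
  apply: le_trans (lc t H H H x y t01 HM HM HM (qH t x y t01)).
  by apply: min_le_powR => //; have /andP[] := XM H HM x; have /andP[] := XM H HM y.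
Qed.

(* Prekopa's theorem; the parameter space V is only required to carry an
   idempotent combination. *)
Lemma marginal_log_concave n (V : Type) (comb : R -> V -> V -> V)
    (H : V -> 'rV[R]_n -> R) (M : R) :
  (forall l v, 0 < l < 1 -> comb l v v = v) ->
  (forall v z, 0 <= H v z <= M) ->
  (forall v, mrv (EFin \o H v)) ->
  (forall l v u x y, 0 < l < 1 ->
    H v x `^ l * H u y `^ (1 - l) <= H (comb l v u) (l *: x + (1 - l) *: y)) ->
  forall l v u, 0 < l < 1 ->
  (\int[gprob n]_t H v (row_of t)) `^ l * (\int[gprob n]_t H u (row_of t)) `^ (1 - l) <=
    \int[gprob n]_t H (comb l v u) (row_of t).
Proof.
elim: n V comb H => [|n IH] V comb H combI HM mH Hlc l v u l01.
  have E v' : \int[gprob 0]_t H v' (row_of t) = H v' 0.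
    by rewrite /Rintegral (integral_row0 (fun x => (H v' x)%:E)).
  by rewrite !E; apply: le_trans (Hlc l v u 0 0 l01) _; rewrite !scaler0 addr0.
have mH' v' : measurable_fun setT (fun t => H v' (row_of t)) by apply/measurable_EFinP; exact: mH.
(* The leading coordinate joins the parameter, where it is combined convexly; this is why the
   induction runs over an arbitrary parameter type. *)
pose H' (va : V * R) z := H va.1 (row_cons va.2 z).
pose comb' l' (va ub : V * R) := (comb l' va.1 ub.1, l' * va.2 + (1 - l') * ub.2).
have mH'' v' a : measurable_fun setT (fun t => H v' (row_cons a (row_of t))).
  by apply/measurable_EFinP; exact: (mrv_row_cons (G := EFin \o H v')).
have lc l' va ub : 0 < l' < 1 ->
  (\int[gprob n]_t H' va (row_of t)) `^ l' * (\int[gprob n]_t H' ub (row_of t)) `^ (1 - l') <=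
  \int[gprob n]_t H' (comb' l' va ub) (row_of t).
  apply: IH => {l' va ub}.
  - move=> l' [v' a] l'01; rewrite /comb' /= combI//; congr pair; ring.
  - by move=> va z; exact: HM.
  - by move=> [v' a]; exact: (mrv_row_cons (G := EFin \o H v')).
  - move=> l' [v' a] [u' b] x y l'01; rewrite /H' /comb' /=.
    apply: le_trans (Hlc _ _ _ _ _ l'01) _; rewrite !scale_row_cons.
    rewrite (_ : _ + _ = row_cons (l' * a + (1 - l') * b) (l' *: x + (1 - l') *: y))//.
    by apply: eq_row_cons => [|i]; rewrite [LHS]mxE ?row_cons0// !row_consS [RHS]mxE.
pose K v' (a : gR) := \int[gprob n]_t H' (v', a) (row_of t).
have K_E v' a : (K v' a)%:E = (\int[gprob n]_t (H v' (row_cons a (row_of t)))%:E)%E.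
  by apply: (@bounded_EFin_Rintegral _ _ _ _ M) => [|t]; [exact: mH''|exact: HM].
have mK v' : measurable_fun setT (K v').
  apply/measurable_EFinP.
  rewrite (_ : _ \o _ = (fun a => \int[gprob n]_t (H v' (row_cons a (row_of t)))%:E)%E); last first.
    by apply/funext => a; rewrite -K_E.
  apply: (@measurable_fun_fubini_tonelli_F _ _ _ _ _ (gprob n)
    (fun p : gR * n.-tuple gR => (H v' (row_cons p.1 (row_of p.2)))%:E)).
    by apply: (mrv_comp (mH v')); apply: mcoord_row_cons => //; exact: mcoord_row_of.
  by move=> p; rewrite lee_fin; have /andP[] := HM v' (row_cons p.1 (row_of p.2)).
have KM v' a : 0 <= K v' a <= M.
  by apply: bounded_Rintegral => [|t]; [exact: mH''|exact: HM].
have E v' : \int[gprob n.+1]_t H v' (row_of t) = \int[gam]_a K v' a.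
  rewrite /Rintegral (@integral_rowS _ _ (fun x => (H v' x)%:E)) => [||x].
  - by congr fine; apply: eq_integral => a _; rewrite K_E.
  - exact: mH.
  - by rewrite lee_fin; have /andP[] := HM v' x.
rewrite !E; apply: (@prekopa_leindler_normal01 l M) => //.
- by move=> a b; exact: (lc l (v, a) (u, b)).
(* Idempotence: with the parameter frozen at [comb l v u], the partial integral is log-concave in
   the remaining coordinate. *)
- move=> t a b t01; have := lc t (comb l v u, a) (comb l v u, b) t01.
  by rewrite /comb' /= combI.
Qed.

(** The origin is the midpoint of x and -x. *)
Lemma log_concave_symm_le n (f : 'rV[R]_n -> R) : (forall x, 0 <= f x) ->
  log_concave f -> (forall x, f (- x) = f x) -> forall x, f x <= f 0.
Proof.
move=> f0 lc sf x.
have h : 0 < (1 / 2 : R) < 1 by apply/andP; split; lra.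
have := lc x (- x) _ h; rewrite sf -powRD; last first.
  by rewrite addrC subrK oner_eq0.
rewrite [X in f x `^ X]addrC subrK powRr1//.
by rewrite (_ : _ + _ = 0)//; apply/rowP => i; rewrite !mxE; field.
Qed.

(** By Prekopa, the integral over z of f (mix a b (s x) z) is log-concave in s, and it is even in s
    by the substitution z |-> -z. The point c is the combination of 1 and -1 with weight (1 + c) / 2
    on 1, and the values at 1 and -1 agree. *)
Lemma mix_ray_le n (f : 'rV[R]_n -> R) (a b x : 'rV[R]_n) (c : R) :
  continuous f -> (forall x, 0 <= f x) -> log_concave f -> (forall x, f (- x) = f x) ->
  0 <= c <= 1 ->
  \int[gprob n]_t f (mix a b x (row_of t)) <= \int[gprob n]_t f (mix a b (c *: x) (row_of t)).
Proof.
move=> cf f0 lc sf /andP[c0 c1].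
have [c1'|c1'] := eqVneq c 1; first by rewrite c1' scale1r.
have {}c1 : c < 1 by rewrite lt_neqAle c1'.
pose H (s : R) z := f (mix a b (s *: x) z).
have mf := continuous_mrv cf.
have mHn s : mrv (EFin \o H s).
  by apply: (mrv_comp mf); apply: mcoord_mix; [exact: mcoord_cst|exact: mcoord_row_of].
have := @marginal_log_concave n R (fun l s t => l * s + (1 - l) * t) H (f 0).
have HM : forall v z, 0 <= H v z <= f 0.
  by move=> s z; rewrite f0/=; exact: (log_concave_symm_le f0 lc sf).
move=> /(_ _ HM mHn).
pose l := (1 + c) / 2.
have l01 : 0 < l < 1 by rewrite /l; apply/andP; split; lra.
move=> /(_ _ _ l 1 (-1) l01).
have -> : l * 1 + (1 - l) * -1 = c by rewrite /l; field.
have -> : \int[gprob n]_t H (-1) (row_of t) = \int[gprob n]_t H 1 (row_of t).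
  rewrite /Rintegral; congr fine.
  have H10 z : (0 <= (H 1%R z)%:E)%E by rewrite lee_fin f0.
  rewrite -[RHS](gprob_opp (mHn 1) H10).
  apply: eq_integral => t _; rewrite /= /H -[in RHS]sf; congr (f _)%:E.
  by apply/rowP => i; rewrite !mxE; ring.
have J0 : 0 <= \int[gprob n]_t H 1 (row_of t) by apply: Rintegral_ge0 => t _; exact: f0.
rewrite -powRD; last by rewrite addrC subrK oner_eq0.
rewrite [X in _ `^ X]addrC subrK powRr1//.
have -> : \int[gprob n]_t H 1 (row_of t) = \int[gprob n]_t f (mix a b x (row_of t)).
  by rewrite /H scale1r.
apply.
- by move=> l' v _; ring.
- move=> l' s t y z l'01; apply: le_trans (lc _ _ _ l'01) _.
  by rewrite /H (_ : _ + _ = mix a b ((l' * s + (1 - l') * t) *: x) (l' *: y + (1 - l') *: z))//;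
    apply/rowP => i; rewrite !mxE; ring.
Qed.

End prekopa_gauss.

(** * Smoothing and Taylor expansion *)

Section calculus.
Context {R : realType}.

Lemma mean_value_ge (q q' : R -> R) (t d : R) : 0 <= d ->
  (forall s : R, is_derive s (1 : R) q (q' s)) ->
  exists2 s, t <= s <= t + d & q (t + d) - q t = q' s * d.
Proof.
move=> d0 dq.
have cq : {within `[t, t + d], continuous q}.
  apply: derivable_within_continuous => s _.
  exact: (@ex_derive _ _ _ _ _ _ _ (dq s)).
have [s] := @MVT_segment R q q' t (t + d) (ler_wpDr d0 (lexx t)) (fun s _ => dq s) cq.
by rewrite in_itv/= => tsd ->; exists s => //; rewrite addrAC subrr add0r.
Qed.

Lemma mean_value (q q' : R -> R) (t d : R) :
  (forall s : R, is_derive s (1 : R) q (q' s)) ->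
  exists2 s, `|s - t| <= `|d| & q (t + d) - q t = q' s * d.
Proof.
move=> dq; have [d0|d0] := leP 0 d.
  have [s /andP[ts std] e] := mean_value_ge t d0 dq; exists s => //.
  by rewrite !ger0_norm ?subr_ge0// lerBlDl.
have d0' : 0 <= - d by rewrite oppr_ge0 ltW.
have [s] := mean_value_ge (t + d) d0' dq.
rewrite addrK => /andP[ts std] e; exists s; last by rewrite -opprB e mulrN opprK.
by rewrite ler0_norm ?subr_le0// ltr0_norm//; lra.
Qed.

Lemma is_derive_shift (q q' : R -> R) (h t : R) :
  is_derive (t + h) (1 : R) q (q' (t + h)) ->
  is_derive t (1 : R) (fun s => q (s + h)) (q' (t + h)).
Proof.
move=> dq.
have ds : is_derive t (1 : R) (fun s => s + h) (1 + 0) by exact: is_deriveD.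
have := @is_derive1_comp R q (fun s => s + h) t _ _ dq ds.
by rewrite addr0 mulr1.
Qed.

Lemma is_derive_diffquot (q q' : R -> R) (h t : R) :
  (forall s : R, is_derive s (1 : R) q (q' s)) ->
  is_derive t (1 : R) (fun s => (q (s + h) - q s) / h) ((q' (t + h) - q' t) / h).
Proof.
move=> dq.
have d1 := is_deriveB (is_derive_shift (dq (t + h))) (dq t).
have := @is_deriveZ R R R _ h^-1 t 1 _ d1.
rewrite (_ : h^-1 *: _ = (q' (t + h) - q' t) / h); last by rewrite /GRing.scale/= mulrC.
rewrite (_ : _ \*: _ = (fun s => (q (s + h) - q s) / h))//.
by apply/funext => s /=; rewrite /GRing.scale/= mulrC.
Qed.

Lemma is_derive_shiftl (q q' : R -> R) (t s : R) :
  (forall s : R, is_derive s (1 : R) q (q' s)) ->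
  is_derive s (1 : R) (fun s => q (t + s)) (q' (t + s)).
Proof.
move=> dq; have := is_derive_shift (dq (s + t)); rewrite addrC.
by under eq_fun do rewrite addrC.
Qed.

Lemma is_derive_linear (c s : R) : is_derive s (1 : R) (fun s => c * s) c.
Proof.
have := @is_deriveZ R R R id c s 1 1 (is_derive_id _ _).
by rewrite /GRing.scale /= mulr1.
Qed.

Lemma is_derive_square (c s : R) :
  is_derive s (1 : R) (fun s => c * s ^+ 2 / 2) (c * s).
Proof.
have := is_deriveM (is_derive_linear (c / 2) s) (is_derive_id s 1).
rewrite (_ : (fun _ => _) * id = (fun s => c * s ^+ 2 / 2)); last first.
  apply/funext => u; change (c / 2 * u * u = c * u ^+ 2 / 2); by field.
rewrite (_ : _ + _ = c * s)//; rewrite /GRing.scale/=; by field.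
Qed.

Local Notation leb := (@lebesgue_measure R).

(* Averaging over a window of width h gains one derivative. *)
Lemma window_average (phi : R -> R) (h : R) : 0 < h -> continuous phi ->
  (forall s t, s <= t -> phi t <= phi s) ->
  exists psi : R -> R,
    (forall t : R, is_derive t (1 : R) psi ((phi (t + h) - phi t) / h)) /\
    (forall t, phi (t + h) <= psi t <= phi t).
Proof.
move=> h0 cphi dphi.
have iphi (a b : R) : leb.-integrable `[a, b] (EFin \o phi).
  apply: continuous_compact_integrable; first exact: segment_compact.
  exact: continuous_subspaceT.
have iphi' (a b : R) : leb.-integrable `]a, b] (EFin \o phi).
  apply: integrableS (iphi a b) => //; exact: subset_itv_oc_cc.
exists (fun t => (\int[leb]_(x in `]t, t + h]) phi x) / h); split => t.
- pose a := t - 1.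
  pose F y := \int[leb]_(x in `[a, y]) phi x.
  have dF x : a < x -> is_derive x (1 : R) F (phi x).
    move=> ax; have xx : x < x + 1 by rewrite ltrDl.
    have [dFx <-] := continuous_FTC1_closed xx (iphi _ _) ax (cphi x).
    by rewrite derive1E; exact: derivableP.
  have ta : a < t by rewrite /a gtrBl.
  have tha : a < t + h by rewrite (lt_le_trans ta)// lerDl ltW.
  have d1 := is_deriveB (is_derive_shift (dF _ tha)) (dF _ ta).
  have := @is_deriveZ R R R _ h^-1 t 1 _ d1.
  rewrite (_ : h^-1 *: _ = (phi (t + h) - phi t) / h); last by rewrite /GRing.scale/= mulrC.
  apply: near_eq_is_derive; apply/nbhs_ballP; exists 1 => //= s.
  rewrite /ball/= ltr_distlC => /andP[ts _].
  rewrite /GRing.scale/= mulrC; congr (_ / h).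
  by apply: Rintegral_itvB => //; rewrite bnd_simp ?lerDl ltW.
- have mu_h : leb `]t, (t + h)] = h%:E.
    by rewrite lebesgue_measure_itv/= lte_fin ltrDl h0 -EFinB addrAC subrr add0r.
  have icst (c : R) : leb.-integrable `]t, (t + h)] (EFin \o cst c).
    apply/integrableP; split; first exact/measurable_EFinP.
    rewrite (eq_integral (cst `|c|%:E))//.
    by rewrite integral_cst//= mu_h -EFinM ltry.
  have Rcst c : \int[leb]_(x in `]t, (t + h)]) cst c x = c * h.
    by rewrite Rintegral_cst//= mu_h.
  apply/andP; split.
    rewrite ler_pdivlMr// -Rcst; apply: le_Rintegral => // x.
    by rewrite /= in_itv/= => /andP[_ xth]; exact: dphi.
  rewrite ler_pdivrMr// -Rcst; apply: le_Rintegral => // x.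
  by rewrite /= in_itv/= => /andP[tx _]; apply: dphi; exact: ltW.
Qed.

(** Each averaging makes the derivative a difference quotient of the previous function, so three of
    them give three derivatives bounded by M times powers of 2 / h, and a total displacement of 3 h.
    The quotient of a non-increasing function gives the sign of [p1]. *)
Lemma window_average3 (phi : R -> R) (h M : R) : 0 < h -> continuous phi ->
  (forall s t, s <= t -> phi t <= phi s) -> (forall t, 0 <= phi t <= M) ->
  exists (K : R) (p p1 p2 p3 : R -> R),
    [/\ (forall t : R, is_derive t (1 : R) p (p1 t)),
        (forall t : R, is_derive t (1 : R) p1 (p2 t)),
        (forall t : R, is_derive t (1 : R) p2 (p3 t)),
        (forall t, [/\ p1 t <= 0, `|p1 t| <= K, `|p2 t| <= K & `|p3 t| <= K]) &
        (forall t, phi (t + 3 * h) <= p t <= phi t)].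
Proof.
move=> h0 cphi dphi phiM.
have M0 : 0 <= M by have /andP[] := phiM 0; exact: le_trans.
have dq_le0 (q : R -> R) t : (forall s t, s <= t -> q t <= q s) -> (q (t + h) - q t) / h <= 0.
  by move=> dq; rewrite pmulr_lle0 ?invr_gt0// subr_le0 dq// lerDl ltW.
have step (q : R -> R) : continuous q -> (forall s t, s <= t -> q t <= q s) ->
    (forall t, 0 <= q t <= M) -> exists q1,
   [/\ (forall t : R, is_derive t (1 : R) q1 ((q (t + h) - q t) / h)),
      (forall t, q (t + h) <= q1 t <= q t), continuous q1,
      (forall s t, s <= t -> q1 t <= q1 s) & (forall t, 0 <= q1 t <= M)].
  move=> cq dq qM; have [q1 [dq1 bq1]] := window_average h0 cq dq.
  exists q1; split => //.
  - move=> t; apply: differentiable_continuous; apply/derivable1_diffP.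
    exact: (@ex_derive _ _ _ _ _ _ _ (dq1 t)).
  - move=> s t st; have [c _ e] := mean_value s (t - s) dq1.
    rewrite -subr_le0 -[X in q1 X - _](subrKC s) e mulr_le0_ge0 ?subr_ge0//.
    exact: dq_le0.
  - move=> t; have /andP[b1 b2] := bq1 t; have /andP[c1 c2] := qM (t + h).
    have /andP[d1 d2] := qM t.
    by rewrite (le_trans c1 b1) (le_trans b2 d2).
have [q1 [dq1 bq1 cq1 nq1 q1M]] := step phi cphi dphi phiM.
have [q2 [dq2 bq2 cq2 nq2 q2M]] := step q1 cq1 nq1 q1M.
have [q3 [dq3 bq3 cq3 nq3 q3M]] := step q2 cq2 nq2 q2M.
pose D (q : R -> R) t := (q (t + h) - q t) / h.
have bD (q : R -> R) B t : (forall t, `|q t| <= B) -> `|D q t| <= 2 * B / h.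
  move=> qB; rewrite normrM [X in _ * X]gtr0_norm ?invr_gt0// ler_pM2r ?invr_gt0//.
  apply: le_trans (ler_normB _ _) _.
  by have := qB (t + h); have := qB t; lra.
have nM (q : R -> R) : (forall t, 0 <= q t <= M) -> forall t, `|q t| <= M.
  by move=> qM t; have /andP[q0 ?] := qM t; rewrite ger0_norm.
pose B1 := 2 * M / h; pose B2 := 2 * B1 / h; pose B3 := 2 * B2 / h.
have B10 : 0 <= B1 by apply: divr_ge0; [exact: mulr_ge0|exact: ltW].
have B20 : 0 <= B2 by apply: divr_ge0; [exact: mulr_ge0|exact: ltW].
have B30 : 0 <= B3 by apply: divr_ge0; [exact: mulr_ge0|exact: ltW].
exists (B1 + B2 + B3), q3, (D q2), (D (D q1)), (D (D (D phi))); split => //.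
- by move=> t; exact: (is_derive_diffquot h t dq2).
- by move=> t; apply: is_derive_diffquot => s; exact: (is_derive_diffquot h s dq1).
- move=> t; have b1 := bD _ _ t (nM _ q2M).
  have b2 := bD _ _ t (fun s => bD _ _ s (nM _ q1M)).
  have b3 := bD _ _ t (fun s => bD _ _ s (fun s => bD _ _ s (nM _ phiM))).
  rewrite -/B1 in b1 b2 b3; rewrite -/B2 in b2 b3; rewrite -/B3 in b3.
  by split; [exact: dq_le0|lra..].
- move=> t; apply/andP; split.
    have /andP[a1 _] := bq3 t; have /andP[a2 _] := bq2 (t + h).
    have /andP[a3 _] := bq1 (t + h + h).
    apply: le_trans (le_trans a2 a1); rewrite (_ : t + 3 * h = t + h + h + h)//; ring.
  have /andP[_ a1] := bq3 t; have /andP[_ a2] := bq2 t; have /andP[_ a3] := bq1 t.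
  exact: le_trans (le_trans a1 a2) a3.
Qed.

(** The mean value theorem applied three times, to successive remainders as functions of the
    increment; the factor 1/6 is given up. *)
Lemma taylor2 (p p1 p2 p3 : R -> R) (K : R) :
  (forall t : R, is_derive t (1 : R) p (p1 t)) -> (forall t : R, is_derive t (1 : R) p1 (p2 t)) ->
  (forall t : R, is_derive t (1 : R) p2 (p3 t)) -> (forall t, `|p3 t| <= K) ->
  forall t d, `|p (t + d) - p t - p1 t * d - p2 t * d ^+ 2 / 2| <= K * `|d| ^+ 3.
Proof.
move=> d1 d2 d3 Kp.
have K0 : 0 <= K by exact: le_trans (Kp 0).
have B2 t d : `|p2 (t + d) - p2 t| <= K * `|d|.
  by have [s _ ->] := mean_value t d d3; rewrite normrM ler_wpM2r.
have B1 t d : `|p1 (t + d) - p1 t - p2 t * d| <= K * `|d| ^+ 2.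
  pose q s := p1 (t + s) - p2 t * s.
  pose q' s := p2 (t + s) - p2 t.
  have dq s : is_derive (s : R) (1 : R) q (q' s).
    apply: is_deriveB; last exact: is_derive_linear.
    exact: is_derive_shiftl.
  have [s sd e] := mean_value 0 d dq.
  have -> : p1 (t + d) - p1 t - p2 t * d = q (0 + d) - q 0 by rewrite /q add0r addr0 mulr0; ring.
  rewrite e normrM expr2 mulrA ler_wpM2r//; apply: le_trans (B2 t s) _.
  by rewrite ler_wpM2l//; rewrite subr0 in sd.
move=> t d.
pose q s := p (t + s) - p1 t * s - p2 t * s ^+ 2 / 2.
pose q' s := p1 (t + s) - p1 t - p2 t * s.
have dq s : is_derive (s : R) (1 : R) q (q' s).
  apply: is_deriveB.
    apply: is_deriveB.
      exact: is_derive_shiftl.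
    exact: is_derive_linear.
  exact: is_derive_square.
have [s sd e] := mean_value 0 d dq.
have -> : p (t + d) - p t - p1 t * d - p2 t * d ^+ 2 / 2 = q (0 + d) - q 0.
  by rewrite /q add0r addr0 mulr0 expr0n/= mulr0 mul0r; ring.
rewrite e normrM exprSr mulrA ler_wpM2r//; apply: le_trans (B1 t s) _.
rewrite ler_wpM2l// lerXn2r ?nnegrE//; by rewrite subr0 in sd.
Qed.

End calculus.

(** * Rotation invariance and diagonalization *)

Section orthogonal.
Context {R : realType}.
Local Notation gR := (measurableTypeR R).
Local Notation gam := (normal_prob (0:R) 1).

(** Proved along with each matrix as it is built from signs, plane reflections and products, for
    which it reduces to one-dimensional facts. *)
Definition gauss_invariant n (U : 'M[R]_n) := forall G : 'rV[R]_n -> \bar R,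
  mrv G -> (forall x, 0 <= G x)%E ->
  (\int[gprob n]_t G (row_of t *m U) = \int[gprob n]_t G (row_of t))%E.

Lemma gauss_invariantM n (U V : 'M[R]_n) :
  gauss_invariant U -> gauss_invariant V -> gauss_invariant (U *m V).
Proof.
move=> iU iV G mG G0; rewrite -(iV G mG G0).
rewrite -[RHS](iU (fun x => G (x *m V))) //.
  by apply: eq_integral => t _; rewrite mulmxA.
by apply: (mrv_comp mG); apply: mcoord_mul; exact: mcoord_row_of.
Qed.

Lemma row_cons_mul_block n a (x : 'rV[R]_n) (c : R) (U : 'M[R]_n) :
  row_cons a x *m (block_mx (c%:M : 'M[R]_1) 0 0 U : 'M[R]_(1 + n)) =
  row_cons (a * c) (x *m U).
Proof.
rewrite /row_cons; set A : 'rV[R]_1 := const_mx a.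
rewrite [LHS](@mul_row_block R 1 1 n 1 n) !mulmx0 addr0 add0r; congr (row_mx _ _).
by apply/rowP => i; rewrite mul_mx_scalar !mxE mulrC.
Qed.

Lemma measurable_int_row_cons n (G : 'rV[R]_n.+1 -> \bar R) : mrv G -> (forall x, 0 <= G x)%E ->
  measurable_fun setT (fun a : gR => \int[gprob n]_t G (row_cons a (row_of t)))%E.
Proof.
move=> mG G0.
apply: (@measurable_fun_fubini_tonelli_F _ _ _ _ _ (gprob n)
  (fun p => G (row_cons p.1 (row_of p.2)))) => //.
by apply: (mrv_comp mG); apply: mcoord_row_cons => //; exact: mcoord_row_of.
Qed.

Lemma gauss_invariant_block n (c : R) (U : 'M[R]_n) : c = 1 \/ c = -1 ->
  gauss_invariant U ->
  gauss_invariant (block_mx (c%:M : 'M[R]_1) 0 0 U : 'M[R]_(1 + n)).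
Proof.
move=> c1 iU G mG G0.
rewrite (@integral_rowS _ _ (fun x => G (x *m (block_mx (c%:M : 'M[R]_1) 0 0 U : 'M[R]_(1 + n)))))//;
  last by apply: (mrv_comp mG); apply: mcoord_mul; exact: mcoord_row_of.
rewrite (integral_rowS mG G0).
pose K (a : gR) := (\int[gprob n]_t G (row_cons a (row_of t)))%E.
transitivity (\int[gam]_a K (a * c)%R)%E.
  apply: eq_integral => a _.
  rewrite -[RHS](iU (fun x => G (row_cons (a * c) x)))//; last exact: mrv_row_cons.
  by apply: eq_integral => t _; rewrite row_cons_mul_block.
case: c1 => ->; first by under eq_integral do rewrite mulr1.
under eq_integral do rewrite mulrN1.
rewrite normal01_opp//; first exact: measurable_int_row_cons.
by move=> a; exact: integral_ge0.
Qed.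

(** The reflection (a, b) |-> (p a + q b, q a - p b) of the two leading coordinates, written in
    blocks. *)
Definition refl2 n (p q : R) : 'M[R]_n.+2 :=
  block_mx (p%:M : 'M[R]_1) (row_cons q 0) (row_cons q 0)^T
    (block_mx ((- p)%:M : 'M[R]_1) 0 0 1%:M : 'M[R]_(1 + n)).

Lemma row_cons_refl2 n (p q a b : R) (x : 'rV[R]_n) :
  row_cons a (row_cons b x) *m refl2 n p q =
  row_cons (p * a + q * b) (row_cons (q * a - p * b) x).
Proof.
rewrite {1}/row_cons /refl2 [LHS](@mul_row_block R 1 1 n.+1 1 n.+1).
rewrite row_cons_mul_block mulmx1.
have e1 : (row_cons b x *m (row_cons q 0)^T) ord0 ord0 = b * q.
  rewrite mxE big_ord_recl [_^T _ _]mxE !row_cons0 big1 ?addr0// => j _.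
  by rewrite [_^T _ _]mxE !row_consS [X in _ * X]mxE mulr0.
have e2 : (const_mx a : 'rV[R]_1) *m row_cons q (0 : 'rV[R]_n) = row_cons (a * q) 0.
  by apply: eq_row_cons => [|i]; rewrite mxE big_ord1 [const_mx _ _ _]mxE ?row_cons0// row_consS !mxE mulr0.
transitivity (row_mx (const_mx (p * a + q * b) : 'rV[R]_1) (row_cons (q * a - p * b) x)) => //.
apply: (f_equal2 (@row_mx R 1 1 n.+1)).
  by apply/rowP => i; rewrite (ord1 i) mul_mx_scalar mxE e1 !mxE; ring.
rewrite e2; apply: eq_row_cons => [|i].
  by rewrite mxE !row_cons0; ring.
by rewrite mxE !row_consS mxE add0r.
Qed.

Lemma gauss_invariant_refl2 n (p q : R) : q != 0 -> p ^+ 2 + q ^+ 2 = 1 ->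
  gauss_invariant (refl2 n p q).
Proof.
move=> q0 pq G mG G0.
rewrite (@integral_rowS _ _ (fun x => G (x *m refl2 n p q)))//;
  last by apply: (mrv_comp mG); apply: mcoord_mul; exact: mcoord_row_of.
rewrite (integral_rowS mG G0).
pose K (ab : gR * gR) := (\int[gprob n]_t G (row_cons ab.1 (row_cons ab.2 (row_of t))))%E.
have mK : measurable_fun setT K.
  apply: (@measurable_fun_fubini_tonelli_F _ _ _ _ _ (gprob n)
    (fun p => G (row_cons p.1.1 (row_cons p.1.2 (row_of p.2))))) => //.
  apply: (mrv_comp mG); apply: mcoord_row_cons; first exact: measurableT_comp.
  by apply: mcoord_row_cons; [exact: measurableT_comp|exact: mcoord_row_of].
have K0 ab : (0 <= K ab)%E by exact: integral_ge0.
transitivity (\int[gam]_a \int[gam]_b K (a, b))%E; last first.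
  apply: eq_integral => a _; rewrite (@integral_rowS _ _ (fun x => G (row_cons a x)))//.
  exact: mrv_row_cons.
rewrite (normal01_reflection q0 pq mK K0); apply: eq_integral => a _.
rewrite (@integral_rowS _ _ (fun x => G (row_cons a x *m refl2 n p q)))//.
  by apply: eq_integral => b _; apply: eq_integral => t _; rewrite row_cons_refl2.
apply: (mrv_comp mG); apply: mcoord_mul; apply: mcoord_row_cons => //; exact: mcoord_row_of.
Qed.

Lemma sqn_eq1_block n (a : R) (v : 'rV[R]_n) : sqn (row_cons a v) = 1 -> sqn v = 0 ->
  v = 0 /\ (a = 1 \/ a = -1).
Proof.
rewrite sqn_row_cons => e v0; split.
  apply/rowP => i; rewrite mxE; apply/eqP; rewrite -sqrf_eq0; apply/eqP.
  have := psumr_eq0P (fun i _ => sqr_ge0 (v ord0 i)) v0; exact.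
by move: e; rewrite v0 addr0 => /eqP; rewrite sqrf_eq1 => /orP[]/eqP ->; [left|right].
Qed.

Lemma sqnZ n (c : R) (v : 'rV[R]_n) : sqn (c *: v) = c ^+ 2 * sqn v.
Proof. by rewrite /sqn mulr_sumr; apply: eq_bigr => i _; rewrite mxE exprMn. Qed.

Lemma sqn_eq0 n (v : 'rV[R]_n) : sqn v = 0 -> v = 0.
Proof.
move=> v0; apply/rowP => i; rewrite mxE; apply/eqP; rewrite -sqrf_eq0; apply/eqP.
have := psumr_eq0P (fun i _ => sqr_ge0 (v ord0 i)) v0; exact.
Qed.

Lemma block_orthogonal n (c : R) (U : 'M[R]_n) : c = 1 \/ c = -1 -> U *m U^T = 1%:M ->
  (block_mx (c%:M : 'M[R]_1) 0 0 U : 'M[R]_(1 + n)) *m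
  (block_mx (c%:M : 'M[R]_1) 0 0 U : 'M[R]_(1 + n))^T = 1%:M.
Proof.
move=> c1 UU; rewrite tr_block_mx !trmx0 mulmx_block !mulmx0 !mul0mx !addr0 !add0r UU.
rewrite tr_scalar_mx -scalar_mxM (_ : c * c = 1) ?scalar_mx_block//.
by case: c1 => ->; rewrite ?mulrNN mulr1.
Qed.

Lemma refl2_orthogonal n (p q : R) : p ^+ 2 + q ^+ 2 = 1 ->
  refl2 n p q *m (refl2 n p q)^T = 1%:M.
Proof.
move=> pq.
have sym : (refl2 n p q)^T = refl2 n p q.
  rewrite /refl2 [LHS](@tr_block_mx _ 1 n.+1 1 n.+1) trmxK (@tr_block_mx _ 1 n 1 n).
  by rewrite !trmx0 !tr_scalar_mx.
rewrite sym; apply/row_matrixP => i.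
rewrite !rowE mulmx1 mulmxA; move: (delta_mx 0 i) => y.
rewrite (row_cons_eta y); set y' := \row__ _; rewrite (row_cons_eta y').
rewrite !row_cons_refl2; congr row_cons; last congr row_cons.
  by rewrite -[RHS]mul1r -pq; ring.
by rewrite -[RHS]mul1r -pq; ring.
Qed.

(* Householder: any unit vector is the first row of an orthogonal matrix. *)
Lemma orthogonal_first_row n (v : 'rV[R]_n.+1) : sqn v = 1 ->
  exists U : 'M[R]_n.+1, [/\ gauss_invariant U, U *m U^T = 1%:M &
    row_cons 1 0 *m U = v].
Proof.
elim: n v => [|n IH] v v1.
  rewrite (row_cons_eta v) in v1 *; set a := v ord0 ord0 in v1 *; set w := \row_i _ in v1 *.
  have [w0 a1] : w = 0 /\ (a = 1 \/ a = -1) by apply: sqn_eq1_block => //; rewrite sqn0.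
  exists (block_mx (a%:M : 'M[R]_1) 0 0 1%:M : 'M[R]_(1 + 0)); split.
  - by apply: gauss_invariant_block => // G _ _; apply: eq_integral => t _; rewrite mulmx1.
  - by apply: block_orthogonal => //; rewrite trmx1 mulmx1.
  - by rewrite row_cons_mul_block mul1r mulmx1 w0.
rewrite (row_cons_eta v) in v1 *; set a := v ord0 ord0 in v1 *; set w := \row_i _ in v1 *.
have [w0|w0] := eqVneq (sqn w) 0.
  have [-> a1] := sqn_eq1_block v1 w0.
  exists (block_mx (a%:M : 'M[R]_1) 0 0 1%:M : 'M[R]_(1 + n.+1)); split.
  - by apply: gauss_invariant_block => // G _ _; apply: eq_integral => t _; rewrite mulmx1.
  - by apply: block_orthogonal => //; rewrite trmx1 mulmx1.
  - by rewrite row_cons_mul_block mul1r mulmx1.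
pose r := Num.sqrt (sqn w).
have r2 : r ^+ 2 = sqn w by rewrite sqr_sqrtr// sqn_ge0.
have r0 : r != 0 by apply: contra_neq w0 => r0; rewrite -r2 r0 expr0n.
have [|U [iU UU Uw]] := IH (r^-1 *: w).
  by rewrite sqnZ exprVn r2 mulVf.
have ar : a ^+ 2 + r ^+ 2 = 1 by rewrite r2 -sqn_row_cons.
(* With v = (a, w) and r = |w|, the reflection sends e_1 to a e_1 + r e_2, and the block then sends
   e_2 to w / r. *)
exists (refl2 n a r *m (block_mx (1%:M : 'M[R]_1) 0 0 U : 'M[R]_(1 + n.+1))); split.
- apply: gauss_invariantM; first exact: gauss_invariant_refl2.
  by apply: gauss_invariant_block => //; left.
- rewrite trmx_mul mulmxA -[X in X *m _]mulmxA block_orthogonal//; last by left.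
  by rewrite mulmx1 refl2_orthogonal.
- rewrite mulmxA (_ : row_cons 1 (0 : 'rV[R]_n.+1) = row_cons 1 (row_cons 0 0)); last first.
    by congr row_cons; apply: eq_row_cons => [|i]; rewrite !mxE.
  rewrite row_cons_refl2 !mulr1 !mulr0 subr0 addr0 row_cons_mul_block mulr1.
  congr row_cons; rewrite (_ : row_cons r 0 = r *: row_cons 1 0); last first.
    by rewrite scale_row_cons mulr1 scaler0.
  by rewrite -scalemxAl Uw scalerA divff// scale1r.
Qed.

Lemma qformE n (S : 'M[R]_n) (x : 'rV[R]_n) :
  qform S x = \sum_i \sum_j (x ord0 i * S i j * x ord0 j).
Proof.
rewrite /qform mxE exchange_big; apply: eq_bigr => j _.
by rewrite [x^T _ _]mxE mxE mulr_suml.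
Qed.

Lemma qformZ n (S : 'M[R]_n) c (x : 'rV[R]_n) : qform S (c *: x) = c ^+ 2 * qform S x.
Proof.
rewrite !qformE mulr_sumr; apply: eq_bigr => i _; rewrite mulr_sumr; apply: eq_bigr => j _.
by rewrite !mxE; ring.
Qed.

Lemma dotpE n (x y : 'rV[R]_n) : dotp x y = (x *m y^T) ord0 ord0.
Proof. by rewrite mxE; apply: eq_bigr => i _; rewrite mxE. Qed.

Lemma dotpC n (x y : 'rV[R]_n) : dotp x y = dotp y x.
Proof. by apply: eq_bigr => i _; rewrite mulrC. Qed.

Lemma qform_add n (S : 'M[R]_n) (x y : 'rV[R]_n) t : S^T = S ->
  qform S (x + t *: y) = qform S x + 2 * t * dotp (x *m S) y + t ^+ 2 * qform S y.
Proof.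
move=> Ssym.
have sw : dotp (y *m S) x = dotp (x *m S) y.
  rewrite dotpC !dotpE trmx_mul Ssym mulmxA//.
have e z z' : (z *m S *m z'^T) ord0 ord0 = dotp (z *m S) z' by rewrite dotpE.
rewrite /qform mulmxDl linearD /= mulmxDl !mulmxDr linearZ /= -!scalemxAl -!scalemxAr.
have mD (A B : 'M[R]_1) : (A + B) ord0 ord0 = A ord0 ord0 + B ord0 ord0 by rewrite mxE.
have mZ c (A : 'M[R]_1) : (c *: A) ord0 ord0 = c * A ord0 ord0 by rewrite mxE.
by rewrite !mD !mZ !e sw; ring.
Qed.

Lemma sqn_add n (x y : 'rV[R]_n) t :
  sqn (x + t *: y) = sqn x + 2 * t * dotp x y + t ^+ 2 * sqn y.
Proof.
rewrite /sqn /dotp !mulr_sumr -!big_split /=; apply: eq_bigr => i _.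
by rewrite !mxE; ring.
Qed.

Lemma continuous_sumr (T : topologicalType) (I : Type) (r : seq I) (F : I -> T -> R) :
  (forall i, continuous (F i)) -> continuous (fun x => \sum_(i <- r) F i x).
Proof.
move=> cF; elim: r => [|i r IHr] x.
  by under eq_fun do rewrite big_nil; exact: cvg_cst.
under eq_fun do rewrite big_cons.
by apply: cvgD; [exact: cF|exact: IHr].
Qed.

Lemma continuous_qform n (S : 'M[R]_n) : continuous (@qform R n S).
Proof.
rewrite (_ : qform S = (fun x : 'rV[R]_n => \sum_i \sum_j (x ord0 i * S i j * x ord0 j))); last first.
  by apply/funext => y; rewrite qformE.
apply: (@continuous_sumr _ _ _ (fun i (x : 'rV[R]_n) => \sum_j (x ord0 i * S i j * x ord0 j))) => i.
apply: (@continuous_sumr _ _ _ (fun j (x : 'rV[R]_n) => x ord0 i * S i j * x ord0 j)) => j x.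
apply: (@continuousM _ _ (fun x : 'rV[R]_n => x ord0 i * S i j) (fun x => x ord0 j));
  last exact: coord_continuous.
apply: (@continuousM _ _ (fun x : 'rV[R]_n => x ord0 i) (cst (S i j)));
  [exact: coord_continuous|exact: cst_continuous].
Qed.

(** A maximizer v of the form on the compact unit sphere, with value l, is an eigenvector: along v +
    t w with w = l v - v S, the nonnegative gap l |x|^2 - <Sx, x> equals 2 t |w|^2 + t^2 C, which
    forces w = 0. *)
Lemma real_eigenvector n (S : 'M[R]_n.+1) : S^T = S ->
  exists (v : 'rV[R]_n.+1) (l : R), sqn v = 1 /\ v *m S = l *: v.
Proof.
move=> Ssym.
pose A : set 'rV[R]_n.+1 := [set x | sqn x = 1].
have csqn : continuous (@sqn R n.+1).
  apply: (@continuous_sumr _ _ _ (fun i (x : 'rV[R]_n.+1) => x ord0 i ^+ 2)) => i x.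
  apply: (@continuous_comp _ _ _ (fun x : 'rV[R]_n.+1 => x ord0 i) (fun y : R => y ^+ 2)).
    exact: coord_continuous.
  exact: exprn_continuous.
have cq := @continuous_qform _ S.
have A0 : A !=set0.
  exists (row_cons 1 0); rewrite /A /= sqn_row_cons expr1n /sqn big1 ?addr0// => i _.
  by rewrite mxE expr0n.
have cA : compact A.
  apply: bounded_closed_compact.
    exists 1; split => // M M1 x /= x1; apply: le_trans (ltW M1).
    rewrite /Num.norm /=; have [->//|/mx_norm_neq0[[i j] ->]] := eqVneq (mx_norm x) 0.
    rewrite /= (ord1 i) -(@ler_pXn2r _ 2)// ?nnegrE// expr1n real_normK ?num_real// -x1.
    by rewrite /sqn (bigD1 j)//= lerDl sumr_ge0// => k _; exact: sqr_ge0.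
  apply: (@closed_comp _ _ (@sqn R n.+1) [set 1]); last exact: closed_eq.
  by move=> x _; exact: csqn.
have [v] := EVT_max_rV A0 cA (continuous_subspaceT cq).
rewrite inE => v1 vmax.
pose l := qform S v.
have qle x : qform S x <= l * sqn x.
  have [x0|x0] := eqVneq (sqn x) 0.
    by rewrite x0 (sqn_eq0 x0) mulr0 /qform !mul0mx mxE.
  have sx0 : 0 < sqn x by rewrite lt_neqAle eq_sym x0 sqn_ge0.
  pose r := Num.sqrt (sqn x).
  have r2 : r ^+ 2 = sqn x by rewrite sqr_sqrtr// ltW.
  have := vmax (r^-1 *: x); rewrite inE /A /= sqnZ exprVn r2 mulVf// => /(_ erefl).
  by rewrite qformZ exprVn r2 -/l mulrC ler_pdivrMr.
pose w := l *: v - v *m S.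
exists v, l; split => //.
suff w0 : w = 0 by apply/esym/eqP; rewrite -subr_eq0 -/w w0.
apply: sqn_eq0; apply/eqP; rewrite eq_le sqn_ge0 andbT leNgt; apply/negP => w0.
pose C := l * sqn w - qform S w.
have C0 : 0 <= C by rewrite subr_ge0.
have C1 : 0 < C + 1 by rewrite ltr_wpDl.
have key t : 0 <= 2 * t * sqn w + t ^+ 2 * C.
  have := qle (v + t *: w); rewrite -subr_ge0.
  suff -> : l * sqn (v + t *: w) - qform S (v + t *: w) = 2 * t * sqn w + t ^+ 2 * C by [].
  rewrite qform_add// sqn_add v1 -/l.
  have -> : dotp (v *m S) w = l * dotp v w - sqn w.
    rewrite -[sqn w]/(sqn w) /sqn /dotp mulr_sumr -sumrB; apply: eq_bigr => i _.
    have -> : w ord0 i = l * v ord0 i - (v *m S) ord0 i by rewrite !mxE.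
    by ring.
  by rewrite /C; ring.
(* Small enough for the linear term to win: the value is -(|w|^2 / (C + 1))^2 (C + 2), and C + 1
   avoids a division by C = 0. *)
have := key (- (sqn w / (C + 1))).
apply/negP; rewrite -ltNge.
have -> : 2 * - (sqn w / (C + 1)) * sqn w + (- (sqn w / (C + 1))) ^+ 2 * C =
  - (sqn w / (C + 1)) ^+ 2 * (C + 2) by field; rewrite gt_eqF.
by rewrite mulNr oppr_lt0 mulr_gt0// ?exprn_gt0 ?divr_gt0// ltr_wpDl.
Qed.

(** After the rotation that sends e_1 to a unit eigenvector, symmetry clears the first row and
    column off the diagonal, and the induction continues on the remaining block. *)
Lemma spectral n (S : 'M[R]_n) : S^T = S ->
  exists (U : 'M[R]_n) (s : 'rV[R]_n), [/\ gauss_invariant U, U *m U^T = 1%:M &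
    forall x, qform S (x *m U) = \sum_i s ord0 i * x ord0 i ^+ 2].
Proof.
elim: n S => [|n IH] S Ssym.
  exists 1%:M, 0; split.
  - by move=> G _ _; apply: eq_integral => t _; rewrite mulmx1.
  - by rewrite trmx1 mulmx1.
  - by move=> x; rewrite qformE !big_ord0.
have [v [l [v1 vl]]] := real_eigenvector Ssym.
have [U0 [iU0 UU0 U0v]] := orthogonal_first_row v1.
pose M := U0 *m S *m U0^T.
have Msym : M^T = M by rewrite /M !trmx_mul trmxK Ssym mulmxA.
have qM x : qform S (x *m U0) = qform M x by rewrite /qform /M trmx_mul !mulmxA.
have M0 j : M ord0 j = l * (row_cons 1 0 : 'rV[R]_n.+1) ord0 j.
  have : row_cons 1 0 *m M = l *: row_cons 1 0.
    by rewrite /M !mulmxA U0v vl -scalemxAl -{1}U0v -mulmxA UU0 mulmx1.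
  move=> /matrixP/(_ ord0 j); rewrite [RHS]mxE => <-.
  rewrite [RHS]mxE big_ord_recl row_cons0 mul1r big1 ?addr0// => i _.
  by rewrite row_consS mxE mul0r.
clearbody M.
have M0' j : M j ord0 = M ord0 j by rewrite -{1}Msym mxE.
pose S' := \matrix_(i < n, j < n) M (lift ord0 i) (lift ord0 j).
have S'sym : S'^T = S' by apply/matrixP => i j; rewrite !mxE -{1}Msym mxE.
have z0 i : (0 : 'rV[R]_n) ord0 i = 0 by rewrite mxE.
have qS' a y : qform M (row_cons a y) = l * a ^+ 2 + qform S' y.
  rewrite !qformE big_ord_recl big_ord_recl !row_cons0 M0 row_cons0 mulr1.
  rewrite big1 ?addr0; last first.
    by move=> i _; rewrite M0 row_consS mxE mulr0 mulr0 mul0r.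
  congr (_ + _); first by rewrite expr2 mulrAC mulrC mulrA.
  apply: eq_bigr => i _; rewrite big_ord_recl M0' M0 !row_consS z0 !mulr0 mul0r add0r.
  by apply: eq_bigr => j _; rewrite !row_consS !mxE.
have [U' [s' [iU' UU' qU']]] := IH S' S'sym.
exists ((block_mx (1%:M : 'M[R]_1) 0 0 U' : 'M[R]_(1 + n)) *m U0), (row_cons l s'); split.
- by apply: gauss_invariantM => //; apply: gauss_invariant_block => //; left.
- rewrite trmx_mul mulmxA -[X in X *m _]mulmxA UU0 mulmx1.
  by apply: block_orthogonal => //; left.
- move=> x; rewrite mulmxA qM (row_cons_eta x) row_cons_mul_block mulr1 qS' qU'.
  rewrite big_ord_recl !row_cons0; congr (_ + _).
  by apply: eq_bigr => i _; rewrite !row_consS.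
Qed.

End orthogonal.

(** * Real-valued integrals against a probability *)

Section integrable_toolbox.
Context d (T : measurableType d) {R : realType} (P : probability T R).

Implicit Types g h : T -> R.

Definition rintegrable (g : T -> R) := P.-integrable setT (EFin \o g).

Lemma rintegrableD g h : rintegrable g -> rintegrable h -> rintegrable (fun x => g x + h x).
Proof. by move=> ig ih; exact: (integrableD measurableT ig ih). Qed.

Lemma rintegrableZ c g : rintegrable g -> rintegrable (fun x => c * g x).
Proof. by move=> ig; exact: (integrableZl measurableT c ig). Qed.

Lemma rintegrable_cst c : rintegrable (fun=> c).
Proof. exact: finite_measure_integrable_cst. Qed.

Lemma rintegrable_le g h : measurable_fun setT g -> (forall x, `|g x| <= h x) ->
  rintegrable h -> rintegrable g.
Proof.
move=> mg gh ih; apply: le_integrable ih => //; first exact/measurable_EFinP.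
by move=> x _; rewrite /= lee_fin (le_trans (gh x))// ler_norm.
Qed.

Lemma rintegrable_ge0 g : measurable_fun setT g -> (forall x, 0 <= g x) ->
  (\int[P]_x (g x)%:E < +oo)%E -> rintegrable g.
Proof.
move=> mg g0 gy; apply/integrableP; split; first exact/measurable_EFinP.
by under eq_integral do rewrite /= ger0_norm//.
Qed.

Lemma rintD g h : rintegrable g -> rintegrable h ->
  \int[P]_x (g x + h x) = \int[P]_x g x + \int[P]_x h x.
Proof. by move=> ig ih; exact: (RintegralD measurableT). Qed.

Lemma rintZ c g : rintegrable g -> \int[P]_x (c * g x) = c * \int[P]_x g x.
Proof. by move=> ig; exact: (RintegralZl c measurableT ig). Qed.

Lemma rint_cst (c : R) : \int[P]_x c = c.
Proof. by rewrite [LHS]Rintegral_cst//= (_ : P setT = 1%E) ?mulr1//; exact: probability_setT. Qed.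

Lemma rint_le g h : rintegrable g -> rintegrable h -> (forall x, g x <= h x) ->
  \int[P]_x g x <= \int[P]_x h x.
Proof. by move=> ig ih gh; apply: le_Rintegral. Qed.

Lemma rint_dct (g_ : nat -> T -> R) g h : (forall m, measurable_fun setT (g_ m)) ->
  (forall x, g_ m x @[m --> \oo] --> g x) -> (forall m x, `|g_ m x| <= h x) ->
  rintegrable h ->
  rintegrable g /\ \int[P]_x g_ m x @[m --> \oo] --> \int[P]_x g x.
Proof.
move=> mg gg gh ih.
have gE x : EFin (g_ m x) @[m --> \oo] --> (g x)%:E by apply/fine_cvgP; split; [exact: nearW|exact: gg].
have mg' : measurable_fun setT g by exact: (measurable_fun_cvg mg (fun x _ => gg x)).
have [ig _ c] := @dominated_convergence _ _ _ P setT measurableT (fun m => EFin \o g_ m)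
  (EFin \o g) (EFin \o h) (fun m => (measurable_EFinP _ _).2 (mg m))
  ((measurable_EFinP _ _).2 mg')
  (aeW _ (fun x _ => gE x)) ih
  (aeW _ (fun x m _ => gh m x)).
split => //; apply: fine_cvg; rewrite fineK //.
exact: integrable_fin_num.
Qed.

End integrable_toolbox.

(** * The exponential weight that dominates the error terms *)

Section gauss_weight.
Context {R : realType}.
Variable n : nat.
Local Notation gR := (measurableTypeR R).
Local Notation mu := (@gprob R n).
Implicit Types x z : 'rV[R]_n.

(** The common integrable majorant of the quantities of polynomial growth below; the exponent is the
    one of [gprob_expsq]. *)
Definition wexp x : R := expR (sqn x / 8).

Lemma wexp_gt0 x : 0 < wexp x. Proof. exact: expR_gt0. Qed.
Lemma wexp_ge1 x : 1 <= wexp x.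
Proof. by rewrite -expR0 ler_expR divr_ge0// sqn_ge0. Qed.

Lemma sqn_le_wexp x : sqn x <= 8 * wexp x.
Proof. by have := expR_ge1Dx (sqn x / 8); rewrite -/(wexp x); lra. Qed.

Lemma measurable_wexp : measurable_fun setT (fun t : n.-tuple gR => wexp (row_of t)).
Proof.
apply: (measurableT_comp (@measurable_expR R)); apply: measurable_funM => //.
by apply: measurable_sqn; exact: mcoord_row_of.
Qed.

Lemma rintegrable_wexp : rintegrable mu (fun t => wexp (row_of t)).
Proof.
apply: rintegrable_ge0; first exact: measurable_wexp.
  by move=> t; exact: ltW (wexp_gt0 _).
exact: gprob_expsq.
Qed.

Lemma rintegrable_wexp_le (g : 'rV[R]_n -> R) (C : R) :
  measurable_fun setT (fun t => g (row_of t)) -> (forall x, `|g x| <= C * wexp x) ->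
  rintegrable mu (fun t => g (row_of t)).
Proof.
move=> mg gC; apply: (@rintegrable_le _ _ _ _ _ (fun t => C * wexp (row_of t))) => //.
by apply: rintegrableZ; exact: rintegrable_wexp.
Qed.

(** With u = (1 + |x|^2 + |z|^2) / 8, the cube is 24^3 (u / 3)^3 <= 24^3 e^u. The bound is a product
    in x and z, so integrating in z leaves a multiple of [wexp x]. *)
Lemma cube_le_wexp x z : (1 + sqn x + sqn z) ^+ 3 <= 24 ^+ 3 * expR (1 / 8) * (wexp x * wexp z).
Proof.
pose u := (1 + sqn x + sqn z) / 8.
have S0 : 0 <= 1 + sqn x + sqn z by rewrite !addr_ge0// sqn_ge0.
have e : expR (1 / 8) * (wexp x * wexp z) = expR (u / 3) ^+ 3.
  by rewrite /wexp -!expRD -expRM_natl; congr expR; rewrite /u; field.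
rewrite -mulrA e -exprMn lerXn2r// ?nnegrE// ?mulr_ge0 ?expR_ge0//.
by have := expR_ge1Dx (u / 3); rewrite /u; lra.
Qed.

Lemma rint_sqn : \int[mu]_t sqn (row_of t) = n%:R.
Proof. by rewrite /Rintegral gprob_sqn. Qed.

Lemma measurable_sqn_row : measurable_fun setT (fun t : n.-tuple gR => sqn (row_of t)).
Proof. by apply: measurable_sqn; exact: mcoord_row_of. Qed.

Lemma rintegrable_sqn : rintegrable mu (fun t => sqn (row_of t)).
Proof.
apply: (@rintegrable_wexp_le (@sqn R n) 8); first exact: measurable_sqn_row.
by move=> x; rewrite ger0_norm ?sqn_ge0//; exact: sqn_le_wexp.
Qed.

Lemma dotp_sqr_le (v z : 'rV[R]_n) : `|dotp v z| <= (sqn v + sqn z) / 2.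
Proof.
apply: le_trans (ler_norm_sum _ _ _) _.
rewrite /sqn -big_split /= mulr_suml; apply: ler_sum => i _.
rewrite normrM -(real_normK (num_real (v ord0 i))) -(real_normK (num_real (z ord0 i))).
have := sqr_ge0 (`|v ord0 i| - `|z ord0 i|); rewrite sqrrB; lra.
Qed.

Lemma measurable_dotp_row v : measurable_fun setT (fun t : n.-tuple gR => dotp v (row_of t)).
Proof. by apply: measurable_dotp; [exact: mcoord_cst|exact: mcoord_row_of]. Qed.

Lemma rintegrable_dotp v : rintegrable mu (fun t => dotp v (row_of t)).
Proof.
apply: (@rintegrable_wexp_le (dotp v) (sqn v + 8)); first exact: measurable_dotp_row.
move=> x; apply: le_trans (dotp_sqr_le v x) _.
have := sqn_le_wexp x; have := wexp_ge1 x; have := sqn_ge0 v => v0 w1 w2.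
have : sqn v <= sqn v * wexp x by rewrite ler_peMr.
by rewrite mulrDl; lra.
Qed.

(** The second moments of [dotp v z + 1] and [dotp v z] differ by 1, and, expanding the square, by
    twice the mean plus 1. *)
Lemma rint_dotp v : \int[mu]_t dotp v (row_of t) = 0.
Proof.
have H c : \int[mu]_t (dotp v (row_of t) + c) ^+ 2 = sqn v + c ^+ 2.
  by rewrite /Rintegral gprob_dotp2.
have I2 : rintegrable mu (fun t => (dotp v (row_of t) + 0) ^+ 2).
  apply: rintegrable_ge0.
  - apply: (measurableT_comp (@exprn_measurable R _ 2)).
    by apply: measurable_funD => //; exact: measurable_dotp_row.
  - by move=> t; exact: sqr_ge0.
  - by rewrite gprob_dotp2 ltry.
have := H 1; rewrite (_ : \int[mu]_t _ =
  \int[mu]_t ((dotp v (row_of t) + 0) ^+ 2 + (2 * dotp v (row_of t) + 1))); last first.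
  by apply: eq_Rintegral => t _; ring.
have Il := rintegrable_dotp v.
rewrite rintD//; last by apply: rintegrableD; [exact: rintegrableZ|exact: rintegrable_cst].
rewrite rintD//; [|exact: rintegrableZ|exact: rintegrable_cst].
by rewrite rintZ// rint_cst H; lra.
Qed.

Lemma rintegrable_dotp2 v : rintegrable mu (fun t => dotp v (row_of t) ^+ 2).
Proof.
apply: rintegrable_ge0.
- by apply: (measurableT_comp (@exprn_measurable R _ 2)); exact: measurable_dotp_row.
- by move=> t; exact: sqr_ge0.
- have := gprob_dotp2 v 0; under eq_integral do rewrite addr0.
  by move=> ->; rewrite ltry.
Qed.

Lemma rint_dotp2 v : \int[mu]_t dotp v (row_of t) ^+ 2 = sqn v.
Proof.
have := gprob_dotp2 v 0; under eq_integral do rewrite addr0.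
by rewrite /Rintegral => ->; rewrite expr0n addr0.
Qed.

End gauss_weight.

Lemma measurable_of_is_derive (R : realType) (q q' : R -> R) :
  (forall t : R, is_derive t (1 : R) q (q' t)) -> measurable_fun setT q.
Proof.
move=> dq; apply: continuous_measurable_fun => t.
apply: differentiable_continuous; apply/derivable1_diffP.
exact: (@ex_derive _ _ _ _ _ _ _ (dq t)).
Qed.

(** * One step of the chain *)

Section one_step.
Context {R : realType}.
Variables (n : nat) (s : 'rV[R]_n).
Hypothesis s0 : forall i, 0 < s ord0 i.
Variables (K : R) (p p1 p2 p3 : R -> R).
Hypothesis dp : forall t : R, is_derive t (1 : R) p (p1 t).
Hypothesis dp1 : forall t : R, is_derive t (1 : R) p1 (p2 t).
Hypothesis dp2 : forall t : R, is_derive t (1 : R) p2 (p3 t).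
Hypothesis pK : forall t, [/\ p1 t <= 0, `|p1 t| <= K, `|p2 t| <= K & `|p3 t| <= K].
Local Notation gR := (measurableTypeR R).

Definition dform (x : 'rV[R]_n) := \sum_i s ord0 i * x ord0 i ^+ 2.
Local Notation T := dform.
Let smax : R := \sum_i s ord0 i.

(* Half of the generator of the diffusion with drift -Sigma^-1 x, reversible for
   the Gaussian measure, applied to p o T. *)
Definition gen (x : 'rV[R]_n) : R := p1 (T x) * (n%:R - sqn x) + 2 * T x * p2 (T x).

(** The coefficient of z in the increment [T (mix a b x z) - T x]; it is of order del. *)
Definition noise (a b x : 'rV[R]_n) : 'rV[R]_n :=
  \row_i (2 * s ord0 i * a ord0 i * b ord0 i * x ord0 i).

Let K0 : 0 <= K. Proof. by have [_ h _ _] := pK 0; exact: le_trans h. Qed.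

Lemma dform_ge0 x : 0 <= T x.
Proof. by apply: sumr_ge0 => i _; rewrite mulr_ge0 ?sqr_ge0 ?ltW. Qed.

Let s_le_smax i : s ord0 i <= smax.
Proof. by rewrite /smax (bigD1 i)//= lerDl sumr_ge0// => j _; exact: ltW. Qed.

Let smax0 : 0 <= smax. Proof. by apply: sumr_ge0 => i _; exact: ltW. Qed.

Lemma dform_le x : T x <= smax * sqn x.
Proof.
rewrite /sqn mulr_sumr; apply: ler_sum => i _.
by rewrite ler_wpM2r ?sqr_ge0.
Qed.

Lemma measurable_dform d (U : measurableType d) (phi : U -> 'rV[R]_n) :
  mcoord phi -> measurable_fun setT (fun t => T (phi t)).
Proof.
move=> mphi; apply: measurable_sum => i; apply: measurable_funM => //.
by apply: (measurableT_comp (@exprn_measurable R _ 2)); exact: mphi.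
Qed.

(** [kap * del] bounds s_i b_i, since (s_i b_i)^2 = 2 s_i del^2 and 2 smax <= kap^2. [C1] comes from
    the Taylor remainder, [C2] from [cube_le_wexp]; the term 64 K in [C3] pays for the del^4 part of
    the variance. *)
Let kap : R := 1 + 2 * smax.
Let C1 : R := K * ((kap + 2) ^+ 3 + 2 * kap + 2).
Let C2 : R := 24 ^+ 3 * expR (1 / 8).
Let Z : R := \int[gprob n]_t wexp (row_of t).
Let C3 : R := C1 * C2 * Z + 64 * K.

Let kap1 : 1 <= kap. Proof. by rewrite /kap lerDl mulr_ge0. Qed.
Let C10 : 0 <= C1.
Proof.
have := kap1 => k1; rewrite /C1 mulr_ge0// !addr_ge0// ?exprn_ge0// ?mulr_ge0//; lra.
Qed.

(** The increment of T is exactly D = 2 del^2 (|z|^2 - |x|^2) + N with N = <noise, z>: the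
    normalization s_i b_i^2 = 2 del^2 removes s from the first part. As N = O(del) and D - N =
    O(del^2), replacing D^2 by N^2 in Taylor's formula costs O(del^3), like the cubic remainder. *)
Lemma one_step_taylor (del : R) (a b x z : 'rV[R]_n) : 0 < del <= 1 ->
  (forall i, 0 <= a ord0 i) -> (forall i, 0 <= b ord0 i) ->
  (forall i, a ord0 i ^+ 2 + b ord0 i ^+ 2 = 1) ->
  (forall i, s ord0 i * b ord0 i ^+ 2 = 2 * del ^+ 2) ->
  p (T (mix a b x z)) <= p (T x) + p1 (T x) * (2 * del ^+ 2 * (sqn z - sqn x) + dotp (noise a b x) z)
     + p2 (T x) * dotp (noise a b x) z ^+ 2 / 2 + C1 * del ^+ 3 * (1 + sqn x + sqn z) ^+ 3.
Proof.
move=> /andP[d0 d1] a0 b0 ab sb; set v := noise a b x.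
set N := dotp v z; pose D := 2 * del ^+ 2 * (sqn z - sqn x) + N.
set S := 1 + sqn x + sqn z.
have sx := sqn_ge0 x; have sz := sqn_ge0 z.
have S1 : 1 <= S by rewrite /S; lra.
have TD : T (mix a b x z) = T x + D.
  rewrite /D /N /dotp /sqn -sumrB mulr_sumr -!big_split /=; apply: eq_bigr => i _.
  rewrite [mix _ _ _ _ _ _]mxE [v _ _]mxE -(sb i).
  have -> : a ord0 i ^+ 2 = 1 - b ord0 i ^+ 2 ->
     s ord0 i * (a ord0 i * x ord0 i + b ord0 i * z ord0 i) ^+ 2 =
     s ord0 i * x ord0 i ^+ 2 + s ord0 i * b ord0 i ^+ 2 * (z ord0 i ^+ 2 - x ord0 i ^+ 2)
      + 2 * s ord0 i * a ord0 i * b ord0 i * x ord0 i * z ord0 i.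
    move=> e; transitivity (s ord0 i * (a ord0 i ^+ 2 * x ord0 i ^+ 2 +
       2 * a ord0 i * b ord0 i * x ord0 i * z ord0 i + b ord0 i ^+ 2 * z ord0 i ^+ 2)); first ring.
    by rewrite e; ring.
  - by ring.
  - by rewrite -(ab i); ring.
have sb0 i : 0 <= s ord0 i * b ord0 i by apply: mulr_ge0 => //; exact: ltW.
have sbk i : s ord0 i * b ord0 i <= kap * del.
  have kd0 : 0 <= kap * del by rewrite mulr_ge0 ?(ltW d0)//; have := kap1; lra.
  rewrite -(@ler_pXn2r _ 2)// ?nnegrE//.
  have -> : (s ord0 i * b ord0 i) ^+ 2 = 2 * s ord0 i * del ^+ 2.
    by transitivity (s ord0 i * (s ord0 i * b ord0 i ^+ 2)); [ring|rewrite sb; ring].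
  rewrite exprMn ler_wpM2r ?sqr_ge0//.
  have := s_le_smax i; rewrite /kap => h; have := smax0 => h0; nra.
have a1 i : a ord0 i <= 1.
  rewrite -(@ler_pXn2r _ 2)// ?nnegrE// expr1n -(ab i) lerDl; exact: sqr_ge0.
have NB : `|N| <= kap * del * S.
  apply: (@le_trans _ _ (kap * del * (sqn x + sqn z))); last first.
    by rewrite ler_wpM2l /S ?mulr_ge0 ?(ltW d0)//; [have := kap1|]; lra.
  apply: le_trans (ler_norm_sum _ _ _) _.
  rewrite /sqn -big_split /= mulr_sumr; apply: ler_sum => i _.
  rewrite [v _ _]mxE.
  rewrite (_ : 2 * s ord0 i * a ord0 i * b ord0 i * x ord0 i * z ord0 i =
    (s ord0 i * b ord0 i * a ord0 i) * (2 * x ord0 i * z ord0 i)); last by ring.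
  rewrite normrM; apply: ler_pM => //.
    rewrite ger0_norm; last exact: mulr_ge0.
    by apply: le_trans (sbk i); rewrite ler_piMr.
  rewrite ler_norml; apply/andP; split.
    have := sqr_ge0 (x ord0 i + z ord0 i); nra.
  have := sqr_ge0 (x ord0 i - z ord0 i); nra.
have DN : `|D - N| <= 2 * del ^+ 2 * S.
  have e0 : 0 <= 2 * del ^+ 2 by rewrite mulr_ge0// sqr_ge0.
  rewrite /D addrK normrM (ger0_norm e0); apply: ler_wpM2l => //.
  by rewrite /S ler_norml; apply/andP; split; lra.
have d2 : del ^+ 2 <= del by rewrite expr2 ler_piMr// ltW.
have DB : `|D| <= (kap + 2) * del * S.
  rewrite -[D](subrK N); apply: le_trans (ler_normD _ _) _.
  rewrite (_ : (kap + 2) * del * S = 2 * del * S + kap * del * S); last by ring.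
  apply: lerD => //; apply: le_trans DN _.
  by rewrite ler_wpM2r ?ler_pM2l//; lra.
have [_ _ p2K _] := pK (T x).
have tay := taylor2 dp dp1 dp2 (fun t => let: And4 _ _ _ h := pK t in h) (T x) D.
(* The factors D - N and D + N give S^2 only; S >= 1 raises it to the S^3 of the cubic remainder. *)
have D2 : `|D ^+ 2 - N ^+ 2| <= del ^+ 3 * S ^+ 3 * (4 * kap + 4).
  rewrite subr_sqr normrM.
  apply: (@le_trans _ _ (2 * del ^+ 2 * S * ((2 * kap + 2) * del * S))).
    apply: ler_pM => //; apply: le_trans (ler_normD _ _) _.
    by apply: le_trans (lerD DB NB) _; rewrite le_eqVlt; apply/orP; left; apply/eqP; ring.
  rewrite (_ : 2 * del ^+ 2 * S * ((2 * kap + 2) * del * S) = del ^+ 3 * S ^+ 2 * (4 * kap + 4)); last by ring.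
  rewrite ler_wpM2r//; first by have := kap1; lra.
  by rewrite ler_wpM2l ?exprn_ge0 ?(ltW d0)// [leRHS]exprS ler_peMl// sqr_ge0.
have D3 : K * `|D| ^+ 3 <= K * ((kap + 2) ^+ 3 * (del ^+ 3 * S ^+ 3)).
  rewrite ler_wpM2l//; rewrite -!exprMn mulrA lerXn2r// nnegrE//.
  by apply: le_trans DB.
rewrite TD.
have hp2 : p2 (T x) * (D ^+ 2 - N ^+ 2) <= K * (del ^+ 3 * S ^+ 3 * (4 * kap + 4)).
  apply: le_trans (ler_norm _) _; rewrite normrM; exact: ler_pM.
move: tay; rewrite ler_norml => /andP[_ tay].
have eC : C1 * del ^+ 3 * S ^+ 3 = K * ((kap + 2) ^+ 3 * (del ^+ 3 * S ^+ 3)) +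
    K * (del ^+ 3 * S ^+ 3 * (4 * kap + 4)) / 2.
  by rewrite /C1; move: kap => k; field.
rewrite eC -/D; move: tay D3 hp2; rewrite mulrBr.
move: (K * (del ^+ 3 * S ^+ 3 * (4 * kap + 4))) (K * ((kap + 2) ^+ 3 * (del ^+ 3 * S ^+ 3))) => r1 r2.
move: (K * `|D| ^+ 3) (p2 (T x) * D ^+ 2) (p2 (T x) * N ^+ 2) (p1 (T x) * D) => r3 r4 r5 r6.
by move: (p (T x)) (p (T x + D)) => r7 r8; lra.
Qed.

(** The Gaussian moments of z give n for |z|^2, 0 for N and |v|^2 = 8 del^2 T - 16 del^4 |x|^2 for
    N^2. The terms in del^2 add up to [2 * del ^+ 2 * gen x]; the one in del^4 is absorbed by [wexp]
    using del <= 1. *)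
Lemma one_step_mean (del : R) (a b x : 'rV[R]_n) (M : R) : 0 < del <= 1 ->
  (forall i, 0 <= a ord0 i) -> (forall i, 0 <= b ord0 i) ->
  (forall i, a ord0 i ^+ 2 + b ord0 i ^+ 2 = 1) ->
  (forall i, s ord0 i * b ord0 i ^+ 2 = 2 * del ^+ 2) ->
  (forall t, 0 <= p t <= M) ->
  \int[gprob n]_t p (T (mix a b x (row_of t))) <=
    p (T x) + 2 * del ^+ 2 * gen x + C3 * del ^+ 3 * wexp x.
Proof.
move=> d01 a0 b0 ab sb pM.
have /andP[d0 d1] := d01.
pose v := noise a b x.
have sv : sqn v = 8 * del ^+ 2 * T x - 16 * del ^+ 4 * sqn x.
  rewrite /sqn /T !mulr_sumr -sumrB; apply: eq_bigr => i _.
  rewrite mxE.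
  transitivity (4 * s ord0 i * (s ord0 i * b ord0 i ^+ 2) * a ord0 i ^+ 2 * x ord0 i ^+ 2); first ring.
  have -> : a ord0 i ^+ 2 = 1 - b ord0 i ^+ 2 by rewrite -(ab i); ring.
  rewrite sb; transitivity (8 * del ^+ 2 * s ord0 i * x ord0 i ^+ 2 -
     8 * del ^+ 2 * (s ord0 i * b ord0 i ^+ 2) * x ord0 i ^+ 2); first ring.
  by rewrite sb; ring.
have mp := measurable_of_is_derive dp.
pose c0 := p (T x) - p1 (T x) * (2 * del ^+ 2 * sqn x).
pose c1 := p1 (T x) * 2 * del ^+ 2.
pose c4 := C1 * del ^+ 3 * C2 * wexp x.
pose rhs z := c0 + (c1 * sqn z + (p1 (T x) * dotp v z + (p2 (T x) / 2 * dotp v z ^+ 2 + c4 * wexp z))).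
have I1 := rintegrableZ c1 (rintegrable_sqn (R := R) n).
have I2 := rintegrableZ (p1 (T x)) (rintegrable_dotp v).
have I3 := rintegrableZ (p2 (T x) / 2) (rintegrable_dotp2 v).
have I4 := rintegrableZ c4 (rintegrable_wexp (R := R) n).
have I34 := rintegrableD I3 I4.
have I234 := rintegrableD I2 I34.
have I1234 := rintegrableD I1 I234.
have Irhs := rintegrableD (rintegrable_cst (gprob n) c0) I1234.
have Ilhs : rintegrable (gprob n) (fun t => p (T (mix a b x (row_of t)))).
  apply: (@bounded_integrable _ _ _ _ M).
    apply: (measurableT_comp mp); apply: measurable_dform.
    by apply: mcoord_mix; [exact: mcoord_cst|exact: mcoord_row_of].
  by move=> t; have /andP[h1 h2] := pM (T (mix a b x (row_of t))); rewrite ger0_norm.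
have le1 : \int[gprob n]_t p (T (mix a b x (row_of t))) <= \int[gprob n]_t rhs (row_of t).
  apply: rint_le => // t; have := one_step_taylor x (row_of t) d01 a0 b0 ab sb.
  rewrite -/v => h; apply: le_trans h _.
  have := cube_le_wexp x (row_of t); rewrite -/C2 => h.
  have : C1 * del ^+ 3 * (1 + sqn x + sqn (row_of t)) ^+ 3 <=
      C1 * del ^+ 3 * (C2 * (wexp x * wexp (row_of t))).
    by rewrite ler_wpM2l// mulr_ge0// exprn_ge0// ltW.
  rewrite /rhs /c0 /c1 /c4.
  rewrite (_ : C1 * del ^+ 3 * C2 * wexp x * wexp (row_of t) =
      C1 * del ^+ 3 * (C2 * (wexp x * wexp (row_of t)))); last by ring.
  by lra.
apply: (le_trans le1).
rewrite rintD//; last exact: rintegrable_cst.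
rewrite rint_cst rintD// rintZ ?rint_sqn; last exact: rintegrable_sqn.
rewrite rintD// rintZ ?rint_dotp; last exact: rintegrable_dotp.
rewrite rintD// rintZ ?rint_dotp2; last exact: rintegrable_dotp2.
rewrite rintZ; last exact: rintegrable_wexp.
rewrite sv /gen /c0 /c1 /c4 /C3 -/Z.
have h1 : - (8 * del ^+ 4 * p2 (T x) * sqn x) <= 64 * K * del ^+ 3 * wexp x.
  have [_ _ p2K _] := pK (T x).
  rewrite (_ : - _ = (- p2 (T x)) * (8 * del ^+ 4 * sqn x)); last by ring.
  apply: (@le_trans _ _ (K * (8 * del ^+ 4 * sqn x))).
    rewrite ler_wpM2r ?mulr_ge0 ?sqn_ge0 ?exprn_ge0 ?(ltW d0)//.
    by move: p2K; rewrite ler_norml => /andP[]; lra.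
  rewrite (_ : 64 * K * del ^+ 3 * wexp x = K * (8 * del ^+ 3 * (8 * wexp x))); last by ring.
  rewrite ler_wpM2l//; apply: ler_pM; rewrite ?mulr_ge0 ?sqn_ge0 ?exprn_ge0 ?(ltW d0)//.
    rewrite ler_pM2l// [leLHS]exprS ler_piMl// exprn_ge0// ltW//.
  exact: sqn_le_wexp.
rewrite -subr_ge0; rewrite -subr_ge0 in h1.
set lhs := (X in 0 <= X).
suff -> : lhs = 64 * K * del ^+ 3 * wexp x - - (8 * del ^+ 4 * p2 (T x) * sqn x) by [].
by rewrite /lhs; field.
Qed.

(** The constant depends on neither [del] nor [x] nor [M], so the errors of successive steps simply
    add up. *)
Lemma one_step_bound : exists2 C, 0 <= C & forall (del : R) (a b x : 'rV[R]_n) (M : R),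
  0 < del <= 1 ->
  (forall i, 0 <= a ord0 i) -> (forall i, 0 <= b ord0 i) ->
  (forall i, a ord0 i ^+ 2 + b ord0 i ^+ 2 = 1) ->
  (forall i, s ord0 i * b ord0 i ^+ 2 = 2 * del ^+ 2) ->
  (forall t, 0 <= p t <= M) ->
  \int[gprob n]_t p (T (mix a b x (row_of t))) <=
    p (T x) + 2 * del ^+ 2 * gen x + C * del ^+ 3 * wexp x.
Proof.
exists C3; last by move=> *; apply: one_step_mean.
have Z0 : 0 <= Z by apply: Rintegral_ge0 => t _; exact: ltW (wexp_gt0 _).
have C20 : 0 <= C2 by rewrite mulr_ge0 ?exprn_ge0 ?expR_ge0.
by apply: addr_ge0; [apply: mulr_ge0 => //; exact: mulr_ge0|exact: mulr_ge0].
Qed.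

End one_step.

(** * Sign of the integral against the generator *)

Section monotone.
Context {R : realType}.
Variables (n : nat) (s : 'rV[R]_n).
Hypothesis s0 : forall i, 0 < s ord0 i.
Variables (K M : R) (p p1 p2 p3 : R -> R).
Hypothesis dp : forall t : R, is_derive t (1 : R) p (p1 t).
Hypothesis dp1 : forall t : R, is_derive t (1 : R) p1 (p2 t).
Hypothesis dp2 : forall t : R, is_derive t (1 : R) p2 (p3 t).
Hypothesis pK : forall t, [/\ p1 t <= 0, `|p1 t| <= K, `|p2 t| <= K & `|p3 t| <= K].
Hypothesis pM : forall t, 0 <= p t <= M.
Local Notation gR := (measurableTypeR R).
Local Notation T := (dform s).
Local Notation mu := (@gprob R n).
Local Notation gen := (gen s p1 p2).
Let smax : R := \sum_i s ord0 i.
Let K0 : 0 <= K. Proof. by have [_ h _ _] := pK 0; exact: le_trans h. Qed.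
Let smax0 : 0 <= smax. Proof. by apply: sumr_ge0 => i _; exact: ltW. Qed.
Let mp1 : measurable_fun setT p1 := measurable_of_is_derive dp1.
Let mp2 : measurable_fun setT p2 := measurable_of_is_derive dp2.
Let mp : measurable_fun setT p := measurable_of_is_derive dp.
Let mT : measurable_fun setT (fun t : n.-tuple gR => T (row_of t)).
Proof. by apply: measurable_dform; exact: mcoord_row_of. Qed.

Let p1_le0 t : p1 t <= 0. Proof. by have [] := pK t. Qed.

Lemma dformZ c (x : 'rV[R]_n) : T (c *: x) = c ^+ 2 * T x.
Proof. by rewrite /dform mulr_sumr; apply: eq_bigr => i _; rewrite mxE; ring. Qed.

(* Image of the density of the measure - p1 (T x) gamma(dx) under x |-> x / l. *)
Let W (x : 'rV[R]_n) (l : R) : R :=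
  - p1 (l ^+ 2 * T x) * l ^+ n * expR ((1 - l ^+ 2) * sqn x / 2).

Let W' (x : 'rV[R]_n) (l : R) : R :=
  - p2 (l ^+ 2 * T x) * (2 * l * T x) * l ^+ n * expR ((1 - l ^+ 2) * sqn x / 2) +
  - p1 (l ^+ 2 * T x) * (n%:R * l ^+ n.-1) * expR ((1 - l ^+ 2) * sqn x / 2) +
  - p1 (l ^+ 2 * T x) * l ^+ n * ((- l * sqn x) * expR ((1 - l ^+ 2) * sqn x / 2)).

Let dW x (l : R) : is_derive l (1 : R) (W x) (W' x l).
Proof.
have d1 : is_derive l (1 : R) (fun l => l ^+ 2 * T x) (2 * l * T x).
  have := is_derive_square (2 * T x) l.
  rewrite (_ : (fun _ => _) = (fun l => l ^+ 2 * T x)); last by apply/funext => u; field.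
  by rewrite (_ : 2 * T x * l = 2 * l * T x)//; ring.
have d2 : is_derive l (1 : R) (fun l => - p1 (l ^+ 2 * T x)) (- (p2 (l ^+ 2 * T x) * (2 * l * T x))).
  have := is_deriveN (@is_derive1_comp R p1 (fun l => l ^+ 2 * T x) l _ _ (dp1 _) d1).
  exact.
have d3 : is_derive l (1 : R) (fun l => l ^+ n) (n%:R * l ^+ n.-1).
  have := @is_deriveX R R id n l 1 1 (is_derive_id _ _).
  by rewrite /GRing.scale /= mulr1 exprfctE -mulr_natl.
have d4 : is_derive l (1 : R) (fun l => (1 - l ^+ 2) * sqn x / 2) (- l * sqn x).
  have := is_deriveB (is_derive_cst (sqn x / 2) l (1:R)) (is_derive_square (sqn x) l).
  rewrite (_ : _ - _ = (fun l => (1 - l ^+ 2) * sqn x / 2)); last first.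
    by apply/funext => u; change (sqn x / 2 - sqn x * u ^+ 2 / 2 = (1 - u ^+ 2) * sqn x / 2); field.
  by rewrite (_ : 0 - sqn x * l = - l * sqn x)//; ring.
have d5 := @is_derive1_comp R expR (fun l => (1 - l ^+ 2) * sqn x / 2) l _ _ (is_derive_expR _) d4.
have d6 := is_deriveM (is_deriveM d2 d3) d5.
apply: is_derive_eq d6 _.
change ((- p1 (l ^+ 2 * T x) * l ^+ n) * (expR ((1 - l ^+ 2) * sqn x / 2) * (- l * sqn x)) +
  expR ((1 - l ^+ 2) * sqn x / 2) * (- p1 (l ^+ 2 * T x) * (n%:R * l ^+ n.-1) +
    l ^+ n * - (p2 (l ^+ 2 * T x) * (2 * l * T x))) = W' x l).
by rewrite /W'; ring.
Qed.

(** Differentiating l^n, the Gaussian factor and p1 at l = 1 yields, up to sign, n p1, |x|^2 p1 and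
    2 T p2: this is the link between the generator and dilations. *)
Let W'1 x : W' x 1 = - gen x.
Proof.
by rewrite /W' /gen !expr1n subrr !mul0r expR0 !mul1r; ring.
Qed.

Let W1 x : W x 1 = - p1 (T x).
Proof. by rewrite /W !expr1n subrr !mul0r expR0 mul1r !mulr1. Qed.

Let CW : R := K * 2 ^+ n * (n%:R + 32 * smax + 16).

(** A majorant of the difference quotients at 1, uniform in l; the exponential is at most 1 because
    l >= 1. *)
Let W'_le x l : 1 <= l <= 2 -> `|W' x l| <= CW * wexp x.
Proof.
move=> /andP[l1 l2].
have l0 : 0 <= l by lra.
have [_ p1K p2K _] := pK (l ^+ 2 * T x).
rewrite /W'; set E := expR _.
have E0 : 0 <= E by exact: expR_ge0.
have E1 : E <= 1.
  rewrite /E -[leRHS]expR0 ler_expR mulr_le0_ge0 ?mulr_le0_ge0 ?sqn_ge0// subr_le0.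
  by rewrite exprn_ege1.
have ln : l ^+ n <= 2 ^+ n by rewrite lerXn2r// nnegrE.
have ln1 : l ^+ n.-1 <= 2 ^+ n.
  apply: (@le_trans _ _ (2 ^+ n.-1)); first by rewrite lerXn2r// nnegrE.
  by rewrite ler_eXn2l ?leq_pred// ltr1n.
have ln0 : 0 <= l ^+ n by rewrite exprn_ge0.
have ln10 : 0 <= l ^+ n.-1 by rewrite exprn_ge0.
have r0 := sqn_ge0 x.
have T0 : 0 <= T x by exact: dform_ge0.
have TL := dform_le s0 x; rewrite -/smax in TL.
have t1 : `|- p2 (l ^+ 2 * T x) * (2 * l * T x) * l ^+ n * E| <= K * (4 * smax * sqn x) * 2 ^+ n * 1.
  rewrite 3!normrM normrN (ger0_norm E0) (ger0_norm ln0) (@ger0_norm _ (2 * l * T x)); last first.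
    by rewrite !mulr_ge0.
  apply: ler_pM => //; first by rewrite !mulr_ge0.
  apply: ler_pM => //; first by rewrite !mulr_ge0.
  apply: ler_pM => //; first by rewrite !mulr_ge0.
  rewrite (_ : 4 * smax * sqn x = 2 * 2 * (smax * sqn x)); last by ring.
  by apply: ler_pM => //; [exact: mulr_ge0|lra].
have t2 : `|- p1 (l ^+ 2 * T x) * (n%:R * l ^+ n.-1) * E| <= K * (n%:R * 2 ^+ n) * 1.
  rewrite 2!normrM normrN (ger0_norm E0) (@ger0_norm _ (n%:R * _)); last by rewrite mulr_ge0.
  apply: ler_pM => //; first by rewrite !mulr_ge0.
  apply: ler_pM => //; first by rewrite mulr_ge0.
  by rewrite ler_wpM2l.
have t3 : `|- p1 (l ^+ 2 * T x) * l ^+ n * (- l * sqn x * E)| <= K * 2 ^+ n * (2 * sqn x * 1).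
  rewrite 2!normrM normrN (ger0_norm ln0) mulNr mulNr normrN (@ger0_norm _ (l * sqn x * E)); last first.
    by rewrite !mulr_ge0.
  apply: ler_pM => //; [by rewrite mulr_ge0|by rewrite !mulr_ge0|exact: ler_pM|].
  by apply: ler_pM => //; [rewrite mulr_ge0|exact: ler_pM].
apply: le_trans (ler_normD _ _) _.
apply: le_trans (lerD (ler_normD _ _) (lexx _)) _.
apply: le_trans (lerD (lerD t1 t2) t3) _.
have w1 := wexp_ge1 x; have w8 := sqn_le_wexp x.
rewrite (_ : _ + _ = K * 2 ^+ n * (n%:R + 4 * smax * sqn x + 2 * sqn x)); last by ring.
rewrite /CW -!mulrA; apply: ler_wpM2l => //; apply: ler_wpM2l; first by rewrite exprn_ge0.
have h1 : smax * sqn x <= smax * (8 * wexp x) by rewrite ler_wpM2l.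
have h2 : (n%:R : R) <= n%:R * wexp x by rewrite ler_peMr.
by lra.
Qed.

Let W_bnd x l : 1 <= l -> 0 <= W x l <= K * l ^+ n.
Proof.
move=> l1; have l0 : 0 <= l by exact: le_trans l1.
have [_ p1K _ _] := pK (l ^+ 2 * T x).
have p10 : 0 <= - p1 (l ^+ 2 * T x) by rewrite oppr_ge0.
have ln0 : 0 <= l ^+ n by exact: exprn_ge0.
apply/andP; split; first by rewrite /W; apply: mulr_ge0; [exact: mulr_ge0|exact: expR_ge0].
rewrite /W -[leRHS]mulr1; apply: ler_pM; first exact: mulr_ge0.
- exact: expR_ge0.
- by apply: ler_wpM2r => //; rewrite -[leLHS]ger0_norm// normrN.
- rewrite -[leRHS]expR0 ler_expR mulr_le0_ge0// mulr_le0_ge0 ?sqn_ge0// subr_le0.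
  exact: exprn_ege1.
Qed.

Let mW l : measurable_fun setT (fun t : n.-tuple gR => W (row_of t) l).
Proof.
have msq : measurable_fun setT (fun t : n.-tuple gR => sqn (row_of t)).
  by apply: measurable_sqn; exact: mcoord_row_of.
apply: measurable_funM; last first.
  apply: (measurableT_comp (@measurable_expR R)); apply: measurable_funM => //.
  exact: measurable_funM.
apply: measurable_funM => //; apply: measurableT_comp => //.
by apply: (measurableT_comp mp1); exact: measurable_funM.
Qed.

(** The integral of F W_l is that of F (x / l) against - p1 (T x) dgamma, so for l >= 1 it is at
    least its value at l = 1, because F decreases along rays. Dividing the difference by l - 1 and
    letting l tend to 1 differentiates the weight only, whose derivative is - gen. *)
Lemma rint_gen_le0 (F : 'rV[R]_n -> R) (B : R) :
  measurable_fun setT (fun t => F (row_of t)) ->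
  (forall x, 0 <= F x <= B) ->
  (forall x c, 0 <= c <= 1 -> F x <= F (c *: x)) ->
  \int[mu]_t (F (row_of t) * gen (row_of t)) <= 0.
Proof.
move=> mF FB Fray.
have F0 x : 0 <= F x by have /andP[] := FB x.
have B0 : 0 <= B by have /andP[h1 h2] := FB 0; exact: le_trans h2.
have iW l : 1 <= l -> rintegrable mu (fun t => F (row_of t) * W (row_of t) l).
  move=> l1; apply: (@bounded_integrable _ _ _ _ (B * (K * l ^+ n))).
    exact: measurable_funM.
  move=> t; have /andP[F0t FBt] := FB (row_of t); have /andP[W0t WBt] := W_bnd (row_of t) l1.
  by rewrite (ger0_norm (mulr_ge0 F0t W0t)); apply: ler_pM.
(* At most 1, so that 1 + ep m stays in the interval [1, 2] of [W'_le]. *)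
pose ep m : R := (m.+1%:R)^-1.
have ep0 m : 0 < ep m by rewrite invr_gt0.
have ep1 m : ep m <= 1 by rewrite invf_le1// ler1n.
pose D m (x : 'rV[R]_n) := (W x (1 + ep m) - W x 1) / ep m.
have D_le m x : `|D m x| <= CW * wexp x.
  have [l l1 e] := mean_value_ge 1 (ltW (ep0 m)) (dW x).
  rewrite /D e mulfK ?gt_eqF//; apply: W'_le.
  by have /andP[-> l2] := l1; rewrite /= (le_trans l2)// lerD2l.
have Dcvg x : D m x @[m --> \oo] --> - gen x.
  have [dv e] := dW x 1; rewrite -W'1 -e.
  have c : (fun h => h^-1 *: (W x (h *: 1 + 1) - W x 1)) @ 0^' --> 'D_1 (W x) 1 by exact: dv.
  have := (cvgr_dnbhsP _ _ _).1 c ep (conj (fun m => lt0r_neq0 (ep0 m)) cvg_harmonic).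
  rewrite (_ : (fun m => _) = D ^~ x)//.
  by apply/funext => m /=; rewrite /D /GRing.scale/= mulr1 mulrC [_ + 1]addrC.
have scale l : 1 <= l ->
    \int[mu]_t (F (row_of t) * W (row_of t) 1) <= \int[mu]_t (F (row_of t) * W (row_of t) l).
  move=> l1; have l0 : 0 < l by exact: lt_le_trans l1.
  have c0 : 0 < l^-1 by rewrite invr_gt0.
  pose G (y : 'rV[R]_n) := (F y * - p1 (l ^+ 2 * T y))%:E.
  have mG : mrv G.
    apply/measurable_EFinP; apply: measurable_funM => //; apply: measurableT_comp => //.
    by apply: (measurableT_comp mp1); exact: measurable_funM.
  have G0 x : (0 <= G x)%E by rewrite lee_fin mulr_ge0// oppr_ge0.
  have e := gprob_scale c0 mG G0.
  have e2 : (\int[mu]_t (G (row_of t) * (l^-1 ^- n * expR ((1 - l^-1 ^- 2) * sqn (row_of t) / 2))%:E))%E =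
     (\int[mu]_t (F (row_of t) * W (row_of t) l)%:E)%E.
    apply: eq_integral => t _; rewrite /G -EFinM; congr EFin.
    by rewrite /W !exprVn !invrK; ring.
  have le1 : (\int[mu]_t (F (row_of t) * W (row_of t) 1)%:E <= \int[mu]_t (F (row_of t) * W (row_of t) l)%:E)%E.
    rewrite -e2 -e; apply: ge0_le_integral.
    - exact: measurableT.
    - by move=> t _; rewrite lee_fin; have /andP[W0t _] := W_bnd (row_of t) (lexx 1); exact: (mulr_ge0 (F0 _) W0t).
    - by apply/measurable_EFinP; apply: measurable_funM.
    - by apply: (mrv_comp mG); apply: mcoordZ; exact: mcoord_row_of.
    - move=> t _; have eT : l ^+ 2 * T (l^-1 *: row_of t) = T (row_of t).
        by clear e e2; rewrite dformZ mulrA -exprMn divff ?gt_eqF// expr1n mul1r.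
      rewrite /G eT lee_fin W1.
      apply: ler_wpM2r; first by rewrite oppr_ge0.
      by apply: Fray; rewrite (ltW c0)/= invf_le1.
  have fin l' : 1 <= l' -> ((\int[mu]_t (F (row_of t) * W (row_of t) l')%:E) \is a fin_num)%E.
    by move=> l'1; exact: (integrable_fin_num measurableT (iW l' l'1)).
  by apply: fine_le; [exact: fin|exact: fin|].
have D0 m : 0 <= \int[mu]_t (F (row_of t) * D m (row_of t)).
  rewrite (_ : \int[mu]_t _ = \int[mu]_t ((ep m)^-1 *
     (F (row_of t) * W (row_of t) (1 + ep m) + -1 * (F (row_of t) * W (row_of t) 1)))); last first.
    by apply: eq_Rintegral => t _; rewrite /D; ring.
  have l1 : 1 <= 1 + ep m by have := ep0 m; lra.
  have i1 := rintegrableZ (-1) (iW _ (lexx 1)).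
  rewrite rintZ; last exact: rintegrableD (iW _ l1) i1.
  apply: mulr_ge0; first by rewrite invr_ge0; exact: ltW.
  rewrite rintD//; last exact: iW.
  rewrite rintZ; last exact: iW.
  by rewrite mulN1r subr_ge0; exact: scale.
have [ig c] := @rint_dct _ _ _ mu (fun m t => F (row_of t) * D m (row_of t))
  (fun t => F (row_of t) * - gen (row_of t)) (fun t => (B * CW) * wexp (row_of t))
  (fun m => measurable_funM mF (measurable_funM (measurable_funB (mW _) (mW _)) (measurable_cst _)))
  (fun t => cvgMl_tmp (Dcvg (row_of t)))
  (fun m t => ltac:(by rewrite normrM -mulrA ger0_norm//; apply: ler_pM => //; have /andP[] := FB (row_of t)))
  (rintegrableZ _ (rintegrable_wexp n)).
have : 0 <= \int[mu]_t (F (row_of t) * - gen (row_of t)).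
  by rewrite -(cvg_lim _ c)//; apply: limr_ge; [by apply/cvg_ex; eexists; exact: c|exact: nearW].
rewrite (_ : \int[mu]_t (F (row_of t) * gen (row_of t)) =
  - \int[mu]_t (F (row_of t) * - gen (row_of t))) ?oppr_le0//.
rewrite -mulN1r -rintZ//; apply: eq_Rintegral => t _; ring.
Qed.

End monotone.

(** * Iteration of the chain *)

Section semigroup.
Context {R : realType}.
Variables (n : nat) (f : 'rV[R]_n -> R).
Hypotheses (cf : continuous f) (f0 : forall x, 0 <= f x) (lcf : log_concave f).
Hypothesis sf : forall x, f (- x) = f x.
Local Notation gR := (measurableTypeR R).
Local Notation mu := (@gprob R n).

Let f_bnd x : 0 <= f x <= f 0.
Proof. by rewrite f0 log_concave_symm_le. Qed.

Let mf d (U : measurableType d) (phi : U -> 'rV[R]_n) :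
  mcoord phi -> measurable_fun setT (fun t => f (phi t)).
Proof. by move=> mphi; apply/measurable_EFinP; exact: (mrv_comp (continuous_mrv cf) mphi). Qed.

Lemma integral_cst_gprob (r : \bar R) : (\int[mu]_z r = r)%E.
Proof.
rewrite (_ : (fun=> r) = cst r)// integral_cst; last exact: measurableT.
by transitivity (r * 1)%E; [congr (_ * _)%E; exact: probability_setT|exact: mule1].
Qed.

Lemma mrv_integral (h : 'rV[R]_n -> 'rV[R]_n -> \bar R) : mrv2 h ->
  (forall x z, 0 <= h x z)%E -> mrv (fun x => (\int[mu]_z h x (row_of z))%E).
Proof.
move=> mh h0.
exact: (@measurable_fun_fubini_tonelli_F _ _ _ _ R mu
  (fun q : n.-tuple gR * n.-tuple gR => h (row_of q.1) (row_of q.2)) mh (fun q => h0 _ _)).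
Qed.

Let mcoord_fst : mcoord (fun q : n.-tuple gR * n.-tuple gR => row_of q.1).
Proof. by apply: mcoord_row_of; exact: measurable_fst. Qed.

Let mcoord_snd : mcoord (fun q : n.-tuple gR * n.-tuple gR => row_of q.2).
Proof. by apply: mcoord_row_of; exact: measurable_snd. Qed.

Let mcoord_mix2 a b :
  mcoord (fun q : n.-tuple gR * n.-tuple gR => mix a b (row_of q.1) (row_of q.2)).
Proof. exact: mcoord_mix. Qed.

(* The Mehler operator with coordinatewise contraction A and noise level B. *)
Definition avg (g : 'rV[R]_n -> R) (A B x : 'rV[R]_n) : R :=
  \int[mu]_z g (mix A B x (row_of z)).

Section avg.
Variables (g : 'rV[R]_n -> R) (M : R).
Hypothesis mg : mrv (EFin \o g).
Hypothesis g_bnd : forall x, 0 <= g x <= M.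

Let mg' d (U : measurableType d) (phi : U -> 'rV[R]_n) :
  mcoord phi -> measurable_fun setT (fun t => g (phi t)).
Proof. by move=> mphi; apply/measurable_EFinP; exact: (mrv_comp mg mphi). Qed.

Let mgmix A B x : measurable_fun setT (fun z : n.-tuple gR => g (mix A B x (row_of z))).
Proof. by apply: mg'; apply: mcoord_mix; [exact: mcoord_cst|exact: mcoord_row_of]. Qed.

Lemma EFin_avg A B x : (avg g A B x)%:E = (\int[mu]_z (g (mix A B x (row_of z)))%:E)%E.
Proof. exact: (@bounded_EFin_Rintegral _ _ _ _ M). Qed.

Lemma avg_bnd A B x : 0 <= avg g A B x <= M.
Proof. exact: bounded_Rintegral. Qed.

Lemma mrv_avg A B : mrv (EFin \o avg g A B).
Proof.
rewrite (_ : EFin \o _ = fun x => (\int[mu]_z (g (mix A B x (row_of z)))%:E)%E); last first.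
  by apply/funext => x; exact: EFin_avg.
apply: (@mrv_integral (fun x z => (g (mix A B x z))%:E)).
  by apply/measurable_EFinP; exact: mg'.
by move=> x z; rewrite lee_fin; have /andP[] := g_bnd (mix A B x z).
Qed.

End avg.

Lemma avg10 g x : avg g (const_mx 1) 0 x = g x.
Proof.
rewrite /avg (_ : (fun z => _) = fun=> g x) ?rint_cst//.
by apply/funext => z; congr g; apply/rowP => i; rewrite !mxE; ring.
Qed.

(** The independent noises A b z and B w add up to one of standard deviation B'. A dummy variable w
    is added on the left, and the reflection with coefficients A b / B' and B / B' splits the single
    noise into the two. *)
Lemma avg_comp (A B a b A' B' x : 'rV[R]_n) :
  (forall i, B ord0 i != 0) -> (forall i, B' ord0 i != 0) ->
  (forall i, A' ord0 i = A ord0 i * a ord0 i) ->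
  (forall i, (A ord0 i * b ord0 i) ^+ 2 + B ord0 i ^+ 2 = B' ord0 i ^+ 2) ->
  avg f A' B' x = avg (avg f A B) a b x.
Proof.
move=> B0 B'0 eA eB; apply: EFin_inj.
rewrite (EFin_avg (continuous_mrv cf) f_bnd).
rewrite (EFin_avg (mrv_avg (continuous_mrv cf) f_bnd A B) (avg_bnd (continuous_mrv cf) f_bnd A B)).
pose P : 'rV[R]_n := \row_i (A ord0 i * b ord0 i / B' ord0 i).
pose Q : 'rV[R]_n := \row_i (B ord0 i / B' ord0 i).
have E := @gprob_reflection R n P Q (fun z _ => (f (mix A' B' x z))%:E).
transitivity (\int[mu]_z \int[mu]_w (f (mix A' B' x (row_of z)))%:E)%E.
  by apply: eq_integral => z _; rewrite integral_cst_gprob.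
rewrite E.
- apply: eq_integral => z _; rewrite (EFin_avg (continuous_mrv cf) f_bnd).
  apply: eq_integral => w _; congr (f _)%:E; apply/rowP => i; rewrite !mxE eA.
  by field; exact: B'0.
- by move=> i; clear E; rewrite mxE mulf_neq0// invr_neq0.
- by move=> i; clear E; rewrite !mxE !exprMn -!mulrDl -exprMn eB exprVn divff// expf_neq0.
- by apply/measurable_EFinP; apply: mf; apply: mcoord_mix => //; exact: mcoord_cst.
- by move=> *; rewrite lee_fin.
Qed.

(** Reversibility: the reflection exchanges x and [mix a b x z], being its own inverse. *)
Lemma avg_dual (F g : 'rV[R]_n -> R) (M N : R) (a b : 'rV[R]_n) :
  mrv (EFin \o F) -> mrv (EFin \o g) ->
  (forall x, 0 <= F x <= M) -> (forall x, 0 <= g x <= N) ->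
  (forall i, b ord0 i != 0) -> (forall i, a ord0 i ^+ 2 + b ord0 i ^+ 2 = 1) ->
  \int[mu]_x (g (row_of x) * avg F a b (row_of x)) =
  \int[mu]_x (F (row_of x) * avg g a b (row_of x)).
Proof.
move=> mF mg FM gN b0 ab.
have key G H (L L' : R) : mrv (EFin \o G) -> mrv (EFin \o H) ->
    (forall x, 0 <= G x <= L) -> (forall x, 0 <= H x <= L') ->
    (\int[mu]_x (G (row_of x) * avg H a b (row_of x)))%:E =
    (\int[mu]_x \int[mu]_z (G (row_of x) * H (mix a b (row_of x) (row_of z)))%:E)%E.
  move=> mG mH GL HL.
  have G0 x : 0 <= G x by have /andP[] := GL x.
  have H0 x : 0 <= H x by have /andP[] := HL x.
  rewrite (@bounded_EFin_Rintegral _ _ _ _ (L * L')).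
  - apply: eq_integral => x _; rewrite EFinM (EFin_avg mH HL) -ge0_integralZl//.
    + by apply: (mrv_comp mH); apply: mcoord_mix; [exact: mcoord_cst|exact: mcoord_row_of].
    + by move=> z _; rewrite lee_fin.
    + by rewrite lee_fin.
  - apply: measurable_funM; first exact/measurable_EFinP.
    by apply/measurable_EFinP; exact: (mrv_avg mH HL a b).
  - move=> x; have /andP[h1 h2] := GL (row_of x); have /andP[h3 h4] := avg_bnd mH HL a b (row_of x).
    by rewrite mulr_ge0//=; exact: ler_pM.
have F0 x : 0 <= F x by have /andP[] := FM x.
have g0 x : 0 <= g x by have /andP[] := gN x.
apply: EFin_inj; rewrite (key g F _ _ mg mF gN FM) (key F g _ _ mF mg FM gN).
rewrite (@gprob_reflection R n a b (fun x z => (g x * F (mix a b x z))%:E))//.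
- apply: eq_integral => x _; apply: eq_integral => z _; rewrite mulrC; congr (F _ * _)%:E.
  apply/rowP => i; rewrite !mxE -[RHS]mul1r -(ab i); ring.
- apply/measurable_EFinP; apply: measurable_funM; apply/measurable_EFinP.
    exact: (mrv_comp mg).
  exact: (mrv_comp mF).
- by move=> x z; rewrite lee_fin mulr_ge0.
Qed.

End semigroup.

(** * The correlation inequality for a diagonal form *)

Section diagonal.
Context {R : realType}.
Variables (n : nat) (f : 'rV[R]_n -> R) (s : 'rV[R]_n).
Hypotheses (cf : continuous f) (f0 : forall x, 0 <= f x) (lcf : log_concave f).
Hypothesis sf : forall x, f (- x) = f x.
Hypothesis s0 : forall i, 0 < s ord0 i.
Local Notation gR := (measurableTypeR R).
Local Notation mu := (@gprob R n).
Local Notation T := (dform s).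

Let f_bnd x : 0 <= f x <= f 0.
Proof. by rewrite f0 log_concave_symm_le. Qed.

Let mrvf : mrv (EFin \o f) := continuous_mrv cf.

Let mT : measurable_fun setT (fun t : n.-tuple gR => T (row_of t)).
Proof. by apply: measurable_dform; exact: mcoord_row_of. Qed.

Section smooth.
Variables (K M : R) (p p1 p2 p3 : R -> R).
Hypothesis dp : forall t : R, is_derive t (1 : R) p (p1 t).
Hypothesis dp1 : forall t : R, is_derive t (1 : R) p1 (p2 t).
Hypothesis dp2 : forall t : R, is_derive t (1 : R) p2 (p3 t).
Hypothesis pK : forall t, [/\ p1 t <= 0, `|p1 t| <= K, `|p2 t| <= K & `|p3 t| <= K].
Hypothesis pM : forall t, 0 <= p t <= M.

Let K0 : 0 <= K. Proof. by have [_ h _ _] := pK 0; exact: le_trans h. Qed.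
Let mp : measurable_fun setT p := measurable_of_is_derive dp.
Let mpT : mrv (EFin \o (p \o T)).
Proof. by apply/measurable_EFinP; exact: (measurableT_comp mp). Qed.

Let smax : R := \sum_i s ord0 i.
Let Kgen : R := K * (n%:R + 8 + 16 * smax).

Let gen_le x : `|gen s p1 p2 x| <= Kgen * wexp x.
Proof.
have [_ p1K p2K _] := pK (T x).
have r0 := sqn_ge0 x; have T0 : 0 <= T x by exact: dform_ge0.
have TL := dform_le s0 x; rewrite -/smax in TL.
have smax0 : 0 <= smax by apply: sumr_ge0 => i _; exact: ltW.
have w1 := wexp_ge1 x; have w8 := sqn_le_wexp x.
have t1 : `|p1 (T x) * (n%:R - sqn x)| <= K * (n%:R + sqn x).
  rewrite normrM; apply: ler_pM => //.
  by apply: le_trans (ler_normB _ _) _; rewrite !ger0_norm.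
have t2 : `|2 * T x * p2 (T x)| <= 2 * (smax * sqn x) * K.
  rewrite normrM; apply: ler_pM => //.
  by rewrite ger0_norm ?mulr_ge0// ler_pM2l.
apply: le_trans (ler_normD _ _) _; apply: le_trans (lerD t1 t2) _.
rewrite (_ : _ + _ = K * (n%:R + sqn x + 2 * (smax * sqn x))); last by ring.
rewrite /Kgen -mulrA; apply: ler_wpM2l => //.
have h1 : smax * sqn x <= smax * (8 * wexp x) by rewrite ler_wpM2l.
have h2 : (n%:R : R) <= n%:R * wexp x by rewrite ler_peMr.
by lra.
Qed.

Let mgen : measurable_fun setT (fun t : n.-tuple gR => gen s p1 p2 (row_of t)).
Proof.
have mp1 := measurable_of_is_derive dp1; have mp2 := measurable_of_is_derive dp2.
apply: measurable_funD; apply: measurable_funM.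
- exact: (measurableT_comp mp1).
- by apply: measurable_funB => //; exact: measurable_sqn_row.
- exact: measurable_funM.
- exact: (measurableT_comp mp2).
Qed.

(** Interpolates between the joint mean (A = 1, B = 0) and the product of the means (A = 0, B =
    1). *)
Definition coupled (A B : 'rV[R]_n) : R :=
  \int[mu]_x (avg f A B (row_of x) * p (T (row_of x))).

(** Reversibility lets the new step act on p (T x), where [one_step_bound] applies. The term in
    del^2 is an integral of [avg f A B] against [gen], nonpositive because that average decreases
    along rays; the remainder is a multiple of the integrable [wexp]. *)
Lemma coupled_step : exists2 C, 0 <= C &
  forall (del : R) (A B a b A' B' : 'rV[R]_n), 0 < del <= 1 ->
  (forall i, 0 <= a ord0 i) -> (forall i, 0 < b ord0 i) ->
  (forall i, a ord0 i ^+ 2 + b ord0 i ^+ 2 = 1) ->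
  (forall i, s ord0 i * b ord0 i ^+ 2 = 2 * del ^+ 2) ->
  (forall x, avg f A' B' x = avg (avg f A B) a b x) ->
  coupled A' B' <= coupled A B + C * del ^+ 3.
Proof.
have [C C0 HC] := one_step_bound s0 dp dp1 dp2 pK.
pose Z := \int[mu]_t wexp (row_of t).
have Z0 : 0 <= Z by apply: Rintegral_ge0 => t _; exact: ltW (wexp_gt0 _).
exists (f 0 * (C * Z)); first by apply: mulr_ge0; [exact: f0|exact: mulr_ge0].
move=> del A B a b A' B' d01 a0 b0 ab sb e.
pose F := avg f A B.
have mF : mrv (EFin \o F) by exact: mrv_avg mrvf f_bnd A B.
have F_bnd : forall x, 0 <= F x <= f 0 by exact: avg_bnd mrvf f_bnd A B.
have F0 x : 0 <= F x by have /andP[] := F_bnd x.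
have FB x : F x <= f 0 by have /andP[] := F_bnd x.
have mF' : measurable_fun setT (fun t => F (row_of t)) by exact/measurable_EFinP.
have d0 : 0 <= del by have /andP[/ltW] := d01.
have -> : coupled A' B' = \int[mu]_x (F (row_of x) * avg (p \o T) a b (row_of x)).
  rewrite -(avg_dual mF mpT F_bnd (fun x => pM (T x)))//; last by move=> i; rewrite gt_eqF.
  by apply: eq_Rintegral => x _; rewrite e mulrC.
have I1 : rintegrable mu (fun t => F (row_of t) * p (T (row_of t))).
  apply: (@bounded_integrable _ _ _ _ (f 0 * M)).
    by apply: measurable_funM => //; exact: (measurableT_comp mp).
  move=> t; have /andP[h1 h2] := pM (T (row_of t)).
  by rewrite (ger0_norm (mulr_ge0 (F0 _) h1)); exact: ler_pM.
have I2 : rintegrable mu (fun t => F (row_of t) * gen s p1 p2 (row_of t)).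
  apply: (@rintegrable_le _ _ _ _ _ (fun t => (f 0 * Kgen) * wexp (row_of t))).
  - exact: measurable_funM.
  - by move=> t; rewrite normrM (ger0_norm (F0 _)) -[leRHS]mulrA; apply: ler_pM.
  - by apply: rintegrableZ; exact: rintegrable_wexp.
have I3 : rintegrable mu (fun t => F (row_of t) * wexp (row_of t)).
  apply: (@rintegrable_le _ _ _ _ _ (fun t => f 0 * wexp (row_of t))).
  - by apply: measurable_funM => //; exact: measurable_wexp.
  - move=> t; rewrite (ger0_norm (mulr_ge0 (F0 _) (ltW (wexp_gt0 _)))).
    by apply: ler_wpM2r => //; exact: ltW (wexp_gt0 _).
  - by apply: rintegrableZ; exact: rintegrable_wexp.
have J2 := rintegrableZ (2 * del ^+ 2) I2.
have J3 := rintegrableZ (C * del ^+ 3) I3.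
apply: (@le_trans _ _ (\int[mu]_t (F (row_of t) * p (T (row_of t)) +
  (2 * del ^+ 2 * (F (row_of t) * gen s p1 p2 (row_of t)) +
   C * del ^+ 3 * (F (row_of t) * wexp (row_of t)))))).
  apply: rint_le.
  - apply: (@bounded_integrable _ _ _ _ (f 0 * M)).
      apply: measurable_funM => //; apply/measurable_EFinP.
      exact: (mrv_avg mpT (fun x => pM (T x)) a b).
    move=> t; have /andP[h1 h2] := avg_bnd mpT (fun x => pM (T x)) a b (row_of t).
    by rewrite (ger0_norm (mulr_ge0 (F0 _) h1)); exact: ler_pM.
  - by apply: rintegrableD => //; exact: rintegrableD.
  - move=> t; have h := HC del a b (row_of t) M d01 a0 (fun i => ltW (b0 i)) ab sb pM.
    have := ler_wpM2l (F0 (row_of t)) h; rewrite !mulrDr /avg /=.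
    move=> h'; apply: le_trans h' _; rewrite le_eqVlt; apply/orP; left; apply/eqP; ring.
rewrite rintD//; last exact: rintegrableD.
rewrite lerD2l rintD// (rintZ _ I2) (rintZ _ I3).
have g0 : \int[mu]_t (F (row_of t) * gen s p1 p2 (row_of t)) <= 0.
  apply: (rint_gen_le0 s0 dp1 pK mF' F_bnd) => x c c01; exact: mix_ray_le.
have w0 : \int[mu]_t (F (row_of t) * wexp (row_of t)) <= f 0 * Z.
  rewrite -rintZ; last exact: rintegrable_wexp.
  apply: rint_le => //; first by apply: rintegrableZ; exact: rintegrable_wexp.
  by move=> t; apply: ler_wpM2r => //; exact: ltW (wexp_gt0 _).
have h1 : 2 * del ^+ 2 * (\int[mu]_t (F (row_of t) * gen s p1 p2 (row_of t))) <= 0.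
  by rewrite mulr_ge0_le0// mulr_ge0// exprn_ge0.
have h2 : C * del ^+ 3 * (\int[mu]_t (F (row_of t) * wexp (row_of t))) <= C * del ^+ 3 * (f 0 * Z).
  by rewrite ler_wpM2l// mulr_ge0// exprn_ge0.
apply: le_trans (lerD h1 h2) _; rewrite add0r le_eqVlt; apply/orP; left; apply/eqP; ring.
Qed.

(* Parameters after k steps, e i being the variance of the noise added to the
   i-th coordinate at each step. *)
Let Ak (e : 'rV[R]_n) k : 'rV[R]_n := \row_i Num.sqrt ((1 - e ord0 i) ^+ k).
Let Bk (e : 'rV[R]_n) k : 'rV[R]_n := \row_i Num.sqrt (1 - (1 - e ord0 i) ^+ k).

Lemma coupled_iter : exists2 C, 0 <= C &
  forall (del : R) (e : 'rV[R]_n) k, 0 < del <= 1 -> (forall i, 0 < e ord0 i < 1) ->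
  (forall i, s ord0 i * e ord0 i = 2 * del ^+ 2) ->
  coupled (Ak e k) (Bk e k) <=
    \int[mu]_x (f (row_of x) * p (T (row_of x))) + k%:R * (C * del ^+ 3).
Proof.
have [C C0 HC] := coupled_step; exists C => // del e k d01 e01 se.
have A0 : Ak e 0 = const_mx 1 by apply/rowP => i; rewrite !mxE expr0 sqrtr1.
have B0 : Bk e 0 = 0 by apply/rowP => i; rewrite !mxE expr0 subrr sqrtr0.
have e0 i : 0 < e ord0 i by have /andP[] := e01 i.
have c0 i : 0 < 1 - e ord0 i by have /andP[_] := e01 i; rewrite subr_gt0.
have c1 i : 1 - e ord0 i < 1 by rewrite ltrBlDr ltrDl.
pose a : 'rV[R]_n := \row_i Num.sqrt (1 - e ord0 i).
pose b : 'rV[R]_n := \row_i Num.sqrt (e ord0 i).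
have a2 i : a ord0 i ^+ 2 = 1 - e ord0 i by rewrite mxE sqr_sqrtr// ltW.
have b2 i : b ord0 i ^+ 2 = e ord0 i by rewrite mxE sqr_sqrtr// ltW.
have Ak2 j i : Ak e j ord0 i ^+ 2 = (1 - e ord0 i) ^+ j.
  by rewrite mxE sqr_sqrtr// exprn_ge0// ltW.
have q1 j i : (1 - e ord0 i) ^+ j <= 1 by rewrite exprn_ile1 ?ltW.
have Bk2 j i : Bk e j ord0 i ^+ 2 = 1 - (1 - e ord0 i) ^+ j.
  by rewrite mxE sqr_sqrtr// subr_ge0.
have Bk0 j i : Bk e j.+1 ord0 i != 0.
  rewrite -sqrf_eq0 Bk2 subr_eq0 eq_sym lt_eqF// exprS.
  by apply: le_lt_trans (c1 i); rewrite ler_piMr// ltW.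
elim: k => [|k IH].
  rewrite A0 B0 mul0r addr0 /coupled; under eq_Rintegral do rewrite avg10.
  by [].
have step : coupled (Ak e k.+1) (Bk e k.+1) <= coupled (Ak e k) (Bk e k) + C * del ^+ 3.
  apply: (HC del _ _ a b) => //.
  - by move=> i; rewrite mxE sqrtr_ge0.
  - by move=> i; rewrite mxE sqrtr_gt0.
  - by move=> i; rewrite a2 b2 subrK.
  - by move=> i; rewrite b2.
  (* The first step is apart: [Bk e 0] vanishes, whereas [avg_comp] wants nonzero noise levels. *)
  - case: k {IH} => [|k] x.
      rewrite A0 B0 (_ : avg f (const_mx 1) 0 = f); last by apply/funext => y; exact: avg10.
      rewrite /Ak /Bk /avg; apply: eq_Rintegral => z _; congr f; apply/rowP => i.
      by rewrite !mxE !expr1 subKr.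
    apply: avg_comp => // i.
      by rewrite !mxE [in LHS]exprSr sqrtrM// exprn_ge0// ltW.
    rewrite exprMn Ak2 b2 !Bk2 [in RHS]exprSr; ring.
apply: le_trans step _; rewrite -natr1 mulrDl mul1r addrA lerD2r; exact: IH.
Qed.

(** As A tends to 0 and B to 1, [mix A B x z] tends to z, so the average forgets x; dominated
    convergence is used once in z and once in x. *)
Lemma coupled_cvg (e : nat -> 'rV[R]_n) (k : nat -> nat) :
  (forall m i, 0 <= (1 - e m ord0 i) ^+ k m) ->
  (forall i, (1 - e m ord0 i) ^+ k m @[m --> \oo] --> 0) ->
  coupled (Ak (e m) (k m)) (Bk (e m) (k m)) @[m --> \oo] -->
    (\int[mu]_x f (row_of x)) * (\int[mu]_x p (T (row_of x))).
Proof.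
move=> q0 qc.
have sq (u : nat -> R) l : u m @[m --> \oo] --> l -> Num.sqrt (u m) @[m --> \oo] --> Num.sqrt l.
  by move=> ul; apply: continuous_cvg => //; exact: sqrt_continuous.
have Ac i : Ak (e m) (k m) ord0 i @[m --> \oo] --> 0.
  have := sq _ _ (qc i); rewrite sqrtr0.
  by rewrite (_ : (fun m => Num.sqrt _) = (fun m => Ak (e m) (k m) ord0 i))//; apply/funext => m; rewrite mxE.
have Bc i : Bk (e m) (k m) ord0 i @[m --> \oo] --> (1 : R).
  have h : 1 - (1 - e m ord0 i) ^+ k m @[m --> \oo] --> (1 - 0 : R).
    by apply: cvgB; [exact: cvg_cst|exact: qc].
  have := sq _ _ h; rewrite subr0 sqrtr1.
  by rewrite (_ : (fun m => Num.sqrt _) = (fun m => Bk (e m) (k m) ord0 i))//; apply/funext => m; rewrite mxE.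
have mixc x z : mix (Ak (e m) (k m)) (Bk (e m) (k m)) x z @[m --> \oo] --> z.
  apply/cvg_ballP => r r0.
  suff H : \forall m \near \oo, forall (i : 'I_1) (j : 'I_n),
      ball (z i j) r (mix (Ak (e m) (k m)) (Bk (e m) (k m)) x z i j).
    by apply: filterS H => m Hm; split.
  apply: filter_forall => i; apply: filter_forall => j.
  rewrite (ord1 i).
  have : mix (Ak (e m) (k m)) (Bk (e m) (k m)) x z ord0 j @[m --> \oo] --> z ord0 j.
    have h : Ak (e m) (k m) ord0 j * x ord0 j + Bk (e m) (k m) ord0 j * z ord0 j @[m --> \oo] -->
        0 * x ord0 j + 1 * z ord0 j.
      by apply: cvgD; apply: cvgMr_tmp; [exact: Ac|exact: Bc].
    move: h; rewrite mul0r add0r mul1r => h.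
    rewrite (_ : (fun m => _) = (fun m => Ak (e m) (k m) ord0 j * x ord0 j +
      Bk (e m) (k m) ord0 j * z ord0 j))//.
    by apply/funext => m; rewrite [LHS]mxE.
  by move=> /cvg_ballP; exact.
pose Av m x := avg f (Ak (e m) (k m)) (Bk (e m) (k m)) x.
pose If := \int[mu]_x f (row_of x).
have avgc x : Av m x @[m --> \oo] --> If.
  have mfm m : measurable_fun setT (fun z => f (mix (Ak (e m) (k m)) (Bk (e m) (k m)) x (row_of z))).
    apply/measurable_EFinP; apply: (mrv_comp mrvf).
    by apply: mcoord_mix; [exact: mcoord_cst|exact: mcoord_row_of].
  have fle m (z : n.-tuple gR) : `|f (mix (Ak (e m) (k m)) (Bk (e m) (k m)) x (row_of z))| <= f 0.
    by rewrite ger0_norm//; have /andP[] := f_bnd (mix (Ak (e m) (k m)) (Bk (e m) (k m)) x (row_of z)).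
  have fcv (z : n.-tuple gR) :
      f (mix (Ak (e m) (k m)) (Bk (e m) (k m)) x (row_of z)) @[m --> \oo] --> f (row_of z).
    by apply: continuous_cvg; [exact: cf|exact: mixc].
  have [_ c] := @rint_dct _ _ _ mu (fun m z => f (mix (Ak (e m) (k m)) (Bk (e m) (k m)) x (row_of z)))
    (fun z => f (row_of z)) (fun=> f 0)
    mfm
    fcv
    fle
    (rintegrable_cst mu (f 0)).
  exact: c.
have Avb m x : 0 <= Av m x <= f 0 by exact: avg_bnd mrvf f_bnd _ _ x.
have [_ c] := @rint_dct _ _ _ mu (fun m x => Av m (row_of x) * p (T (row_of x)))
  (fun x => If * p (T (row_of x))) (fun=> f 0 * M)
  (fun m => measurable_funM ((measurable_EFinP _ _).1 (mrv_avg mrvf f_bnd _ _)) (measurableT_comp mp mT))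
  (fun x => cvgMr_tmp (avgc (row_of x)))
  (fun m x => ltac:(have /andP[h1 h2] := Avb m (row_of x); have /andP[h3 h4] := pM (T (row_of x));
      by rewrite (ger0_norm (mulr_ge0 h1 h3)); apply: ler_pM))
  (rintegrable_cst mu _).
rewrite -rintZ; first exact: c.
apply: (@bounded_integrable _ _ _ _ M); first exact: measurableT_comp mp mT.
by move=> x; have /andP[h1 h2] := pM (T (row_of x)); rewrite ger0_norm.
Qed.

Lemma correlation_smooth :
  (\int[mu]_x f (row_of x)) * (\int[mu]_x p (T (row_of x))) <=
  \int[mu]_x (f (row_of x) * p (T (row_of x))).
Proof.
have [C C0 HC] := coupled_iter.
(* Small enough for d0 <= 1 and 2 d0 / s_i < 1, hence for noise variances 2 del^2 / s_i below 1. *)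
pose d0 : R := (1 + \sum_i 2 / s ord0 i)^-1.
have S0 : 0 <= \sum_i 2 / s ord0 i by apply: sumr_ge0 => i _; rewrite divr_ge0// ltW.
have Si i : 2 / s ord0 i <= \sum_i 2 / s ord0 i.
  by rewrite (bigD1 i)//= lerDl sumr_ge0// => j _; rewrite divr_ge0// ltW.
have d00 : 0 < d0 by rewrite invr_gt0; lra.
have d01 : d0 <= 1 by rewrite invf_le1; lra.
have d0s i : d0 * (2 / s ord0 i) < 1.
  by rewrite mulrC ltr_pdivrMr ?mul1r; have := Si i; lra.
(* With k = (m + 1)^5 steps, the total time k del^2 = d0^2 (m + 1) tends to infinity while the total
   error is of order k del^3 = d0^3 / (m + 1). *)
pose del m : R := d0 / m.+1%:R ^+ 2.
pose e m : 'rV[R]_n := \row_i (2 * del m ^+ 2 / s ord0 i).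
have m0 m : 0 < m.+1%:R :> R by rewrite ltr0n.
have m1 m : 1 <= m.+1%:R :> R by rewrite ler1n.
have del0 m : 0 < del m by rewrite divr_gt0// exprn_gt0.
have deld m : del m <= d0 by rewrite ler_pdivrMr ?exprn_gt0// ler_peMr ?(ltW d00)// exprn_ege1.
have e01 m i : 0 < e m ord0 i < 1.
  rewrite mxE; apply/andP; split; first by rewrite divr_gt0// mulr_gt0// exprn_gt0.
  apply: le_lt_trans (d0s i); rewrite mulrAC mulrC; apply: ler_wpM2r.
    by rewrite divr_ge0// ltW.
  apply: le_trans (deld m); rewrite expr2 ler_piMr ?(ltW (del0 m))//.
  exact: le_trans d01.
have se m i : s ord0 i * e m ord0 i = 2 * del m ^+ 2 by rewrite mxE mulrC divfK// gt_eqF.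
pose k m := (m.+1 ^ 5)%N.
have q0 m i : 0 <= (1 - e m ord0 i) ^+ k m.
  by rewrite exprn_ge0// subr_ge0; have /andP[_ /ltW] := e01 m i.
pose c i : R := 2 * d0 ^+ 2 / s ord0 i.
have c0 i : 0 < c i by rewrite divr_gt0// mulr_gt0// exprn_gt0.
have ke m i : (k m)%:R * e m ord0 i = m.+1%:R * c i.
  rewrite mxE /k natrX /del /c; field.
  by rewrite gt_eqF// addrC natr1 pnatr_eq0.
have qle m i : (1 - e m ord0 i) ^+ k m <= (c i)^-1 * m.+1%:R^-1.
  have /andP[e0 e1] := e01 m i.
  (* Bernoulli's inequality and (1 - e)(1 + e) <= 1 give (1 - e)^k <= 1 / (k e). *)
  have bern : 1 + (k m)%:R * e m ord0 i <= (1 + e m ord0 i) ^+ k m.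
    elim: (k m) => [|j IH]; first by rewrite mul0r addr0 expr0.
    rewrite exprS; apply: (@le_trans _ _ ((1 + e m ord0 i) * (1 + j%:R * e m ord0 i))).
      rewrite -natr1; have : 0 <= j%:R * e m ord0 i ^+ 2 by rewrite mulr_ge0// exprn_ge0// ltW.
      by lra.
    by rewrite ler_wpM2l//; lra.
  have pr : (1 - e m ord0 i) ^+ k m * (1 + e m ord0 i) ^+ k m <= 1.
    rewrite -exprMn exprn_ile1//; first by rewrite mulr_ge0//; lra.
    by nra.
  rewrite [leRHS](_ : _ = 1 / (m.+1%:R * c i)); last by rewrite mul1r -invfM [in LHS]mulrC.
  rewrite ler_pdivlMr; last exact: mulr_gt0.
  rewrite -(ke m i).
  apply: le_trans pr; apply: ler_wpM2l; [exact: q0|lra].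
have qc i : (1 - e m ord0 i) ^+ k m @[m --> \oo] --> 0.
  apply: (@squeeze_cvgr _ _ _ _ (fun=> 0) (fun m => (c i)^-1 * m.+1%:R^-1)).
  - by apply: nearW => m; rewrite q0 qle.
  - exact: cvg_cst.
  - by rewrite -(mulr0 (c i)^-1); apply: cvgMl_tmp; exact: cvg_harmonic.
have lim := coupled_cvg q0 qc.
set L := \int[mu]_x (f _ * _).
have rhs : L + (C * d0 ^+ 3) * m.+1%:R^-1 @[m --> \oo] --> L.
  have : L + (C * d0 ^+ 3) * m.+1%:R^-1 @[m --> \oo] --> L + C * d0 ^+ 3 * 0; last by rewrite mulr0 addr0.
  by apply: cvgD; [exact: cvg_cst|apply: cvgMl_tmp; exact: cvg_harmonic].
apply: (ler_cvg_to lim rhs); apply: nearW => m.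
have d1 : 0 < del m <= 1 by rewrite del0 (le_trans (deld m)).
apply: le_trans (HC (del m) (e m) (k m) d1 (e01 m) (se m)) _.
rewrite le_eqVlt; apply/orP; left; apply/eqP; congr (_ + _).
by rewrite /k natrX /del; field; rewrite addrC natr1 pnatr_eq0.
Qed.

End smooth.

(** The inequalities phi (t + 3 h) <= p t <= phi t are used on opposite sides, the first in the
    product of means and the second in the joint mean, so that h remains only in the product, where
    dominated convergence removes it. *)
Lemma correlation_diagonal (phi : R -> R) (M : R) : continuous phi ->
  (forall s t, s <= t -> phi t <= phi s) -> (forall t, 0 <= phi t <= M) ->
  (\int[mu]_x f (row_of x)) * (\int[mu]_x phi (T (row_of x))) <=
  \int[mu]_x (f (row_of x) * phi (T (row_of x))).
Proof.
move=> cphi dphi phiM.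
have mphi : measurable_fun setT phi by exact: continuous_measurable_fun.
have mphiT c : measurable_fun setT (fun x : n.-tuple gR => phi (T (row_of x) + c)).
  by apply: (measurableT_comp mphi); exact: measurable_funD.
have bI (g : n.-tuple gR -> R) (N : R) : measurable_fun setT g -> (forall x, 0 <= g x <= N) -> rintegrable mu g.
  move=> mg gN; apply: (@bounded_integrable _ _ _ _ N) => // x.
  by have /andP[h1 h2] := gN x; rewrite ger0_norm.
have mf : measurable_fun setT (fun x => f (row_of x)) by exact/measurable_EFinP.
have fM g N : (forall x : R, 0 <= g x <= N) ->
    forall x, 0 <= f (row_of x) * g (T (row_of x)) <= f 0 * N.
  move=> gN x; have /andP[h1 h2] := gN (T (row_of x)); have /andP[h3 h4] := f_bnd (row_of x).
  by rewrite mulr_ge0//=; exact: ler_pM.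
have If0 : 0 <= \int[mu]_x f (row_of x) by apply: Rintegral_ge0.
have le m : (\int[mu]_x f (row_of x)) * (\int[mu]_x phi (T (row_of x) + 3 * m.+1%:R^-1)) <=
    \int[mu]_x (f (row_of x) * phi (T (row_of x))).
  have h0 : 0 < m.+1%:R^-1 :> R by rewrite invr_gt0.
  have [K [p [p1 [p2 [p3 [dp dp1 dp2 pK ph]]]]]] := window_average3 h0 cphi dphi phiM.
  have pM t : 0 <= p t <= M.
    have /andP[h1 h2] := ph t; have /andP[h3 _] := phiM (t + 3 * m.+1%:R^-1).
    by have /andP[_ h4] := phiM t; rewrite (le_trans h3 h1) (le_trans h2 h4).
  have mp := measurable_of_is_derive dp.
  have mpT : measurable_fun setT (fun x : n.-tuple gR => p (T (row_of x))) by exact: measurableT_comp.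
  apply: le_trans (le_trans _ (correlation_smooth dp dp1 dp2 pK pM)) _.
    apply: ler_wpM2l => //; apply: rint_le.
    - by apply: (bI _ M) => // x; exact: phiM.
    - by apply: (bI _ M) => // x; exact: pM.
    - by move=> x; have /andP[] := ph (T (row_of x)).
  apply: rint_le.
  - by apply: (bI _ (f 0 * M)); [exact: measurable_funM|exact: fM].
  - apply: (bI _ (f 0 * M)); last exact: fM.
    by apply: measurable_funM => //; exact: measurableT_comp.
  - by move=> x; apply: ler_wpM2l => //; have /andP[] := ph (T (row_of x)).
have hc : 3 * m.+1%:R^-1 @[m --> \oo] --> (0 : R).
  by rewrite -(mulr0 3); apply: cvgMl_tmp; exact: cvg_harmonic.
have hc' (t : R) : t + 3 * m.+1%:R^-1 @[m --> \oo] --> t.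
  have : t + 3 * m.+1%:R^-1 @[m --> \oo] --> (t + 0 : R); last by rewrite addr0.
  by apply: cvgD; [exact: cvg_cst|exact: hc].
have [_ c] := @rint_dct _ _ _ mu (fun m x => phi (T (row_of x) + 3 * m.+1%:R^-1))
  (fun x => phi (T (row_of x))) (fun=> M) (fun m => mphiT _)
  (fun x => continuous_cvg _ (cphi _) (hc' _))
  (fun m x => ltac:(have /andP[h1 h2] := phiM (T (row_of x) + 3 * m.+1%:R^-1); by rewrite ger0_norm))
  (rintegrable_cst mu M).
exact: (cvgr_to_le (cvgMl_tmp c) (nearW _ le)).
Qed.

End diagonal.

(** * Reduction of the theorem to the diagonal case *)

Lemma continuous_mulmxr (R : realType) n (U : 'M[R]_n) : continuous (fun x : 'rV[R]_n => x *m U).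
Proof.
move=> x; apply: (proj2 (@cvg_ballP _ _ _ (nbhs x) _ _ _)) => r r0.
suff H : \forall y \near x, forall (i : 'I_1) (j : 'I_n), ball ((x *m U) i j) r ((y *m U) i j).
  by apply: filterS H => y Hy; split.
have Fx : Filter (nbhs x) := nbhs_filter x.
apply: (@filter_forall _ _ _ (nbhs x) Fx) => i; apply: (@filter_forall _ _ _ (nbhs x) Fx) => j.
have : continuous (fun y : 'rV[R]_n => (y *m U) i j).
  rewrite (_ : (fun y : 'rV[R]_n => _) = (fun y : 'rV[R]_n => \sum_k (y i k * U k j))); last first.
    by apply/funext => y; rewrite mxE.
  apply: (@continuous_sumr _ _ _ _ (fun k (y : 'rV[R]_n) => y i k * U k j)) => k y.
  apply: (@continuousM _ _ (fun x : 'rV[R]_n => x i k) (cst (U k j)));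
    [exact: coord_continuous|exact: cst_continuous].
by move=> /(_ x)/cvg_ballP; exact.
Qed.

(** [phi] is controlled only on [0, +oo), whereas smoothing takes place on the whole line; freezing
    it at [phi 0] for negative arguments extends continuity, monotonicity and the bounds. *)
Lemma continuous_clamp (R : realType) (phi : R -> R) :
  {within [set t : R | 0 <= t], continuous phi} -> continuous (fun t : R => phi (Num.max t 0)).
Proof.
move=> /subspace_continuousP cphi t.
have t0 : [set t : R | 0 <= t] (Num.max t 0) by rewrite /= le_max lexx orbT.
apply: cvg_comp (cphi _ t0) => P; rewrite /within /= => HP.
have cm : Num.max u 0 @[u --> t] --> Num.max t 0.
  by apply: (@continuous_max R R id (cst 0) t); [exact: cvg_id|exact: cvg_cst].
have h : \forall u \near t, 0 <= Num.max u 0 -> P (Num.max u 0) := cm _ HP.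
suff : \forall u \near t, P (Num.max u 0) by [].
by apply: filterS h => u; apply; rewrite /= le_max lexx orbT.
Qed.

Theorem theorem4p1 (R : realType) (d : nat) (f : 'rV[R]_d -> R)
  (S : 'M[R]_d) (phi : R -> R) :
  continuous f ->
  (forall x, 0 <= f x) ->
  log_concave f ->
  (forall x, f (- x) = f x) ->
  S^T = S ->
  (forall x : 'rV[R]_d, x != 0 -> 0 < qform S x) ->
  {within [set t : R | 0 <= t], continuous phi} ->
  (forall t, 0 <= t -> 0 <= phi t) ->
  (forall s t, 0 <= s -> s <= t -> phi t <= phi s) ->
  (gauss_int (fun x => (f x)%:E) * gauss_int (fun x => (phi (qform S x))%:E)
    <= gauss_int (fun x => (f x * phi (qform S x))%:E))%E.
Proof.
move=> cf f0 lcf sf symS posS cphi phi0 dphi.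
have [U [s [Uinv UU qs]]] := spectral symS.
(* s_i is the value of the form at e_i U, which is nonzero because U is invertible. *)
have s0 i : 0 < s ord0 i.
  have := qs (delta_mx 0 i).
  rewrite (bigD1 i)//= mxE !eqxx expr1n mulr1 big1 ?addr0; last first.
    by move=> j ji; rewrite mxE (negbTE ji) andbF expr0n mulr0.
  move=> <-; apply: posS; apply/eqP => e.
  have := congr1 (fun v => (v *m U^T) ord0 i) e.
  by rewrite -mulmxA UU mulmx1 mul0mx !mxE !eqxx => /eqP; rewrite oner_eq0.
(* Composition with the linear map U keeps f continuous, log-concave and even, and turns the form
   into [dform s]. *)
pose g x := f (x *m U); pose ph t := phi (Num.max t 0).
have q0 x : 0 <= qform S x.
  have [->|x0] := eqVneq x 0; first by rewrite /qform !mul0mx mxE.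
  exact: ltW (posS x x0).
have phE x : phi (qform S x) = ph (qform S x) by rewrite /ph max_l.
have cph : continuous ph by exact: continuous_clamp.
have max0 (t : R) : 0 <= Num.max t 0 by rewrite le_max lexx orbT.
have phb t : 0 <= ph t <= phi 0 by rewrite phi0//= dphi.
have dph t u : t <= u -> ph u <= ph t by move=> tu; rewrite dphi// ge_max !le_max lexx tu orbT.
have cphq : continuous (fun x => ph (qform S x)).
  by move=> x; apply: continuous_comp; [exact: continuous_qform|exact: cph].
have cg : continuous g.
  by move=> x; apply: continuous_comp; [exact: continuous_mulmxr|exact: cf].
have g0 x : 0 <= g x by exact: f0.
have sg x : g (- x) = g x by rewrite /g mulNmx sf.
have lcg : log_concave g.
  by move=> x y l l01; rewrite /g mulmxDl -!scalemxAl; exact: lcf.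
have gb x : 0 <= g x <= g 0 by rewrite g0 log_concave_symm_le.
have T x : qform S (x *m U) = dform s x by exact: qs.
(* Passes from [gauss_int] to [gprob] and rotates by U at once; boundedness makes the extended
   integral finite. *)
have gint (G : 'rV[R]_d -> R) (M : R) : continuous G -> (forall x, 0 <= G x <= M) ->
    gauss_int (fun x => (G x)%:E) = (\int[gprob d]_t G (row_of t *m U))%:E.
  move=> cG GM; have mG := continuous_mrv cG.
  have G0 x : (0 <= (G x)%:E)%E by rewrite lee_fin; have /andP[] := GM x.
  rewrite (gauss_intE mG G0) -(Uinv _ mG G0) (@bounded_EFin_Rintegral _ _ _ _ M)//.
  apply/measurable_EFinP; apply: (mrv_comp mG); apply: mcoord_mul.
  exact: mcoord_row_of.
have fb x : 0 <= f x <= f 0 by rewrite f0 log_concave_symm_le.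
rewrite (_ : (fun x => (phi (qform S x))%:E) = (fun x => (ph (qform S x))%:E)); last first.
  by apply/funext => x; rewrite phE.
rewrite (_ : (fun x => (f x * phi (qform S x))%:E) = (fun x => (f x * ph (qform S x))%:E)); last first.
  by apply/funext => x; rewrite phE.
rewrite (gint f (f 0))// (gint _ (phi 0) cphq)// (gint (fun x => f x * ph (qform S x)) (f 0 * phi 0)).
- rewrite -EFinM lee_fin.
  under [X in _ * X]eq_Rintegral do rewrite T.
  under [X in _ <= X]eq_Rintegral do rewrite T.
  exact: (correlation_diagonal cg g0 lcg sg s0 cph dph phb).
- by move=> x; apply: (@continuousM _ _ f (fun x => ph (qform S x))); [exact: cf|exact: cphq].
- move=> x; have /andP[h1 h2] := fb x; have /andP[h3 h4] := phb (qform S x).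
  by rewrite mulr_ge0//=; exact: ler_pM.
Qed.
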